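(* Let $g\ge2$ and $n\ge0$. Then $$\chi(\overline{\mathcal M}_{g,n})=n!\sum_{k=0}^{3g-3+n}a_{g,n}^k=n!\cdot\Big[\sum_{k=0}^{3g-3+n}\sum_{p=0}^{3g-3}a_{g,0}^p\,A_{g,k}^p(x)\Big]_n,$$ where $[\cdot]_n$ denotes the coefficient of $x^n$ and, with $x=e^{s+1}-1$ (i.e. $s=\log(1+x)-1$), the $A^p_{g,k}$ are given by $$A_{g,0}^p=\cdots=A_{g,p-1}^p=0,\qquad A_{g,p}^p=e^{(2-2g)(s+1)},$$ $$A_{g,k}^p=\sum_{m=0}^{k-p}a_{g,k,-2g+2-m}^p\,e^{(-2g+2-m)(s+1)}\qquad(k>p),$$ with the following polynomials in $s$. For $p=0$: $$a_{g,k,-2g+2}^0=(2-2g)\sum_{l=1}^{k}\frac{s^l}{l!}e_{l-1}(-2g+3,-2g+4,\dots,-2g+k+1),$$ $$a_{g,k,-2g+2-m}^0=\frac{2-2g}{m!}\sum_{l=0}^{k-m}\frac{s^l}{l!}e_{l+m-1}(-2g+3-m,\dots,-2g+k+1-m)\quad(m\ge1).$$ For $p=1$: $$a_{g,k,-2g+2-m}^1=\frac1{m!}\sum_{l=0}^{k-m-1}\frac{s^l}{l!}e_{l+m}(-2g+3-m,\dots,-2g+k+1-m).$$ For $p=2$: $$a_{g,k,-2g+2}^2=k-1+\sum_{l=1}^{k-2}\frac{s^l}{l!}\Big(\sum_{j=-2g+4}^{k-l-2g+2}j(j+2g-3)\,e_{l-1}(j+1,\dots,k-2g+1)\Big),$$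 and for $m\ge1$ $$\begin{aligned}a_{g,k,-2g+2-m}^2=&(-1)^m\binom{2g-3+m}{m}(k-1-m)+\frac{(-1)^m}{m!}\sum_{l=0}^{k-2-m}\frac{s^l}{l!}\Big[\sum_{h=0}^m(-1)^he_{m-h}(2g-2,\dots,2g-3+m)\\&\times\sum_{j=-2g+4}^{k-l-2g+2-m-h}j(j+2g-3)\,e_{l-1+h}(j+1,\dots,k-2g-m+1)\Big].\end{aligned}$$ For $p\ge3$: $$\begin{aligned}a_{g,k,-2g+2-m}^p=\frac{(-1)^m}{m!}\sum_{l=0}^{k-p-m}\frac{s^l}{l!}\Big[&\sum_{h=0}^m(-1)^he_{m-h}(2g-2,\dots,2g-3+m)\\&\times\Big(\sum_{j=-2g+p+1}^{k-l-2g+1-m-h}\binom{j+2g-3}{p-2}e_{l+h}(j+1,\dots,k-2g-m+1)\Big)\Big],\end{aligned}$$ or equivalently $$\begin{aligned}a_{g,k,-2g+2-m}^p=\frac1{m!}\sum_{l=0}^{k-p-m}\frac{s^l}{l!}\Big[&\sum_{j=-2g+p+1}^{-2g+k+1-m-l}\binom{j+2g-3}{p-2}\\&\times e_{m+l}(-2g+3-m,\dots,-2g+2;\,j+1,\dots,-2g+k+1-m)\Big].\end{aligned}$$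
   Context: Stable graphs: a stable graph is a finite graph (loops and multiple edges allowed) with internal edges, each joining two (possibly equal) vertices, and unlabelled external edges, each attached to one vertex. Each vertex $v$ carries a genus $g_v\in\mathbb Z_{\ge0}$; its valence $\mathrm{val}_v$ is the number of half-edges at $v$ (an external edge counts once, a loop twice); stability means $2g_v-2+\mathrm{val}_v>0$ for every $v$. The genus of a connected stable graph $\Gamma$ is $h^1(\Gamma)+\sum_v g_v$. $\mathcal G^c_{g,n}$ is the (finite) set of isomorphism classes of connected stable graphs of genus $g$ with $n$ external edges, $V(\Gamma)$ and $E(\Gamma)$ are the sets of vertices and internal edges, and $\mathrm{Aut}(\Gamma)$ is the automorphism group (acting on vertices and half-edges; external edges may be permuted). For $2g-2+n>0$, $\chi(\mathcal M_{g,n})=(-1)^n\frac{(2g-1)B_{2g}}{(2g)!}(2g+n-3)!$ is the orbifold Euler characteristic of $\mathcal M_{g,n}$ (Harer–Zagier formula), and $a_{g,n}^k$ is the coefficient of $\kappa^k$ in $\widetilde\chi_{g,n}(\kappa):=\sum_{\Gamma\in\mathcal G^c_{g,n}}\frac{\kappa^{|E(\Gamma)|}}{|\mathrm{Aut}(\Gamma)|}\prod_{v}\chi(\mathcal M_{g_v,\mathrm{val}_v})$, a polynomial of degree $3g-3+n$. $\chi(\overline{\mathcal M}_{g,n})$ is the orbifold Euler characteristic of the Deligne–Mumford moduli space; by Bini–Harer, $\chi(\overline{\mathcal M}_{g,n})=n!\,\widetilde\chi_{g,n}(1)$. $e_l$ is the $l$-th elementary symmetric polynomial of the listed arguments (a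 list ''$a,\dots,b$'' means consecutive integers from $a$ to $b$, empty if $b<a$; a semicolon denotes concatenation of lists), with $e_0=1$, $e_l=0$ for $l<0$ or $l$ larger than the number of arguments. Sums with upper limit smaller than lower limit are zero. *)

(* Defs.v *)
From HB Require Import structures.
From mathcomp Require Import all_boot all_order all_fingroup all_algebra.
From mathcomp Require Import generic_quotient.
From mathcomp Require Import all_classical all_reals all_analysis.
(* Not imported: the notations of mpoly clash with those of mathcomp-analysis. *)
From mathcomp Require mpoly.

Set Implicit Arguments.
Unset Strict Implicit.
Unset Printing Implicit Defensive.

Import Order.TTheory GRing.Theory Num.Theory.
Import numFieldNormedType.Exports.

Local Open Scope classical_set_scope.
Local Open Scope ring_scope.

(* A finite graph given by half-edges.  The orbits of size two of the
   involution [flip] are the internal edges and its fixed points are the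
   external edges.  Vertices and half-edges are numbered, so that the graphs
   form a small type; every finite graph is isomorphic to one of these, and only
   isomorphism classes are used below. *)
Record graph := Graph {
  nvert : nat;
  nhalf : nat;
  vert : 'I_nhalf -> 'I_nvert;
  flip : 'I_nhalf -> 'I_nhalf;
  flipK : involutive flip;
  vgenus : 'I_nvert -> nat }.

HB.instance Definition _ := gen_eqMixin graph.
HB.instance Definition _ := gen_choiceMixin graph.

Section GraphInvariants.
Variable G : graph.

Definition legs : {set 'I_(nhalf G)} := [set h | flip h == h]%SET.

Definition edges : {set {set 'I_(nhalf G)}} :=
  [set [set h; flip h] | h in (~: legs)%SET]%SET.

Definition valence (v : 'I_(nvert G)) : nat := #|[set h | vert h == v]%SET|.

Definition vertex_adj : rel 'I_(nvert G) :=
  [rel u v | [exists h : 'I_(nhalf G), (vert h == u) && (vert (flip h) == v)]].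

Definition ncomponents : nat := n_comp vertex_adj predT.

Definition connected_graph : bool := ncomponents == 1%N.

(* First Betti number. *)
Definition h1 : int := #|edges|%:Z - (nvert G)%:Z + ncomponents%:Z.

Definition graph_genus : int := h1 + \sum_(v < nvert G) (vgenus v)%:Z.

(* 2 g_v - 2 + val_v > 0, without subtraction. *)
Definition stable_graph : bool :=
  [forall v : 'I_(nvert G), (2 < 2 * vgenus v + valence v)%N].

End GraphInvariants.

Definition preserves (G1 G2 : graph) (f : 'I_(nvert G1) -> 'I_(nvert G2))
    (h : 'I_(nhalf G1) -> 'I_(nhalf G2)) : bool :=
  [&& [forall i, vert (h i) == f (vert i)],
      [forall i, flip (h i) == h (flip i)] &
      [forall v, vgenus (f v) == vgenus v]].

Definition graph_iso (G1 G2 : graph) : bool :=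
  `[< exists f : 'I_(nvert G1) -> 'I_(nvert G2),
      exists h : 'I_(nhalf G1) -> 'I_(nhalf G2),
      [/\ bijective f, bijective h & preserves f h] >].

Definition graph_aut (G : graph) :
    {set {perm 'I_(nvert G)} * {perm 'I_(nhalf G)}} :=
  [set s : {perm 'I_(nvert G)} * {perm 'I_(nhalf G)} | preserves s.1 s.2]%SET.

Lemma preservesP (G1 G2 : graph) (f : 'I_(nvert G1) -> 'I_(nvert G2))
    (h : 'I_(nhalf G1) -> 'I_(nhalf G2)) :
  reflect [/\ forall i, vert (h i) = f (vert i),
              forall i, flip (h i) = h (flip i) &
              forall v, vgenus (f v) = vgenus v] (preserves f h).
Proof.
apply: (iffP and3P) => -[H1 H2 H3].
  by split=> x; apply/eqP; [exact: (forallP H1) | exact: (forallP H2)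
                           | exact: (forallP H3)].
by split; apply/forallP => x; apply/eqP.
Qed.

Lemma preserves_id (G : graph) : preserves (@id 'I_(nvert G)) (@id 'I_(nhalf G)).
Proof. exact/preservesP. Qed.

Lemma preserves_inv (G1 G2 : graph) (f : 'I_(nvert G1) -> 'I_(nvert G2))
    (h : 'I_(nhalf G1) -> 'I_(nhalf G2)) f' h' :
  cancel f f' -> cancel f' f -> cancel h h' -> cancel h' h ->
  preserves f h -> preserves f' h'.
Proof.
move=> fK f'K hK h'K /preservesP[H1 H2 H3]; apply/preservesP; split=> x.
- by apply: (can_inj fK); rewrite f'K -H1 h'K.
- by apply: (can_inj hK); rewrite h'K -H2 h'K.
- by rewrite -{2}(f'K x) H3.
Qed.

Lemma preserves_comp (G1 G2 G3 : graph)
    (f : 'I_(nvert G1) -> 'I_(nvert G2)) (h : 'I_(nhalf G1) -> 'I_(nhalf G2))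
    (f' : 'I_(nvert G2) -> 'I_(nvert G3)) (h' : 'I_(nhalf G2) -> 'I_(nhalf G3)) :
  preserves f h -> preserves f' h' -> preserves (f' \o f) (h' \o h).
Proof.
move=> /preservesP[H1 H2 H3] /preservesP[K1 K2 K3]; apply/preservesP.
by split=> x /=; [rewrite K1 H1 | rewrite K2 H2 | rewrite K3 H3].
Qed.

Lemma graph_iso_equiv : equiv_class_of graph_iso.
Proof.
split=> [G|G1 G2|G2 G1 G3].
- apply/asboolP; exists id, id.
  by split; [exists id | exists id | exact: preserves_id].
- suff iso_sym A B : graph_iso A B -> graph_iso B A by apply/idP/idP; apply: iso_sym.
  move=> /asboolP[f [h [[f' fK f'K] [h' hK h'K] fh]]].
  apply/asboolP; exists f', h'.
  by split; [exists f | exists h | exact: preserves_inv fh].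
- move=> /asboolP[f [h [bf bh fh]]] /asboolP[f' [h' [bf' bh' fh']]].
  apply/asboolP; exists (f' \o f), (h' \o h).
  by split; [exact: bij_comp | exact: bij_comp | exact: preserves_comp].
Qed.

Canonical graph_iso_rel := EquivRelPack graph_iso_equiv.

Definition graph_class := {eq_quot graph_iso_rel}%qT.

(* A graph whose external edges are numbered by ['I_n]; isomorphisms and
   automorphisms then fix every external edge. *)
Record lgraph (n : nat) := LGraph {
  lg :> graph;
  mark : 'I_n -> 'I_(nhalf lg);
  mark_inj : injective mark;
  mark_legs : codom mark =i legs lg }.

HB.instance Definition _ n := gen_eqMixin (lgraph n).
HB.instance Definition _ n := gen_choiceMixin (lgraph n).

Definition lgraph_iso n (G1 G2 : lgraph n) : bool :=
  `[< exists f : 'I_(nvert G1) -> 'I_(nvert G2),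
      exists h : 'I_(nhalf G1) -> 'I_(nhalf G2),
      [/\ bijective f, bijective h, preserves f h &
          forall i, h (mark G1 i) = mark G2 i] >].

Definition lgraph_aut n (G : lgraph n) :
    {set {perm 'I_(nvert G)} * {perm 'I_(nhalf G)}} :=
  [set s in graph_aut G | [forall i, s.2 (mark G i) == mark G i]]%SET.

Lemma lgraph_iso_equiv n : equiv_class_of (@lgraph_iso n).
Proof.
split=> [G|G1 G2|G2 G1 G3].
- apply/asboolP; exists id, id.
  by split; [exists id | exists id | exact: preserves_id |].
- suff iso_sym A B : @lgraph_iso n A B -> lgraph_iso B A
    by apply/idP/idP; apply: iso_sym.
  move=> /asboolP[f [h [[f' fK f'K] [h' hK h'K] fh mh]]].
  apply/asboolP; exists f', h'.
  by split; [exists f | exists h | exact: preserves_inv fh | move=> i; rewrite -mh].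
- move=> /asboolP[f [h [bf bh fh mh]]] /asboolP[f' [h' [bf' bh' fh' mh']]].
  apply/asboolP; exists (f' \o f), (h' \o h).
  split; [exact: bij_comp | exact: bij_comp | exact: preserves_comp |].
  by move=> i /=; rewrite mh mh'.
Qed.

Canonical lgraph_iso_rel n := EquivRelPack (lgraph_iso_equiv n).

Definition lgraph_class n := {eq_quot lgraph_iso_rel n}%qT.

Fixpoint bernoulli_numbers (n : nat) : seq rat :=
  if n is m.+1 then
    let s := bernoulli_numbers m in
    rcons s (- (\sum_(j < m.+1) 'C(m.+2, j)%:R * s`_j) / m.+2%:R)
  else [:: 1].

Definition bernoulli_number (n : nat) : rat := (bernoulli_numbers n)`_n.

Lemma bernoulli_number_rec (n : nat) :
  \sum_(j < n.+1) 'C(n.+1, j)%:R * bernoulli_number j = (n == 0%N)%:R.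
Proof.
have sz m : size (bernoulli_numbers m) = m.+1.
  by elim: m => //= m IH; rewrite size_rcons IH.
have nthE m j : (j <= m)%N -> (bernoulli_numbers m)`_j = bernoulli_number j.
  elim: m => [|m IH]; first by rewrite leqn0 => /eqP->.
  rewrite leq_eqVlt => /orP[/eqP->//|jm].
  by rewrite /= nth_rcons sz jm IH.
case: n => [|n]; first by rewrite big_ord1 bin0 mul1r.
rewrite big_ord_recr /= {2}/bernoulli_number /= nth_rcons sz ltnn eqxx.
rewrite binSn mulrC divfK ?pnatr_eq0// -sumrB big1 // => i _.
by rewrite nthE ?subrr // -ltnS.
Qed.

(* Orbifold Euler characteristic of M_{g,n} (Harer-Zagier), for 2g-2+n > 0. *)
Definition chi_M (g n : nat) : rat :=
  (-1) ^+ n * (((2 * g)%:R - 1) * bernoulli_number (2 * g)) / (2 * g)`!%:R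
  * (2 * g + n - 3)`!%:R.

Definition chi_vertices (G : graph) : rat :=
  \prod_(v < nvert G) chi_M (vgenus v) (valence v).

Definition Gc (g n : nat) : set graph_class :=
  [set C | let G := repr C in
    [/\ connected_graph G, stable_graph G, graph_genus G = g%:Z & #|legs G| = n]].

(* [\sum_(C \in A)] is a sum with finite support.  [Gc g n] is finite: stability
   bounds the numbers of vertices and edges by 2g-2+n and 3g-3+n. *)
Definition chi_tilde (g n : nat) : {poly rat} :=
  \sum_(C \in Gc g n)
     (chi_vertices (repr C) / #|graph_aut (repr C)|%:R) *: 'X^#|edges (repr C)|.

Definition a_coef (g n k : nat) : rat := (chi_tilde g n)`_k.

Definition lGc (g n : nat) : set (lgraph_class n) :=
  [set C | let G : lgraph n := repr C in
    [/\ connected_graph G, stable_graph G & graph_genus G = g%:Z]].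
Arguments lGc : clear implicits.

(* Orbifold Euler characteristic of the Deligne-Mumford space of stable curves
   with n ordered marked points.  The topological types of such curves are the
   isomorphism classes of stable graphs with numbered external edges; the
   stratum of Gamma is (\prod_v M_{g_v, val_v}) / Aut(Gamma), and the orbifold
   Euler characteristic is additive over the strata. *)
Definition chi_Mbar (g n : nat) : rat :=
  \sum_(C \in lGc g n)
     chi_vertices (repr C : lgraph n) / #|lgraph_aut (repr C : lgraph n)|%:R.

(* Coefficient of x^n in the expansion of f at 0. *)
Definition taylor_coef (R : realType) (f : R -> R) (n : nat) : R :=
  (f^`(n))%classic 0 / n`!%:R.

Definition irange (a b : int) : seq int :=
  [seq a + i%:Z | i <- iota 0 (if (a <= b)%R then `|b - a|.+1 else 0)%N].

Definition elem_sym (l : int) (L : seq int) : int :=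
  if l is Posz i then
    mpoly.meval (fun j : 'I_(size L) => L`_j) (mpoly.mesym (size L) int i)
  else 0.

Section Coefficients.
Variable R : realType.
Implicit Types (g p k m l h : nat) (j : int).

(* The polynomials a^p_{g,k,-2g+2-m}, for k > p and m <= k - p; their variable
   ['X] is s. *)

Definition acoef0 g k m : {poly R} :=
  if m == 0%N then
    (2 - (2 * g)%:R) *:
    \sum_(1 <= l < k.+1)
      ((elem_sym (l%:Z - 1)
          (irange (- 2 * g%:Z + 3) (- 2 * g%:Z + k%:Z + 1)))%:~R
       / l`!%:R) *: 'X^l
  else
    ((2 - (2 * g)%:R) / m`!%:R) *:
    \sum_(0 <= l < (k - m).+1)
      ((elem_sym (l%:Z + m%:Z - 1)
          (irange (- 2 * g%:Z + 3 - m%:Z) (- 2 * g%:Z + k%:Z + 1 - m%:Z)))%:~R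
       / l`!%:R) *: 'X^l.

Definition acoef1 g k m : {poly R} :=
  (m`!%:R)^-1 *:
  \sum_(0 <= l < (k - m - 1).+1)
    ((elem_sym (l%:Z + m%:Z)
        (irange (- 2 * g%:Z + 3 - m%:Z) (- 2 * g%:Z + k%:Z + 1 - m%:Z)))%:~R
     / l`!%:R) *: 'X^l.

Definition acoef2 g k m : {poly R} :=
  if m == 0%N then
    (k%:R - 1)%:P +
    \sum_(1 <= l < (k - 2).+1)
      ((\sum_(j <- irange (- 2 * g%:Z + 4) (k%:Z - l%:Z - 2 * g%:Z + 2))
          j * (j + 2 * g%:Z - 3)
          * elem_sym (l%:Z - 1) (irange (j + 1) (k%:Z - 2 * g%:Z + 1)))%:~R
       / l`!%:R) *: 'X^l
  else
    ((-1) ^+ m * 'C(2 * g - 3 + m, m)%:R * (k%:R - 1 - m%:R))%:P +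
    ((-1) ^+ m / m`!%:R) *:
    \sum_(0 <= l < (k - 2 - m).+1)
      ((\sum_(0 <= h < m.+1)
          (-1) ^+ h
          * elem_sym (m%:Z - h%:Z)
              (irange (2 * g%:Z - 2) (2 * g%:Z - 3 + m%:Z))
          * \sum_(j <- irange (- 2 * g%:Z + 4)
                         (k%:Z - l%:Z - 2 * g%:Z + 2 - m%:Z - h%:Z))
              j * (j + 2 * g%:Z - 3)
              * elem_sym (l%:Z - 1 + h%:Z)
                  (irange (j + 1) (k%:Z - 2 * g%:Z - m%:Z + 1)))%:~R
       / l`!%:R) *: 'X^l.

(* In the next two definitions j >= -2g+p+1, so that j+2g-3 >= p-2 >= 0. *)

Definition acoef3 g p k m : {poly R} :=
  ((-1) ^+ m / m`!%:R) *:
  \sum_(0 <= l < (k - p - m).+1)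
    ((\sum_(0 <= h < m.+1)
        (-1) ^+ h
        * elem_sym (m%:Z - h%:Z)
            (irange (2 * g%:Z - 2) (2 * g%:Z - 3 + m%:Z))
        * \sum_(j <- irange (- 2 * g%:Z + p%:Z + 1)
                       (k%:Z - l%:Z - 2 * g%:Z + 1 - m%:Z - h%:Z))
            'C(absz (j + 2 * g%:Z - 3)%R, p - 2)%:Z
            * elem_sym (l%:Z + h%:Z)
                (irange (j + 1) (k%:Z - 2 * g%:Z - m%:Z + 1)))%:~R
     / l`!%:R) *: 'X^l.

Definition acoef3' g p k m : {poly R} :=
  (m`!%:R)^-1 *:
  \sum_(0 <= l < (k - p - m).+1)
    ((\sum_(j <- irange (- 2 * g%:Z + p%:Z + 1)
                   (- 2 * g%:Z + k%:Z + 1 - m%:Z - l%:Z))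
        'C(absz (j + 2 * g%:Z - 3)%R, p - 2)%:Z
        * elem_sym (m%:Z + l%:Z)
            (irange (- 2 * g%:Z + 3 - m%:Z) (- 2 * g%:Z + 2)
             ++ irange (j + 1) (- 2 * g%:Z + k%:Z + 1 - m%:Z)))%:~R
     / l`!%:R) *: 'X^l.

Definition acoef g p k m : {poly R} :=
  match p with
  | 0 => acoef0 g k m
  | 1 => acoef1 g k m
  | 2 => acoef2 g k m
  | _ => acoef3 g p k m
  end.

(* A^p_{g,k} as a function of s. *)
Definition A_fun g p k (s : R) : R :=
  if (k < p)%N then 0
  else if k == p then expR ((2 - (2 * g)%:R) * (s + 1))
  else \sum_(0 <= m < (k - p).+1)
         (acoef g p k m).[s] * expR ((- (2 * g)%:R + 2 - m%:R) * (s + 1)).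

End Coefficients.

(* Main.v *)
Require Import Defs.
From HB Require Import structures.
From mathcomp Require Import all_boot all_order all_fingroup all_algebra.
From mathcomp Require Import generic_quotient.
From mathcomp Require Import all_classical all_reals all_analysis.
From mathcomp Require Import zify ring lra.
From mathcomp Require mpoly.

Set Implicit Arguments.
Unset Strict Implicit.
Unset Printing Implicit Defensive.

Import Order.TTheory GRing.Theory Num.Theory.
Import numFieldNormedType.Exports.

Local Open Scope ring_scope.

(** The weights chi(M_{g,n}) satisfy chi(M_{g,n+1}) = (2 - 2g - n) chi(M_{g,n}),
    and this relation propagates to the sums over stable graphs.  In a connected
    graph of genus g >= 2 with n+1 external edges, mark one of them and remove
    it.  Either its vertex stays stable; since the numbers 2 - 2g_v - val_v add
    up to 2 - 2g - n, these graphs contribute (2 - 2g - n) times the sum over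
    graphs with n external edges.  Or its vertex has genus 0 and valence 3, has
    weight 1, and sits in the middle of one of the k edges or of one of the n
    external edges of a graph with one edge less.  Hence

      (n+1) a_{n+1}^{k+1} = (2-2g-n) a_n^{k+1} + (n+k) a_n^k

    ([a_coef_rec0], [a_coef_recS]).  To prove this with the automorphism
    factors, the sums over isomorphism classes are first replaced by sums over
    all graphs on fixed finite sets of vertices and half-edges, divided by the
    orders of the two symmetric groups ([count_iso], [class_sum]); there the
    cutting and gluing are bijections ([total_weight_rec]).  The same counting,
    with the external edges as marked half-edges, gives the factor n! between
    graphs with numbered and unnumbered external edges ([chi_Mbar_sum]), hence
    the first formula ([chi_Mbar_a_coef]).

    For the generating function F(x,kappa) = sum a_n^k x^n kappa^k the recursion
    is the linear equation

      (1 + x - kappa x) dF/dx = (2-2g) F + kappa^2 dF/dkappa,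

    so that F is determined by F(0,kappa) = sum_p a_0^p kappa^p, and it is enough
    to solve the equation for the data kappa^p.  Put u = 1 + x = e^(s+1) and
    alpha = 2 - 2g.  The kappa^k-term of the solution is a combination of
    u^(alpha-m), 0 <= m <= k, with polynomials in s as coefficients, and the
    equation becomes a triangular system for these polynomials ([solves]), with
    initial condition at s = -1 ([initial]).  Its solutions have a simple form
    for the data 1 and kappa^(q+1)/(1+kappa)^q: up to constants, they are
    prod_j (d/ds + j) applied to s^N/N!, for j in one or two ranges of integers
    ([solves_const_evol], [solves_geom_evol]).  The operator identities are
    checked termwise; the initial values come from a vanishing finite difference
    ([sum_diffop_shift_eq0], [initial_const_evol], [initial_geom_evol]).  The
    data kappa^p, p >= 2, are binomial combinations of these
    ([initial_monomial_evol]).  Expanding prod_j (d/ds + j) produces elementary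
    symmetric functions of consecutive integers
    ([coef_diffop_divided_power]), which leads to the formulas for p = 0, for
    p = 1, and to the second formula for p >= 3, valid for p = 2 as well.  The
    first formula for p >= 3 follows by splitting the elementary symmetric
    functions of a concatenation ([acoef3_eq]), and the one for p = 2 by another
    summation over j ([acoef2_eq]).

    Finally, the solutions are actual functions of x near 0, and their Taylor
    coefficients satisfy the recursion of the a_n^k ([taylor_recS]) with the same
    initial values, which identifies the two ([taylor_coef_A_fun]). *)

(** * Elementary symmetric polynomials and ranges of integers *)

Arguments elem_sym : simpl never.

Definition elem_sym_gen (L : seq int) : {poly int} := \prod_(j <- L) (1 + j *: 'X).

Lemma elem_symE (i : nat) (L : seq int) : elem_sym i%:Z L = (elem_sym_gen L)`_i.
Proof.
rewrite /elem_sym /mpoly.mesym (big_morph _ (mpoly.mevalD _) (mpoly.meval0 _)).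
rewrite /elem_sym_gen (big_nth 0) big_mkord; under [in RHS]eq_bigr do rewrite addrC.
rewrite bigA_distr coef_sum [LHS]big_mkcond; apply: eq_bigr => h _.
rewrite -big_mkcond /= (eq_bigr (fun j : 'I_(size L) => (L`_j)%:P * 'X)); last first.
  by move=> j _; rewrite mul_polyC.
rewrite big_split /= prodr_const -rmorph_prod coefCM coefXn eq_sym.
case: eqP => _; last by rewrite mulr0.
rewrite mulr1 (big_morph _ (mpoly.mevalM _) (mpoly.meval1 _)).
by apply: eq_bigr => j _; rewrite mpoly.mevalXU.
Qed.

Lemma elem_sym_neg (l : int) L : l < 0 -> elem_sym l L = 0.
Proof. by case: l. Qed.

Lemma elem_sym_nil (l : int) : elem_sym l [::] = (l == 0)%:R.
Proof.
case: l => [i|i]; last by rewrite elem_sym_neg.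
by rewrite elem_symE /elem_sym_gen big_nil coef1.
Qed.

Lemma elem_sym_cons (l : int) j L :
  elem_sym l (j :: L) = elem_sym l L + j * elem_sym (l - 1) L.
Proof.
case: l => [i|i]; last by rewrite !elem_sym_neg ?mulr0 ?addr0 //; lia.
rewrite !elem_symE /elem_sym_gen big_cons mulrDl mul1r coefD -scalerAl coefZ coefXM.
case: i => [|i] /=; first by [].
by rewrite -!elem_symE; congr (_ + _ * elem_sym _ _); lia.
Qed.

Lemma elem_sym_large (l : int) L : (size L)%:Z < l -> elem_sym l L = 0.
Proof.
elim: L l => [|j L IH] l /= Ll; first by rewrite elem_sym_nil; case: eqP => // ?; lia.
by rewrite elem_sym_cons !IH ?mulr0 ?addr0 //; lia.
Qed.

Lemma elem_sym0 L : elem_sym 0 L = 1.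
Proof. by elim: L => [|j L IH]; rewrite ?elem_sym_nil // elem_sym_cons IH elem_sym_neg // mulr0
  addr0. Qed.

Lemma elem_sym_cat (m l : nat) L L' :
  elem_sym (m%:Z + l%:Z) (L ++ L') =
  \sum_(0 <= i < (m + l).+1) elem_sym (m%:Z + l%:Z - i%:Z) L * elem_sym i%:Z L'.
Proof.
rewrite -PoszD elem_symE /elem_sym_gen big_cat /= mulrC coefM big_mkord.
apply: eq_bigr => i _; rewrite -!elem_symE mulrC; congr (elem_sym _ _ * _).
by have := ltn_ord i; lia.
Qed.

Lemma elem_sym_opp (l : nat) L :
  elem_sym l%:Z [seq - j | j <- L] = (-1) ^+ l * elem_sym l%:Z L.
Proof.
suff H (k : int) : elem_sym k [seq - j | j <- L] = (-1) ^+ `|k| * elem_sym k L by exact: H.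
elim: L k => [|j L IH] k /=; first by rewrite elem_sym_nil; case: eqP => [->|];
  rewrite ?mulr0 ?mulr1 ?expr0.
rewrite !elem_sym_cons !IH mulrDr; congr (_ + _).
have [k0|k0] := leP k 0; first by rewrite elem_sym_neg ?mulr0 //; lia.
have -> : `|k|%N = `|k - 1|.+1 by lia.
by rewrite exprS; ring.
Qed.

Lemma irange_nil a b : b < a -> irange a b = [::].
Proof. by move=> ba; rewrite /irange leNgt ba. Qed.

Lemma irangeE (a : int) (n : nat) (b : int) : b = a + n%:Z - 1 -> irange a b =
  [seq a + i%:Z | i <- iota 0 n].
Proof.
move=> ->; rewrite /irange; case: n => [|n].
  by case: ifP => // ?; lia.
by case: ifP => [_|]; [congr map; congr iota; lia | lia].
Qed.

Lemma size_irange a b : (size (irange a b))%:Z = if a <= b then b - a + 1 else 0.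
Proof. by rewrite /irange size_map size_iota; case: ifP => // ?; lia. Qed.

Lemma irange_cons a b : a <= b -> irange a b = a :: irange (a + 1) b.
Proof.
move=> ab; have [n nE] : exists n : nat, b - a = n%:Z by exists `|b - a|%N; lia.
rewrite (@irangeE a n.+1) ?(@irangeE (a+1) n) //=; [|lia..].
rewrite addr0; congr (_ :: _); rewrite -(addn0 1%N) iotaDl -map_comp.
by apply: eq_map => i /=; lia.
Qed.

Lemma irange_rcons a b : a <= b -> irange a b = rcons (irange a (b - 1)) b.
Proof.
move=> ab; have [n nE] : exists n : nat, b - a = n%:Z by exists `|b - a|%N; lia.
rewrite (@irangeE a n.+1) ?(@irangeE a n); [|lia..].
by rewrite -cats1 -[n.+1]addn1 iotaD map_cat /=; congr (_ ++ [:: _]); lia.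
Qed.

(** * Differential operators with constant coefficients *)

Section Action.
Variable K : numFieldType.
Implicit Types (p q v w : {poly K}).

(** The polynomial w in the derivation d/ds, acting on p. *)
Definition diffop w p : {poly K} := \sum_(i < size w) w`_i *: p^`(i).

Lemma diffop_widen n w p : (size w <= n)%N -> diffop w p = \sum_(i < n) w`_i *: p^`(i).
Proof.
move=> wn; rewrite /diffop (big_ord_widen n (fun i => w`_i *: p^`(i))) //.
rewrite [LHS]big_mkcond /=; apply: eq_bigr => i _; case: ltnP => // wi.
by rewrite nth_default // scale0r.
Qed.

Lemma diffopDl v w p : diffop (v + w) p = diffop v p + diffop w p.
Proof.
set n := maxn (size v) (size w).
rewrite !(@diffop_widen n) ?leq_maxl ?leq_maxr ?(leq_trans (size_polyD _ _)) //.
by rewrite -big_split; apply: eq_bigr => i _; rewrite coefD scalerDl.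
Qed.

Lemma diffop0l p : diffop 0 p = 0.
Proof. by rewrite /diffop size_poly0 big_ord0. Qed.

Lemma diffopZl c w p : diffop (c *: w) p = c *: diffop w p.
Proof.
rewrite (@diffop_widen (size w)) ?size_scale_leq // /diffop scaler_sumr.
by apply: eq_bigr => i _; rewrite coefZ scalerA.
Qed.

Lemma diffop_suml (I : Type) (r : seq I) (P : pred I) (F : I -> {poly K}) p :
  diffop (\sum_(i <- r | P i) F i) p = \sum_(i <- r | P i) diffop (F i) p.
Proof. exact: (big_morph (diffop^~ p) (fun v w => diffopDl v w p) (diffop0l p)). Qed.

Lemma diffopZr c w p : diffop w (c *: p) = c *: diffop w p.
Proof.
rewrite /diffop scaler_sumr; apply: eq_bigr => i _.
by rewrite derivnZ !scalerA mulrC.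
Qed.

Lemma diffop_derivr w p : diffop w p^`() = (diffop w p)^`().
Proof.
rewrite /diffop raddf_sum; apply: eq_bigr => i _ /=.
by rewrite derivZ -derivnS derivSn.
Qed.

Lemma diffop0r w : diffop w 0 = 0.
Proof. by have := diffopZr 0 w 0; rewrite !scale0r. Qed.

Lemma diffopC c p : diffop c%:P p = c *: p.
Proof. by rewrite (@diffop_widen 1) ?size_polyC_leq1 // big_ord1 coefC. Qed.

Lemma diffop1 p : diffop 1 p = p.
Proof. by rewrite diffopC scale1r. Qed.

Lemma diffopMX w p : diffop (w * 'X) p = diffop w p^`().
Proof.
rewrite (@diffop_widen (size w).+1) ?(leq_trans (size_polyMleq _ _)) ?size_polyX ?addn2 //.
rewrite big_ord_recl coefMX scale0r add0r /diffop; apply: eq_bigr => i _.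
by rewrite coefMX lift0 derivSn.
Qed.

(** Composition of operators is the product of polynomials, so that identities
    between operators become identities in a commutative ring. *)
Lemma diffopM v w p : diffop (v * w) p = diffop v (diffop w p).
Proof.
elim/poly_ind: v p => [|v c IH] p; first by rewrite mul0r !diffop0l.
rewrite mulrDl !diffopDl mul_polyC diffopZl diffopC; congr (_ + _).
by rewrite mulrAC !diffopMX IH diffop_derivr.
Qed.

Lemma diffop_XaddC c w p : diffop (('X + c%:P) * w) p = (diffop w p)^`() + c *: diffop w p.
Proof. by rewrite diffopM diffopDl diffopC -['X]mul1r diffopMX diffop1. Qed.

Definition divided_power (N : nat) : {poly K} := N`!%:R^-1 *: 'X^N.

Lemma fact_neq0 n : n`!%:R != 0 :> K.
Proof. by rewrite pnatr_eq0 -lt0n fact_gt0. Qed.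

Lemma deriv_divided_power N : (divided_power N.+1)^`() = divided_power N.
Proof.
rewrite /divided_power derivZ derivXn -[_ *+ N.+1]scaler_nat scalerA; congr (_ *: _).
by rewrite factS natrM invfM mulrAC mulVf ?mul1r // pnatr_eq0.
Qed.

Lemma deriv_divided_power0 : (divided_power 0)^`() = 0.
Proof. by rewrite /divided_power expr0 alg_polyC derivC. Qed.

(** Choosing d/ds in size L - i of the factors and a number j in the other i
    lowers s^N/N! to s^l/l! with l = N - size L + i; this is the source of
    every product s^l/l! times an elementary symmetric polynomial. *)
Lemma coef_diffop_divided_power (L : seq int) N l :
  (diffop (\prod_(j <- L) ('X + j%:~R%:P)) (divided_power N))`_l =
  (elem_sym (l%:Z + (size L)%:Z - N%:Z) L)%:~R / l`!%:R.
Proof.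
elim: L l => [|j L IH] l.
  rewrite big_nil diffop1 coefZ coefXn elem_sym_nil /= addr0 subr_eq0 eqz_nat.
  by case: eqP => [->|_]; rewrite ?mulr1 ?mul1r ?mulr0 ?mul0r.
rewrite big_cons diffop_XaddC coefD coef_deriv coefZ !IH elem_sym_cons intrD intrM.
have -> : l%:Z + (size (j :: L))%:Z - N%:Z - 1 = l%:Z + (size L)%:Z - N%:Z by rewrite /=; lia.
have -> : l%:Z + (size (j :: L))%:Z - N%:Z = l.+1%:Z + (size L)%:Z - N%:Z by rewrite /=; lia.
rewrite mulrDl -[in RHS]mulrA; congr (_ + _).
rewrite -[_ *+ l.+1]mulr_natr -mulrA factS natrM invfM; congr (_ * _).
by rewrite mulrAC mulVf ?mul1r // pnatr_eq0.
Qed.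

End Action.

(** * Falling factorials in a commutative ring *)

Section FallingFactorial.
Variable A : comNzRingType.
Implicit Types x y : A.

Definition falling x m := \prod_(i < m) (x - i%:R).

Lemma falling0 x : falling x 0 = 1. Proof. exact: big_ord0. Qed.

Lemma fallingS x m : falling x m.+1 = falling x m * (x - m%:R).
Proof. exact: big_ord_recr. Qed.

Lemma fallingSl x m : falling x m.+1 = x * falling (x - 1) m.
Proof.
rewrite /falling big_ord_recl subr0; congr (_ * _).
by apply: eq_bigr => i _; rewrite lift0 -natr1; ring.
Qed.

Lemma falling_add x m n : falling x (m + n) = falling x m * falling (x - m%:R) n.
Proof.
rewrite /falling big_split_ord; congr (_ * _).
by apply: eq_bigr => i _ /=; rewrite natrD opprD addrA.
Qed.

Lemma falling_vandermonde x y m :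
  falling (x + y) m = \sum_(i < m.+1) (falling x i * falling y (m - i)) *+ 'C(m, i).
Proof.
elim: m => [|m IH]; first by rewrite big_ord1 !falling0 mulr1.
rewrite fallingS IH mulr_suml.
rewrite (eq_bigr (fun i : 'I_m.+1 => (falling x i.+1 * falling y (m - i)) *+ 'C(m, i)
   + (falling x i * falling y (m.+1 - i)) *+ 'C(m, i))); last first.
  move=> i _; have im : (i <= m)%N by rewrite -ltnS.
  rewrite -mulrnAl -mulrnDl subSn // !fallingS natrB //; ring.
rewrite big_split /=.
have -> : \sum_(i < m.+1) falling x i * falling y (m.+1 - i) *+ 'C(m, i) =
    \sum_(i < m.+2) falling x i * falling y (m.+1 - i) *+ 'C(m, i).
  by rewrite [RHS]big_ord_recr /= bin_small // mulr0n addr0.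
rewrite [X in _ + X]big_ord_recl [RHS]big_ord_recl !bin0 addrCA; congr (_ + _).
by rewrite -big_split; apply: eq_bigr => i _; rewrite /= -mulrnDr subSS binS addnC.
Qed.
End FallingFactorial.

Lemma falling_rmorph (A B : comNzRingType) (f : {rmorphism A -> B}) x m :
  f (falling x m) = falling (f x) m.
Proof. by rewrite rmorph_prod; apply: eq_bigr => i _; rewrite rmorphB rmorph_nat. Qed.

Lemma falling_nat (A : comNzRingType) (N a : nat) : falling (N%:R : A) a = (N ^_ a)%:R.
Proof.
elim: a N => [|a IH] N; first by rewrite falling0 ffactn0.
rewrite fallingSl; case: N => [|N]; first by rewrite mul0r ffact0n.
by rewrite -natr1 addrK IH ffactSS natrM natr1.
Qed.

(** The operators attached to ranges of consecutive integers are falling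
    factorials in d/ds. *)
Lemma prod_irange_falling (K : numFieldType) (b : int) m :
  \prod_(j <- irange (b - m%:Z + 1) b) ('X + j%:~R%:P) = falling ('X + b%:~R%:P : {poly K}) m.
Proof.
elim: m => [|m IH].
  by rewrite irange_nil ?big_nil ?falling0 //; lia.
rewrite irange_cons; last by lia.
have -> : b - m.+1%:Z + 1 + 1 = b - m%:Z + 1 by lia.
rewrite big_cons IH fallingS mulrC; congr (_ * _).
rewrite -[in RHS]addrA -[m%:R](rmorph_nat (@polyC K)) -polyCB; congr (_ + _%:P).
have -> : b - m.+1%:Z + 1 = b - m%:Z by lia.
by rewrite intrB.
Qed.

(** * A vanishing sum at s = -1 *)

Section Init.
Variable K : numFieldType.
Implicit Types (P Q : {poly K}).

(** The M-th finite difference lowers the degree by M. *)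
Lemma finite_difference_eq0 M Q : (size Q <= M)%N ->
  \sum_(N < M.+1) (-1) ^+ N * 'C(M, N)%:R * Q.[N%:R] = 0.
Proof.
elim: M Q => [|M IH] Q.
  by rewrite leqn0 size_poly_eq0 => /eqP->; rewrite big1 // => i _; rewrite horner0 mulr0.
elim/poly_ind: Q => [|Q c _] szQ.
  by rewrite big1 // => i _; rewrite horner0 mulr0.
have szQ' : (size Q <= M)%N.
  move: szQ; rewrite size_MXaddC; case: ifP => // /andP[/eqP-> _] _.
  by rewrite size_poly0.
under eq_bigr do rewrite hornerMXaddC mulrDr.
rewrite big_split /=.
rewrite [X in _ + X = _](_ : _ = 0); last first.
  rewrite -mulr_suml.
  have -> : \sum_(i < M.+2) (-1) ^+ i * 'C(M.+1, i)%:R = (1 - 1 : K) ^+ M.+1.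
    by rewrite exprBn; apply: eq_bigr => i _; rewrite !expr1n !mulr1 mulr_natr.
  by rewrite subrr expr0n mul0r.
rewrite addr0 big_ord_recl !mulr0 add0r.
have := IH (Q \Po ('X + 1%:P)); rewrite size_comp_poly2 ?size_XaddC //.
move=> /(_ szQ') /(congr1 ( *%R (- M.+1%:R))); rewrite mulr0 => E0; rewrite -[RHS]E0.
rewrite mulr_sumr; apply: eq_bigr => i _; rewrite lift0 horner_comp !hornerE natr1.
have := mul_bin_diag M.+1 i => /(congr1 (fun n => n%:R : K)); rewrite !natrM => E.
rewrite exprS /=; transitivity (- (-1) ^+ i * (i.+1%:R * 'C(M.+1, i.+1)%:R) * Q.[i.+1%:R]);
  first by ring.
by rewrite -E; ring.
Qed.

Lemma size_fallingX a : size (falling ('X : {poly K}) a) = a.+1.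
Proof.
elim: a => [|a IH]; first by rewrite falling0 size_poly1.
rewrite fallingS size_Mmonic ?IH ?addn2 //.
- rewrite -(rmorph_nat (@polyC K)) size_XsubC; lia.
- by rewrite -size_poly_eq0 IH.
- by rewrite -(rmorph_nat (@polyC K)) monicXsubC.
Qed.

Lemma size_falling_subXn a : (size (falling ('X : {poly K}) a - 'X^a)%R <= a)%N.
Proof.
elim: a => [|a IH]; first by rewrite falling0 expr0 subrr size_poly0.
have -> : (falling 'X a.+1 : {poly K}) - 'X^(a.+1) =
  (falling 'X a - 'X^a) * 'X - a%:R *: falling 'X a.
  rewrite fallingS exprS -[a%:R *: _]mul_polyC -(rmorph_nat (@polyC K)); ring.
rewrite (leq_trans (size_polyD _ _)) // geq_max size_polyN; apply/andP; split.
  by rewrite (leq_trans (size_polyMleq _ _)) // size_polyX addn2 ltnS.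
by rewrite (leq_trans (size_scale_leq _ _)) // size_fallingX.
Qed.

Lemma diffop_comp_XaddC P n c p : (size P <= n)%N ->
  diffop (P \Po ('X + c%:P)) p = \sum_(a < n) P^`N(a).[c] *: p^`(a).
Proof.
move=> szP; rewrite addrC /comp_poly (@nderiv_taylor_wide _ n); last 2 first.
- exact: mulrC.
- by rewrite size_map_polyC.
rewrite diffop_suml; apply: eq_bigr => a _.
rewrite nderivn_map horner_map /= mul_polyC diffopZl; congr (_ *: _).
elim: (nat_of_ord a) p => [|i IH] q; first by rewrite expr0 diffop1.
by rewrite exprSr diffopMX IH derivSn.
Qed.

(** Taylor expansion of P(d/ds + N) at N and
    (d/ds)^a s^N = N (N-1) ... (N-a+1) s^(N-a) show that (P(d/ds + N) s^N)(-1)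
    is (-1)^N times this polynomial evaluated at N; it has the virtue that its
    degree can be bounded independently of N. *)
Definition twist n P : {poly K} :=
  \sum_(a < n) (-1) ^+ a *: (P^`N(a) * falling 'X a).

Lemma twistE n P N : (size P <= n)%N ->
  (diffop (P \Po ('X + N%:R%:P)) 'X^N).[-1] = (-1) ^+ N * (twist n P).[N%:R].
Proof.
move=> szP; rewrite (diffop_comp_XaddC _ _ szP) !horner_sum mulr_sumr.
apply: eq_bigr => a _; rewrite hornerZ hornerZ hornerM derivnXn hornerMn hornerXn.
have -> : (falling 'X a : {poly K}).[N%:R] = (N ^_ a)%:R.
  by rewrite -falling_nat -[LHS]horner_evalE falling_rmorph /= horner_evalE hornerX.
have [aN|Na] := leqP a N; last by rewrite ffact_small // !mulr0.
rewrite -[_ *+ N ^_ a]mulr_natr (_ : (-1) ^+ N = (-1) ^+ (N - a) * (-1) ^+ a :> K);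
  last by rewrite -exprD subnK.
have E : (-1) ^+ a * (-1) ^+ a = 1 :> K by rewrite -expr2 sqrr_sign.
rewrite /=.
transitivity ((P^`N(a)).[N%:R] * ((-1) ^+ (N - a) * (N ^_ a)%:R) * ((-1) ^+ a * (-1) ^+ a));
  last by ring.
by rewrite E mulr1.
Qed.

(** A priori the degree is at most M.  Replacing the falling factorial of order a
    by X^a changes it only in lower degree, and for P = X^i the sum then
    becomes (1-1)^i X^i, so that the terms of degree M cancel. *)
Lemma size_twist M P : (0 < M)%N -> (size P <= M.+1)%N -> (size (twist M.+1 P) <= M)%N.
Proof.
move=> M0 szP.
have -> : twist M.+1 P = \sum_(i < M.+1) P`_i *: twist M.+1 'X^i.
  rewrite /twist; under [RHS]eq_bigr do rewrite scaler_sumr.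
  rewrite exchange_big; apply: eq_bigr => a _ /=.
  under [RHS]eq_bigr do rewrite scalerA mulrC -scalerA scalerAl -nderivnZ.
  rewrite -scaler_sumr -mulr_suml; congr (_ *: (_ * _)).
  rewrite -(big_morph (nderivn a) (nderivnD a) (raddf0 (nderivn a))); congr nderivn.
  rewrite -[LHS](@coefK _ P) poly_def.
  rewrite (big_ord_widen M.+1 (fun i => P`_i *: 'X^i)) // big_mkcond /=.
  apply: eq_bigr => i _; case: ltnP => // wi; by rewrite nth_default // scale0r.
apply: (leq_trans (size_sum _ _ _)); apply/bigmax_leqP => i _.
apply: (leq_trans (size_scale_leq _ _)).
have iM : (i <= M)%N by rewrite -ltnS.
have -> : twist M.+1 'X^i =
    \sum_(a < M.+1) (-1) ^+ a *: (('X^(i - a) *+ 'C(i,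
      a)) * (falling 'X a - 'X^a)) + ((i == 0 :> nat)%:R)%:P.
  have -> : ((i == 0 :> nat)%:R)%:P = \sum_(a < M.+1) (-1) ^+ a *: (('X^(i - a) *+ 'C(i,
    a)) * 'X^a) :> {poly K}.
    transitivity ((1 - 1 : K) ^+ i *: 'X^i : {poly K}).
      rewrite subrr expr0n; case: eqP => [->|_]; last by rewrite scale0r.
      by rewrite expr0 scale1r.
    rewrite exprBn scaler_suml (big_ord_widen M.+1 (fun a => ((-1) ^+ a * 1 ^+ (i - a) * 1 ^+ a
      *+ 'C(i, a)) *: 'X^i)) //.
    rewrite big_mkcond /=; apply: eq_bigr => a _; rewrite ltnS.
    case: leqP => [ai|ia]; last by rewrite bin_small // mulr0n mul0r scaler0.
    by rewrite !expr1n !mulr1 mulrnAl -exprD subnK // -scalerMnl scalerMnr.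
  rewrite -big_split; apply: eq_bigr => a _ /=.
  by rewrite -scalerDr -mulrDr subrK nderivnXn.
apply: (leq_trans (size_polyD _ _)); rewrite geq_max; apply/andP; split; last first.
  by apply: (leq_trans (size_polyC_leq1 _)).
apply: (leq_trans (size_sum _ _ _)); apply/bigmax_leqP => a _.
apply: (leq_trans (size_scale_leq _ _)).
have [ai|ia] := leqP a i; last by rewrite bin_small // mulr0n mul0r size_poly0.
apply: (leq_trans (size_polyMleq _ _)).
apply: leq_trans iM; rewrite -subn1 leq_subLR add1n (_ : i.+1 = (i - a).+1 + a)%N;
  last by rewrite addSn subnK.
apply: leq_add; last exact: size_falling_subXn.
by rewrite -scaler_nat (leq_trans (size_scale_leq _ _)) // size_polyXn.
Qed.

(** By the degree bound, this is an M-th finite difference of a polynomial of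
    degree less than M.  The sign (-1)^N that the finite difference needs comes
    from the evaluation at s = -1. *)
Lemma sum_diffop_shift_eq0 M P : (0 < M)%N -> (size P <= M.+1)%N ->
  \sum_(N < M.+1) 'C(M, N)%:R * (diffop (P \Po ('X + N%:R%:P)) 'X^N).[-1] = 0.
Proof.
move=> M0 szP; rewrite -[RHS](finite_difference_eq0 (size_twist M0 szP)).
apply: eq_bigr => N _; rewrite (twistE _ szP); ring.
Qed.

End Init.

(** * Solutions of the differential equation *)

Section Families.
Variable K : numFieldType.
Variable al : int.
Let alpha : K := al%:~R.
Implicit Types (T : nat -> nat -> {poly K}) (c : nat -> nat -> {poly K}).

(** Let F = sum_(k,m) c_{k,m}(s) u^(alpha-m) kappa^k with u = 1 + x = e^(s+1).
    Since u d/du sends c u^(alpha-m) to (c' + (alpha-m) c) u^(alpha-m), these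
    are the equations between coefficients of
    (1 + x - kappa x) dF/dx = alpha F + kappa^2 dF/dkappa. *)
Definition solves c : Prop :=
  [/\ forall k m, (k < m)%N -> c k m = 0,
      (c 0 0)^`() = 0,
      forall k, (c k.+1 0)^`() = (c k 0)^`() + (alpha + k%:R) *: c k 0 &
      forall k m, (c k.+1 m.+1)^`() - m.+1%:R *: c k.+1 m.+1 =
        (c k m.+1)^`() + (alpha + k%:R - m.+1%:R) *: c k m.+1
        - ((c k m)^`() + (alpha - m%:R) *: c k m)].

(** The coefficient of kappa^k at x = 0, where u = 1 and s = -1. *)
Definition initial c k : K := \sum_(m < k.+1) (c k m).[-1].

Lemma solves_sum (I : Type) (r : seq I) (w : I -> K) (c : I -> nat -> nat -> {poly K}) :
  (forall i, solves (c i)) -> solves (fun k m => \sum_(i <- r) w i *: c i k m).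
Proof.
move=> H.
have dS (f : I -> {poly K}) : (\sum_(i <- r) f i)^`() = \sum_(i <- r) (f i)^`().
  by rewrite raddf_sum.
split.
- by move=> k m km; rewrite big1 // => i _; have [E _ _ _] := H i; rewrite E ?scaler0.
- by rewrite dS big1 // => i _ /=; rewrite derivZ; have [_ E _ _] := H i; rewrite E scaler0.
- move=> k; rewrite !dS scaler_sumr -big_split; apply: eq_bigr => i _ /=.
  by have [_ _ E _] := H i; rewrite !derivZ E scalerDr; congr (_ + _); rewrite !scalerA mulrC.
- move=> k m; rewrite !dS !scaler_sumr -!big_split -!sumrB.
  apply: eq_bigr => i _ /=; have [_ _ _ E] := H i.
  by rewrite !derivZ !scalerA ![_ * w i]mulrC -!scalerA -!scalerDr -!scalerBr E.
Qed.

(** In the solutions of interest c_{k,m} has degree at most N = k - m - d in s.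
    Indexing by m and N makes the system separate into one relation in N and one
    in m. *)
Definition shifted d T k m := if (m + d <= k)%N then T m (k - m - d)%N else 0.

(** The first relation is the equation for m = 0, extended to all m.  The second
    one then turns the coupling of m and m+1 into an identity. *)
Lemma solves_shifted d T :
  (forall m, (T m 0)^`() = 0) ->
  (forall m N, (T m N.+1)^`() = (T m N)^`() + (alpha + d%:R + N%:R) *: T m N) ->
  (forall m N, (T m N)^`() + (alpha - m%:R) *: T m N = m.+1%:R *: T m.+1 N) ->
  solves (shifted d T).
Proof.
move=> T0 T1 T2; rewrite /shifted; split.
- by move=> k m km; rewrite leqNgt (leq_trans km) // leq_addr.
- by rewrite leqn0; case: d {T1} => [|d] /=; rewrite ?T0 ?deriv0.
- move=> k; rewrite !add0n !subn0.
  have [dk|kd|->] := ltngtP d k.+1; last first.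
  + by rewrite subnn T0 ltnn deriv0 scaler0 addr0.
  + by rewrite leqNgt (ltn_trans _ kd) //= deriv0 scaler0 addr0.
  + rewrite -ltnS dk subSn // T1; congr (_ + _ *: _).
    by rewrite -addrA -natrD subnKC.
- move=> k m; rewrite addSn ltnS.
  have [mk|km] := leqP (m + d) k; last first.
    have -> : (m + d < k)%N = false by lia.
    by rewrite !deriv0 !scaler0 !addr0 !subr0.
  rewrite subSS T2.
  move: mk; rewrite leq_eqVlt => /orP[/eqP<-|mk].
    rewrite ltnn deriv0 scaler0 addr0 add0r.
    by rewrite addKn subnn T0 sub0r.
  rewrite mk; congr (_ - _).
  have -> : (k - m - d = (k - m.+1 - d).+1)%N by lia.
  rewrite T1; congr (_ + _ *: _).
  have -> : k = ((k - m.+1 - d) + d + m.+1)%N by lia.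
  rewrite !natrD (_ : (k - m.+1 - d + d + m.+1 - m.+1 - d)%N = (k - m.+1 - d)%N) //; last by lia.
  ring.
Qed.

Lemma falling_top (a : K) N : falling ('X + (a + N.+1%:R)%:P) N.+1 =
  ('X + (a + N.+1%:R)%:P) * falling ('X + (a + N%:R)%:P) N.
Proof.
by rewrite fallingSl -addrA -polyC1 -polyCB -natr1 addrA addrK.
Qed.

(** The evolution of the datum kappa^(q+1)/(1+kappa)^q, up to the shift by
    q + 1.  Raising m adds a factor of the left falling factorial, raising N a
    factor of the right one, so that the two relations of the system hold
    separately. *)
Definition geom_evol (q m N : nat) : {poly K} :=
  m`!%:R^-1 *: diffop (falling ('X + alpha%:P) m * falling ('X + (alpha + q%:R + N%:R)%:P) N)
    (divided_power K N).

Lemma factS_inv m : (m`!%:R^-1 : K) = m.+1%:R * (m.+1)`!%:R^-1.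
Proof. by rewrite factS natrM invfM mulrA mulfV ?mul1r // pnatr_eq0. Qed.

Lemma solves_geom_evol q : solves (shifted q.+1 (geom_evol q)).
Proof.
apply: solves_shifted => [m|m N|m N]; rewrite /geom_evol.
- by rewrite derivZ -diffop_derivr deriv_divided_power0 diffop0r scaler0.
- rewrite falling_top mulrCA [LHS]derivZ -[in LHS]diffop_derivr deriv_divided_power diffop_XaddC.
  rewrite scalerDr derivZ; congr (_ + _); rewrite !scalerA mulrC; congr (_ * _ *: _).
  by rewrite -!natr1; ring.
- rewrite derivZ scalerA [(alpha - _) * _]mulrC -scalerA -scalerDr -diffop_XaddC mulrA.
  rewrite polyCB (rmorph_nat (@polyC K)) addrA [_ * falling _ m]mulrC -fallingS.
  by rewrite factS_inv scalerA.
Qed.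

(** The evolution of the datum 1.  The general solution for the datum f is
    lambda^alpha f(kappa/(1 - kappa log lambda)), where
    lambda = u + kappa (1 - lambda + lambda log lambda); these are the
    coefficients of lambda^alpha given by Lagrange inversion.  The falling
    factorial has order m + j - 1, whence the separate value at m = j = 0. *)
Definition const_evol (m j : nat) : {poly K} :=
  if (m + j == 0)%N then 1 else
  (alpha / m`!%:R) *:
    diffop (falling ('X + (alpha + j%:R - 1)%:P) (m + j).-1) (divided_power K j).

Lemma solves_const_evol : solves (shifted 0 const_evol).
Proof.
have Z1 : const_evol 1 0 = alpha%:P.
  by rewrite /const_evol /= falling0 diffop1 /divided_power divr1 expr0 -[_^-1%R]/(1^-1) invr1
    scale1r alg_polyC.
apply: solves_shifted => [m|m j|m j].
- rewrite /const_evol; case: eqP => _; first by rewrite derivC.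
  by rewrite derivZ -diffop_derivr deriv_divided_power0 diffop0r scaler0.
- have [/eqP|mj] := boolP (m + j == 0)%N.
    move=> /eqP; rewrite addn_eq0 => /andP[/eqP-> /eqP->].
    rewrite /const_evol /= falling0 diffop1 derivZ deriv_divided_power derivC /divided_power
      expr0 add0r !addr0 divr1.
    by rewrite -[(0`!)%:R^-1]/(1^-1) invr1 scale1r.
  rewrite /const_evol (negPf mj) addnS /=.
  have -> : (m + j = (m + j).-1.+1)%N by lia.
  rewrite fallingSl /=.
  have -> : 'X + (alpha + j.+1%:R - 1)%:P - 1 = 'X + (alpha + j%:R - 1)%:P :> {poly K}.
    by rewrite -natr1 !polyCB !polyCD polyC1; ring.
  rewrite [LHS]derivZ -[in LHS]diffop_derivr deriv_divided_power diffop_XaddC.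
  rewrite scalerDr derivZ; congr (_ + _); rewrite !scalerA mulrC; congr (_ * _ *: _).
  by ring.
- have [/eqP|mj] := boolP (m + j == 0)%N.
    move=> /eqP; rewrite addn_eq0 => /andP[/eqP-> /eqP->].
    by rewrite Z1 /const_evol /= derivC add0r subr0 scale1r alg_polyC.
  rewrite /const_evol (negPf mj) addSn /=.
  have -> : (m + j = (m + j).-1.+1)%N by lia.
  rewrite [in RHS]fallingS /= [_ * (_ - _)]mulrC.
  have -> : 'X + (alpha + j%:R - 1)%:P - (m + j).-1%:R = 'X + (alpha - m%:R)%:P :> {poly K}.
    rewrite -addrA -(rmorph_nat (@polyC K)) -polyCB; congr (_ + _%:P).
    have -> : (m + j).-1%:R = m%:R + j%:R - 1 :> K.
      by rewrite -natrD -[in RHS](prednK (_ : 0 < m + j)%N) ?lt0n // -natr1 addrK.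
    by ring.
  have E : m.+1%:R * (alpha / (m.+1)`!%:R) = alpha / m`!%:R by rewrite mulrCA -factS_inv.
  rewrite diffop_XaddC [RHS]scalerA E derivZ scalerDr; congr (_ + _).
  by rewrite !scalerA mulrC.
Qed.
End Families.

Lemma exchange_triangle (V : nmodType) M (F : nat -> nat -> V) :
  \sum_(N < M.+1) \sum_(i < (M - N).+1) F i N =
  \sum_(i < M.+1) \sum_(N < (M - i).+1) F i N.
Proof.
have W (G : nat -> V) (j : 'I_M.+1) : \sum_(i < (M - j).+1) G i =
  \sum_(i < M.+1 | (i + j <= M)%N) G i.
  rewrite (big_ord_widen M.+1) ?ltnS ?leq_subr //.
  by apply: eq_bigl => i; rewrite ltnS; have := ltn_ord j; lia.
under eq_bigr => N _ do rewrite (W (F^~ N)).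
under [RHS]eq_bigr => i _ do rewrite (W (F i)).
rewrite (exchange_big_dep predT) //=; apply: eq_bigr => i _.
by apply: eq_bigl => j; rewrite addnC.
Qed.

Lemma sum_rev (V : nmodType) M (F : nat -> V) :
  \sum_(m < M.+1) F m = \sum_(m < M.+1) F (M - m)%N.
Proof.
by rewrite (reindex_inj rev_ord_inj); apply: eq_bigr => m _; rewrite /= subSS.
Qed.

(** * Initial values of the solutions *)

Section Initial.
Variable K : numFieldType.
Variable al : int.
Let alpha : K := al%:~R.
Local Notation geom := (geom_evol K al).
Local Notation const := (const_evol K al).

Lemma initial_shifted d (T : nat -> nat -> {poly K}) k :
  initial (shifted d T) k =
  if (d <= k)%N then \sum_(m < (k - d).+1) (T m (k - d - m)%N).[-1] else 0.
Proof.
rewrite /initial /shifted; case: leqP => [dk|kd]; last first.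
  by rewrite big1 // => m _; rewrite leqNgt ltn_addl // horner0.
rewrite (big_ord_widen k.+1 (fun m => (T m (k - d - m)%N).[-1])) ?ltnS ?leq_subr //.
rewrite [RHS]big_mkcond /=; apply: eq_bigr => m _.
have -> : (m + d <= k)%N = (m < (k - d).+1)%N by lia.
by case: ifP => _; rewrite ?horner0 // subnAC.
Qed.

(** The binomial form of the vanishing sum, with the factor M! distributed over
    the divided powers. *)
Lemma diffop_vanish (b : K) M M' : (0 < M)%N -> (M' <= M)%N ->
  \sum_(N < M.+1) ((M - N)`!%:R)^-1 *
     (diffop (falling ('X + (b + N%:R)%:P) M') (divided_power K N)).[-1] = 0.
Proof.
move=> M0 M'M.
pose P : {poly K} := falling ('X + b%:P) M'.
have PE : P = falling 'X M' \Po ('X + b%:P).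
  by rewrite [RHS](falling_rmorph (comp_poly ('X + b%:P))) /= comp_polyX.
have szP : (size P <= M.+1)%N.
  by rewrite PE size_comp_poly2 ?size_XaddC // size_fallingX.
have := sum_diffop_shift_eq0 M0 szP => /(congr1 ( *%R (M`!%:R^-1))).
rewrite mulr0 => E; rewrite -[RHS]E mulr_sumr; apply: eq_bigr => N _ /=.
have NM : (N <= M)%N by rewrite -ltnS.
have -> : falling ('X + (b + N%:R)%:P) M' = P \Po ('X + N%:R%:P).
  rewrite [RHS](falling_rmorph (comp_poly ('X + N%:R%:P))) /= comp_polyD comp_polyX comp_polyC.
  by rewrite polyCD; congr falling; ring.
rewrite diffopZr hornerZ !mulrA; congr (_ * _).
rewrite -(bin_fact NM) !natrM; field.
by rewrite !fact_neq0 pnatr_eq0 -lt0n bin_gt0 NM.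
Qed.

Lemma initial_const_evol k : (0 < k)%N -> \sum_(m < k.+1) (const m (k - m)%N).[-1] = 0.
Proof.
move=> k0; rewrite (sum_rev k (fun m => (const m (k - m)%N).[-1])).
transitivity (alpha * \sum_(N < k.+1) ((k - N)`!%:R)^-1 *
     (diffop (falling ('X + (alpha - 1 + N%:R)%:P) k.-1) (divided_power K N)).[-1]); last first.
  by rewrite diffop_vanish ?mulr0 // leq_pred.
rewrite mulr_sumr; apply: eq_bigr => N _.
have NM : (N <= k)%N by rewrite -ltnS.
rewrite subKn // /const_evol subnK // gtn_eqF // hornerZ mulrA.
by rewrite (_ : alpha + N%:R - 1 = alpha - 1 + N%:R) //; ring.
Qed.

(** Expanding the falling factorial of order m at d/ds + alpha around
    d/ds + alpha + q, by Vandermonde, merges the two falling factorials of the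
    solution into a single one.  For fixed i the sum over N is then an instance
    of the vanishing sum, except for i = M, which leaves the binomial
    coefficient of -q over M. *)
Lemma initial_geom_evol q M :
  \sum_(m < M.+1) (geom q m (M - m)%N).[-1] = falling (- q%:R : K) M / M`!%:R.
Proof.
rewrite (sum_rev M (fun m => (geom q m (M - m)%N).[-1])).
pose h i N := (diffop (falling ('X + (alpha + q%:R + N%:R)%:P) (M - i)) (divided_power K N)).[-1].
(* Here N is the degree in s, so that m = M - N, and i is the Vandermonde index. *)
transitivity (\sum_(N < M.+1) \sum_(i < (M - N).+1)
   falling (- q%:R : K) i / i`!%:R * ((M - i - N)`!%:R^-1 * h i N)).
  apply: eq_bigr => N _; have NM : (N <= M)%N by rewrite -ltnS.
  rewrite subKn // /geom_evol -/alpha.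
  have -> : 'X + alpha%:P = (- q%:R)%:P + ('X + (alpha + q%:R)%:P) :> {poly K}.
    by rewrite polyCD polyCN; ring.
  rewrite falling_vandermonde mulr_suml diffop_suml hornerZ horner_sum mulr_sumr.
  apply: eq_bigr => i _ /=; have iM : (i <= M - N)%N by rewrite -ltnS.
  rewrite /h -(falling_rmorph (@polyC K)) -!mulrnAl -mulrA mulrnAl -mulrA.
  have -> : falling ('X + (alpha + q%:R)%:P) (M - N - i) * falling ('X + (alpha + q%:R +
    N%:R)%:P) N
    = falling ('X + (alpha + q%:R + N%:R)%:P) (M - i) :> {poly K}.
    have -> : (M - i = N + (M - N - i))%N by lia.
    rewrite falling_add mulrC; congr (_ * falling _ _).
    by rewrite polyCD -(rmorph_nat (@polyC K)); ring.
  rewrite -[_ *+ 'C(_, _)]scaler_nat diffopZl mul_polyC diffopZl !hornerZ [(M - i - N)%N]subnAC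
    !mulrA.
  congr (_ * _); rewrite -(bin_fact iM) !natrM; field.
  by rewrite !fact_neq0 pnatr_eq0 -lt0n bin_gt0 iM.
rewrite (exchange_triangle M (fun i N => falling (- q%:R : K) i / i`!%:R * ((M - i - N)`!%:R^-1
  * h i N))).
under eq_bigr do rewrite -mulr_sumr.
rewrite big_ord_recr /= subnn big_ord1 big1 ?add0r.
  rewrite /h subnn falling0 diffop1 /divided_power expr0 hornerZ hornerC.
  by rewrite (_ : 0`! = 1%N) // invr1 !mulr1.
move=> i _; rewrite diffop_vanish ?mulr0 //.
by rewrite subn_gt0.
Qed.

End Initial.

(** * Evolution of the monomials *)

Section Cfam.
Variable K : numFieldType.
Variable al : int.
Let alpha : K := al%:~R.
Local Notation geom := (geom_evol K al).
Local Notation const := (const_evol K al).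

(** With t = kappa/(1+kappa) one has kappa = t/(1-t), hence
    kappa^(p'+2) = kappa t^(p'+1)/(1-t)^(p'+1), which is the sum over q of
    binomial(q,p') kappa t^(q+1), a combination of the data already solved.
    Terms with q >= k do not reach kappa^k. *)
Definition monomial_evol (p k m : nat) : {poly K} :=
  match p with
  | 0 => shifted 0 const k m
  | 1 => shifted 1 (geom 0) k m
  | p'.+2 => \sum_(q < k) 'C(q, p')%:R *: shifted q.+2 (geom q.+1) k m
  end.

(** The sum over q has to be extended to a common range before linearity of the
    system applies. *)
Lemma monomial_evol_widen n p k m : (k <= n)%N ->
  monomial_evol p.+2 k m = \sum_(q < n) 'C(q, p)%:R *: shifted q.+2 (geom q.+1) k m.
Proof.
move=> kn /=; rewrite (big_ord_widen n (fun q => 'C(q, p)%:R *: shifted q.+2 (geom q.+1) k m)) //.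
rewrite big_mkcond; apply: eq_bigr => q _ /=; case: ltnP => // kq.
by rewrite /shifted (_ : (m + q.+2 <= k)%N = false) ?scaler0 //; lia.
Qed.

Lemma solves_monomial_evol p : solves al (monomial_evol p).
Proof.
case: p => [|[|p]]; [exact: solves_const_evol | exact: solves_geom_evol |].
have S n : solves al (fun k m => \sum_(q < n) ('C(q, p)%:R : K) *: shifted q.+2 (geom q.+1) k m).
  by apply: solves_sum => q; exact: solves_geom_evol.
split.
- by move=> k m km; have [E _ _ _] := S k; exact: E.
- by have [_ E _ _] := S 0; exact: E.
- move=> k; have [_ _ E _] := S k.+1.
  by rewrite !(@monomial_evol_widen k.+1) // E.
- move=> k m; have [_ _ _ E] := S k.+1.
  by rewrite !(@monomial_evol_widen k.+1) // E.
Qed.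

Lemma falling_neg q M : falling (- q.+1%:R : K) M = (-1) ^+ M * ((q + M) ^_ M)%:R.
Proof.
elim: M => [|M IH]; first by rewrite falling0 ffactn0 mulr1.
rewrite fallingS IH addnS ffactSS natrM exprS -[(q + M).+1%:R]natr1 natrD -[q.+1%:R]natr1; ring.
Qed.

(** For p >= 2 this is binomial inversion: the sum over q of
    (-1)^(n-q) binomial(n,q) binomial(q,p) vanishes unless n = p, again as a
    finite difference. *)
Lemma initial_monomial_evol p k : initial (monomial_evol p) k = (k == p)%:R.
Proof.
case: p => [|[|p]].
- rewrite initial_shifted subn0 leq0n; case: k => [|k]; last by rewrite initial_const_evol.
  by rewrite big_ord1 /const_evol /= hornerC.
- rewrite initial_shifted; case: k => [|k] //=; rewrite subSS subn0 initial_geom_evol oppr0.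
  case: k => [|k]; first by rewrite falling0 divr1.
  by rewrite fallingSl mul0r mul0r.
have -> : initial (monomial_evol p.+2) k =
  \sum_(q < k) 'C(q, p)%:R * initial (shifted q.+2 (geom q.+1)) k.
  rewrite /initial /=; under eq_bigr do rewrite horner_sum.
  rewrite exchange_big; apply: eq_bigr => q _ /=.
  by rewrite mulr_sumr; apply: eq_bigr => m _; rewrite hornerZ.
have [k2|k2] := ltnP k 2.
  rewrite big1 ?(ltn_eqF (leq_trans k2 _)) // => q _.
  by rewrite initial_shifted (_ : (_ <= k)%N = false) ?mulr0 //; lia.
have [n ->] : exists n, k = n.+2 by exists (k - 2)%N; lia.
rewrite 2!eqSS.
transitivity (\sum_(q < n.+1) (-1) ^+ (n - q) * 'C(n, q)%:R * 'C(q, p)%:R : K).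
  rewrite big_ord_recr /= initial_shifted (_ : (_ <= _)%N = false) ?mulr0 ?addr0; last by lia.
  apply: eq_bigr => q _; have qn : (q <= n)%N by rewrite -ltnS.
  rewrite initial_shifted !ltnS qn !subSS initial_geom_evol falling_neg mulrC; congr (_ * _).
  by rewrite subnKC // -bin_ffact natrM mulrA mulfK ?fact_neq0 // bin_sub.
have [np|pn|->] := ltngtP n p.
- rewrite big1 // => q _; by rewrite (@bin_small q p) ?mulr0 //; exact: leq_trans (ltn_ord q) np.
- have szQ : (size (p`!%:R^-1 *: falling 'X p : {poly K})%R <= n)%N.
    by rewrite (leq_trans (size_scale_leq _ _)) // size_fallingX.
  have := finite_difference_eq0 szQ => /(congr1 ( *%R ((-1) ^+ n))); rewrite mulr0 => E.
  rewrite -[RHS]E mulr_sumr; apply: eq_bigr => q _ /=.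
  have qn : (q <= n)%N by rewrite -ltnS.
  have -> : (p`!%:R^-1 *: falling 'X p : {poly K}).[q%:R] = 'C(q, p)%:R.
    rewrite hornerZ -[X in _ * X]horner_evalE falling_rmorph /= horner_evalE hornerX falling_nat.
    by rewrite -bin_ffact natrM mulrCA mulVf ?mulr1 // fact_neq0.
  have -> : (-1) ^+ n = (-1) ^+ (n - q) * (-1) ^+ q :> K by rewrite -exprD subnK.
  by rewrite -!mulrA [X in _ = _ * X]mulrA -expr2 sqrr_sign mul1r.
- rewrite big_ord_recr /= subnn !binn !mulr1 big1 ?add0r // => q _.
  by rewrite (@bin_small q p (ltn_ord q)) mulr0.
Qed.

Lemma geom_evol00 q : geom q 0 0 = 1.
Proof. by rewrite /geom_evol !falling0 mulr1 diffop1 /divided_power expr0 fact0 invr1 !scale1r.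
  Qed.

Lemma monomial_evol_eq0 p k m : (k < p + m)%N -> monomial_evol p k m = 0.
Proof.
case: p => [|[|p]] /= H; rewrite /shifted; try by case: ifP => //; lia.
rewrite big1 // => q _; have [qp|pq] := ltnP q p; first by rewrite bin_small // scale0r.
by rewrite (_ : (_ <= k)%N = false) ?scaler0 //; lia.
Qed.

Lemma monomial_evol_diag p m : monomial_evol p p m = (m == 0%N)%:R.
Proof.
case: m => [|m]; last by rewrite monomial_evol_eq0 //; lia.
case: p => [|[|p]]; [by rewrite /= /shifted /const_evol | by rewrite /= /shifted /= geom_evol00
  |].
rewrite (@monomial_evol_widen p.+2) // big_ord_recr big_ord_recr /=.
rewrite {2}/shifted add0n leqnn subn0 subnn geom_evol00 binn scale1r.
rewrite [X in _ + X](_ : _ = 0) ?addr0;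
  last by rewrite /shifted (_ : (_ <= _)%N = false) ?scaler0 //; lia.
by rewrite big1 ?add0r // => q _; rewrite bin_small // scale0r.
Qed.

End Cfam.

(** * Comparison with the formulas for the coefficients *)

Lemma coef_sum_nat (A : nzRingType) (m n : nat) (c : nat -> A) l :
  (\sum_(m <= i < n) c i *: 'X^i)`_l = if (m <= l < n)%N then c l else 0.
Proof.
rewrite coef_sum; under eq_bigr do rewrite coefZ coefXn.
case: ifP => [|] H; last first.
  rewrite big_nat_cond big1 // => i /andP[imn _].
  case: eqP => [li|_]; last by rewrite mulr0.
  by rewrite li imn in H.
rewrite (bigD1_seq l) /= ?mem_index_iota ?iota_uniq // eqxx mulr1 big1 ?addr0 // => i il.
by rewrite eq_sym (negPf il) mulr0.
Qed.

(** Sums over a range of integers as sums over ordinals, with a bound k that can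
    be shared by different ranges. *)
Lemma big_irange (V : nmodType) (a b : int) (p k : nat) (F : int -> V) : b - a < k%:Z ->
  \sum_(j <- irange (a + p%:Z) b) F j =
  \sum_(q < k | (p <= q)%N && (a + q%:Z <= b)) F (a + q%:Z).
Proof.
move=> bk; have [ba|ab] := ltP b (a + p%:Z).
  by rewrite irange_nil // big_nil big1 // => q; lia.
have [n nE] : exists n : nat, b = a + p%:Z + n%:Z - 1 by exists (absz (b - a - p%:Z + 1)%R); lia.
rewrite (@irangeE _ n) // big_map -[n]subn0 -/(index_iota 0 n).
transitivity (\sum_(p <= q < n + p) F (a + q%:Z)).
  rewrite [RHS](_ : _ = \sum_(0 + p <= q < n + p) F (a + q%:Z)) // big_addn addnK;
    apply: eq_bigr => i _.
  by congr F; lia.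
rewrite (@big_nat_widen _ _ _ _ _ k); last by lia.
rewrite (@big_nat_widenl _ _ _ p 0) // big_mkord.
by apply: eq_bigl => q /=; lia.
Qed.

Section Match.
Variable K : numFieldType.
Variable al : int.

Lemma coef_geom_evol q m N l : (geom_evol K al q m N)`_l =
  (elem_sym (l%:Z + m%:Z)
     (irange (al - m%:Z + 1) al ++ irange (al + q%:Z + 1) (al + q%:Z + N%:Z)))%:~R
  / l`!%:R / m`!%:R.
Proof.
rewrite /geom_evol coefZ mulrC -prod_irange_falling.
have -> : (al%:~R + q%:R + N%:R : K) = (al + q%:Z + N%:Z)%:~R by rewrite !intrD.
rewrite -prod_irange_falling -big_cat coef_diffop_divided_power size_cat PoszD !size_irange.
congr ((elem_sym _ (_ ++ irange _ _))%:~R / _ / _); last by lia.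
case: leP => h1; case: leP => h2; lia.
Qed.

Lemma coef_const_evol m j l : (0 < m + j)%N -> (const_evol K al m j)`_l =
  al%:~R * ((elem_sym (l%:Z + m%:Z - 1)
     (irange (al - m%:Z + 1) (al + j%:Z - 1)))%:~R / l`!%:R) / m`!%:R.
Proof.
move=> mj; rewrite /const_evol gtn_eqF // coefZ.
have -> : (al%:~R + j%:R - 1 : K) = (al + j%:Z - 1)%:~R by rewrite intrB intrD.
rewrite -prod_irange_falling coef_diffop_divided_power size_irange mulrAC;
  congr (_ * (_%:~R / _) / _).
have -> : al + j%:Z - 1 - (m + j).-1%:Z + 1 = al - m%:Z + 1 by lia.
by congr elem_sym; case: leP => h; lia.
Qed.

Lemma irange_split (a b c : int) : a <= b + 1 -> b <= c -> irange a b ++ irange (b + 1) c =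
  irange a c.
Proof.
move=> ab bc.
have [n nE] : exists n : nat, b = a + n%:Z - 1 by exists (absz (b - a + 1)%R); lia.
have [r rE] : exists r : nat, c = b + r%:Z by exists `|c - b|%N; lia.
rewrite (@irangeE a n) // (@irangeE (b + 1) r); last by lia.
rewrite (@irangeE a (n + r)); last by lia.
rewrite iotaD map_cat add0n; congr (_ ++ _).
rewrite -[in RHS](addn0 n) iotaDl -map_comp; apply: eq_map => i /=; lia.
Qed.
End Match.

Section Acoef.
Variable R : realType.
Variable g : nat.
Let al : int := 2 - 2 * g%:Z.

Lemma intr_al : (al%:~R : R) = 2 - (2 * g)%:R.
Proof. by rewrite /al intrB intrM natrM. Qed.

Lemma acoef0_monomial_evol k m : (0 < k)%N -> (m <= k)%N -> acoef0 R g k m =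
  monomial_evol R al 0 k m.
Proof.
move=> k0 mk; apply/polyP => l.
rewrite /= /shifted addn0 mk subn0 coef_const_evol; last by lia.
rewrite /acoef0; case: eqP => [->|/eqP m0]; rewrite coefZ coef_sum_nat.
  rewrite divr1 -intr_al; congr (_ * _).
  rewrite addr0 subr0 subn0; case: ifP => [lk|].
    by congr ((elem_sym _ (irange _ _))%:~R / _); rewrite /al; lia.
  move=> /negbT; rewrite negb_and -!leqNgt leqn0 => /orP[/eqP->|kl].
    by rewrite elem_sym_neg // mul0r.
  rewrite elem_sym_large ?mul0r // size_irange; case: ifP => _; lia.
rewrite -intr_al [RHS]mulrAC; congr (_ * _); case: ifP => [lk|].
  by congr ((elem_sym _ (irange _ _))%:~R / _); rewrite /al; lia.
move=> /negbT lk; rewrite elem_sym_large ?mul0r // size_irange; case: ifP => _; lia.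
Qed.

Lemma acoef1_monomial_evol k m : (1 < k)%N -> (m <= k - 1)%N -> acoef1 R g k m =
  monomial_evol R al 1 k m.
Proof.
move=> k0 mk; apply/polyP => l.
rewrite /= /shifted (_ : (m + 1 <= k)%N = true); last by lia.
rewrite coef_geom_evol !addr0 irange_split; [|lia|lia].
rewrite /acoef1 coefZ coef_sum_nat [RHS]mulrC; congr (_ * _); case: ifP => [lk|].
  by congr ((elem_sym _ (irange _ _))%:~R / _); rewrite /al; lia.
move=> /negbT lk; rewrite elem_sym_large ?mul0r // size_irange; case: ifP => _; lia.
Qed.

(** The summation index j of the formula is alpha + q + 1, and
    binomial(j+2g-3, p) is binomial(q, p). *)
Lemma acoef3'_monomial_evol p k m : (m + p.+2 <= k)%N ->
  acoef3' R g p.+2 k m = monomial_evol R al p.+2 k m.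
Proof.
move=> mk; apply/polyP => l.
rewrite /= coef_sum /acoef3' coefZ coef_sum_nat.
transitivity (m`!%:R^-1 * \sum_(q < k) (if (p <= q)%N && (m + q + l + 2 <= k)%N then
    'C(q, p)%:R * ((elem_sym (m%:Z + l%:Z) (irange (al - m%:Z + 1) al ++ irange (al + q%:Z + 2)
      (al + k%:Z - 1 - m%:Z)))%:~R / l`!%:R : R) else 0)).
  congr (_ * _); case: ifP => lk; last first.
    by rewrite big1 // => q _; rewrite ifF //; lia.
  have -> : - 2 * g%:Z + p.+2%:Z + 1 = al + 1 + p%:Z by rewrite /al; lia.
  rewrite (big_irange _ _ (k := k)); last by rewrite /al; lia.
  rewrite rmorph_sum mulr_suml [LHS]big_mkcond; apply: eq_bigr => q _ /=.
  have -> : (al + 1 + q%:Z <= - 2 * g%:Z + k%:Z + 1 - m%:Z - l%:Z) = (m + q + l + 2 <= k)%N.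
    by rewrite /al; lia.
  case: ifP => // _; rewrite intrM !subSS subn0 -mulrA; congr (_ * _).
    by rewrite (_ : `|_|%N = q) // /al; lia.
  by congr ((elem_sym _ (irange _ _ ++ irange _ _))%:~R / _); rewrite /al; lia.
rewrite mulr_sumr; apply: eq_bigr => q _; rewrite coefZ /shifted.
have [pq|qp] := leqP p q; last by rewrite bin_small // mulr0 mul0r.
have [mq|km] := leqP (m + q.+2) k; last first.
  by rewrite coef0 mulr0 ifF ?mulr0 //; lia.
rewrite coef_geom_evol; have [lk|kl] := leqP (m + q + l + 2) k.
  rewrite mulrC -!mulrA; congr (_ * (_%:~R * _)).
  by congr elem_sym; [lia | congr (_ ++ irange _ _); lia].
rewrite mulr0 elem_sym_large ?mul0r ?mulr0 // size_cat PoszD !size_irange.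
by case: ifP; case: ifP; lia.
Qed.

(** Reversing the sign of the numbers -2g+3-m, ..., -2g+2 gives
    2g-2, ..., 2g-3+m in the opposite order. *)
Lemma elem_sym_cat_irange m l L :
  elem_sym (m%:Z + l%:Z) (irange (- 2 * g%:Z + 3 - m%:Z) (- 2 * g%:Z + 2) ++ L) =
  (-1) ^+ m * \sum_(0 <= h < m.+1) (-1) ^+ h *
     elem_sym (m%:Z - h%:Z) (irange (2 * g%:Z - 2) (2 * g%:Z - 3 + m%:Z)) *
     elem_sym (l%:Z + h%:Z) L.
Proof.
rewrite elem_sym_cat (big_cat_nat (n := l)) //=; last by lia.
rewrite big_nat_cond big1 ?add0r; last first.
  move=> i /andP[/andP[_ il] _].
  by rewrite elem_sym_large ?mul0r // size_irange; case: ifP; lia.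
rewrite -{1}[l]add0n big_addn -addSn addnK mulr_sumr.
apply: eq_big_nat => h /andP[_ hm].
have [i iE] : exists i : nat, m%:Z - h%:Z = i%:Z by exists (m - h)%N; lia.
have -> : m%:Z + l%:Z - (h + l)%:Z = i%:Z by lia.
rewrite iE mulrA; congr (_ * elem_sym _ _); last by lia.
have -> : (-1) ^+ m * ((-1) ^+ h * elem_sym i (irange (2 * g%:Z - 2) (2 * g%:Z - 3 + m%:Z)))
   = (-1) ^+ i * elem_sym i (irange (2 * g%:Z - 2) (2 * g%:Z - 3 + m%:Z)).
  rewrite mulrA -exprD; congr (_ * _).
  by rewrite -signr_odd -[RHS]signr_odd; congr (_ ^+ nat_of_bool _); lia.
rewrite -elem_sym_opp !elem_symE; congr (_`_ _).
rewrite (@irangeE _ m) ?(@irangeE (2 * g%:Z - 2) m); [|lia..].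
have prodE (F : nat -> {poly int}) : \prod_(j <- iota 0 m) F j = \prod_(j < m) F j.
  by rewrite -(big_mkord xpredT F) /index_iota subn0.
rewrite /elem_sym_gen !big_map !prodE.
have revE (F : nat -> {poly int}) : \prod_(j < m) F j = \prod_(j < m) F (m - j.+1)%N.
  by rewrite (reindex_inj rev_ord_inj).
rewrite (revE (fun j => 1 + (- 2 * g%:Z + 3 - m%:Z + j%:Z) *: 'X)).
apply: congr1; apply: eq_bigr => j _; congr (1 + _ *: _); have := ltn_ord j; lia.
Qed.

Lemma big_irange_trunc (F : int -> int) a b b' : b' <= b ->
  (forall j, b' < j -> j <= b -> F j = 0) ->
  \sum_(j <- irange a b') F j = \sum_(j <- irange a b) F j.
Proof.
move=> b'b F0; have [k kE] : exists k : nat, b - a < k%:Z.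
  by exists (absz (b - a)%R).+1; lia.
rewrite -[a]addr0 (@big_irange _ a b' 0 k) ?(@big_irange _ a b 0 k) //; last by lia.
rewrite [LHS]big_mkcond [RHS]big_mkcond; apply: eq_bigr => q _ /=.
case: ifP => h1; case: ifP => h2 //; first by lia.
by rewrite F0 //; lia.
Qed.

(** After splitting the elementary symmetric polynomial, the two formulas differ
    only in the upper limit of the sum over j; for larger j the list j+1, ... is
    too short for the elementary symmetric polynomial not to vanish. *)
Lemma acoef3_eq p k m : (2 <= p)%N -> (m + p <= k)%N -> acoef3 R g p k m = acoef3' R g p k m.
Proof.
move=> p2 mpk; rewrite /acoef3 /acoef3' [(-1) ^+ m / _]mulrC -scalerA; congr (_ *: _).
rewrite scaler_sumr; apply: eq_big_nat => l _.
rewrite scalerA; congr (_ *: _); rewrite mulrA; congr (_ / _).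
rewrite -[(-1) ^+ m](rmorph_sign (intmul 1 : int -> R)) -intrM; congr (_%:~R).
under [RHS]eq_bigr => j _ do rewrite elem_sym_cat_irange mulrCA mulr_sumr.
rewrite -mulr_sumr exchange_big /=; congr (_ * _).
apply: eq_big_nat => h _.
rewrite (@big_irange_trunc _ _ (- 2 * g%:Z + k%:Z + 1 - m%:Z - l%:Z)); last 2 first.
- by lia.
- move=> j h1 h2; rewrite elem_sym_large ?mulr0 // size_irange.
  by case: ifP; lia.
rewrite mulr_sumr; apply: eq_bigr => j _; rewrite mulrCA;
  congr (_ * (_ * elem_sym _ (irange _ _))).
by lia.
Qed.

(** Sorting the monomials by their smallest variable. *)
Lemma elem_sym_irange_least (i : nat) (K c : int) :
  elem_sym i.+1%:Z (irange c K) =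
  \sum_(j <- irange c (K - i%:Z)) j * elem_sym i%:Z (irange (j + 1) K).
Proof.
have [cK|cK] := leP c (K - i%:Z); last first.
  rewrite elem_sym_large; last by rewrite size_irange; case: ifP; lia.
  by rewrite irange_nil ?big_nil //; lia.
have [n nE] : exists n : nat, c = K - i%:Z + 1 - n%:Z by exists (absz (K - i%:Z + 1 - c)%R); lia.
elim: n c nE {cK} => [|n IH] c nE.
  rewrite elem_sym_large; last by rewrite size_irange; case: ifP; lia.
  by rewrite irange_nil ?big_nil //; lia.
rewrite irange_cons; last by lia.
rewrite elem_sym_cons (IH (c + 1)); last by lia.
rewrite [in RHS]irange_cons; last by lia.
by rewrite big_cons addrC; congr (_ * elem_sym _ _ + _); lia.
Qed.

(** Sort each term on the left by the smallest variable j: it occurs once for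
    every lower limit between c and j - 1, hence j - c times. *)
Lemma sum_elem_sym_irange (i : nat) (K c : int) :
  \sum_(j <- irange c (K - i.+1%:Z)) elem_sym i.+1%:Z (irange (j + 1) K) =
  \sum_(j <- irange (c + 1) (K - i%:Z)) j * (j - c) * elem_sym i%:Z (irange (j + 1) K).
Proof.
have [cK|cK] := leP c (K - i%:Z); last first.
  by rewrite !irange_nil ?big_nil //; lia.
have [n nE] : exists n : nat, c = K - i%:Z - n%:Z by exists (absz (K - i%:Z - c)%R); lia.
elim: n c nE {cK} => [|n IH] c nE.
  by rewrite !irange_nil ?big_nil //; lia.
rewrite irange_cons; last by lia.
rewrite big_cons (IH (c + 1)) ?elem_sym_irange_least; last by lia.
rewrite irange_cons; last by lia.
rewrite !big_cons -addrA -big_split /=; congr (_ + _); first by ring.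
by apply: eq_bigr => j _; ring.
Qed.

Lemma elem_sym_size L : elem_sym (size L)%:Z L = \prod_(j <- L) j.
Proof.
elim: L => [|j L IH]; first by rewrite elem_sym_nil big_nil.
rewrite big_cons elem_sym_cons elem_sym_large ?add0r -?IH /=; last by lia.
by congr (_ * elem_sym _ _); lia.
Qed.

Lemma elem_sym_rising (s m : nat) :
  elem_sym m%:Z (irange (s%:Z + 1) (s%:Z + m%:Z)) = ((s + m) ^_ m)%:Z.
Proof.
have E : (size (irange (s%:Z + 1) (s%:Z + m%:Z)))%:Z = m%:Z.
  by rewrite size_irange; case: ifP; lia.
rewrite -[X in elem_sym X]E elem_sym_size {E}; elim: m => [|m IH].
  by rewrite irange_nil ?big_nil //; lia.
rewrite irange_rcons; last by lia.
rewrite -cats1 big_cat big_seq1 /=.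
have -> : s%:Z + m.+1%:Z - 1 = s%:Z + m%:Z by lia.
by rewrite IH addnS ffactSS; lia.
Qed.

(** The formula for p = 2 is the one for p >= 3 after summing over the lower
    limits of the elementary symmetric polynomials, which is possible unless
    their degree l + h is 0.  The remaining term, with l = h = 0, counts a range
    of length k - 1 - m and is the separate constant of the formula. *)
Lemma acoef2_eq k m : (2 <= g)%N -> (2 < k)%N -> (m + 2 <= k)%N -> acoef2 R g k m =
  acoef3 R g 2 k m.
Proof.
move=> g2 k2 mk; apply/polyP => l.
pose c : int := - 2 * g%:Z + 3.
pose KK : int := k%:Z - 2 * g%:Z - m%:Z + 1.
pose E h := elem_sym (m%:Z - h%:Z) (irange (2 * g%:Z - 2) (2 * g%:Z - 3 + m%:Z)).
have Em : E 0 = 'C(2 * g - 3 + m, m)%:Z * m`!%:Z.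
  rewrite /E subr0.
  have -> : 2 * g%:Z - 2 = (2 * g - 3)%N%:Z + 1 by lia.
  have -> : 2 * g%:Z - 3 = (2 * g - 3)%N%:Z by lia.
  by rewrite elem_sym_rising -bin_ffact PoszM.
pose S3 l := \sum_(0 <= h < m.+1) (-1) ^+ h * E h *
  \sum_(j <- irange c (KK - l%:Z - h%:Z)) elem_sym (l%:Z + h%:Z) (irange (j + 1) KK).
pose S2 l := \sum_(0 <= h < m.+1) (-1) ^+ h * E h *
  \sum_(j <- irange (c + 1) (KK - l%:Z - h%:Z + 1)) j * (j - c) * elem_sym (l%:Z - 1 + h%:Z)
    (irange (j + 1) KK).
have c3 : (acoef3 R g 2 k m)`_l = (-1) ^+ m / m`!%:R * (if (l < (k - 2 - m).+1)%N then (S3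
  l)%:~R / l`!%:R else 0).
  rewrite /acoef3 coefZ coef_sum_nat leq0n /=; congr (_ * _); case: ifP => // _.
  congr (_%:~R / _); apply: eq_bigr => h _; congr (_ * _).
  rewrite [in LHS](_ : - 2 * g%:Z + 2%:Z + 1 = c); last by rewrite /c; lia.
  rewrite (_ : k%:Z - l%:Z - 2 * g%:Z + 1 - m%:Z - h%:Z = KK - l%:Z - h%:Z);
    last by rewrite /KK; lia.
  by apply: eq_bigr => j _; rewrite bin0 mul1r.
have tele h : (0 < l + h)%N ->
  \sum_(j <- irange c (KK - l%:Z - h%:Z)) elem_sym (l%:Z + h%:Z) (irange (j + 1) KK) =
  \sum_(j <- irange (c + 1) (KK - l%:Z - h%:Z + 1)) j * (j - c) * elem_sym (l%:Z - 1 + h%:Z)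
    (irange (j + 1) KK).
  move=> lh; have [i iE] : exists i, (l + h = i.+1)%N by exists (l + h).-1; lia.
  have -> : KK - l%:Z - h%:Z = KK - i.+1%:Z by lia.
  have -> : l%:Z + h%:Z = i.+1%:Z by lia.
  have -> : KK - i.+1%:Z + 1 = KK - i%:Z by lia.
  have -> : l%:Z - 1 + h%:Z = i%:Z by lia.
  exact: sum_elem_sym_irange.
have S32 : S3 l = S2 l + (if l == 0%N then E 0 * (k%:Z - 1 - m%:Z) else 0).
  rewrite /S3 /S2; case: eqP => [l0|/eqP l0]; last first.
    by rewrite addr0; apply: eq_bigr => h _; rewrite tele // addn_gt0 lt0n l0.
  rewrite !(big_nat_recl _ _ _ (leq0n m)) [RHS]addrAC; congr (_ + _); last first.
    by apply: eq_bigr => h _; rewrite tele // addnS.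
  rewrite l0 !mul1r -mulrDr; congr (_ * _).
  rewrite [X in _ = X + _]big1 ?add0r; last by move=> j _; rewrite elem_sym_neg // mulr0.
  rewrite (eq_bigr (fun=> 1)); last by move=> j _; rewrite elem_sym0.
  rewrite big_const_seq count_predT iter_addr_0 -[RHS]mulr1.
  have -> : k%:Z - 1 - m%:Z = (size (irange c (KK - 0 - 0)))%:Z.
    by rewrite size_irange; case: ifP; rewrite /c /KK; lia.
  by rewrite mulr1 natz.
have kmE : (k%:Z - 1 - m%:Z)%:~R = k%:R - 1 - m%:R :> R by rewrite !intrB.
rewrite c3 S32 /acoef2; case: (eqVneq m 0%N) => [m0|m0].
  rewrite coefD coefC coef_sum_nat.
  have E0 : E 0 = 1 by rewrite Em m0 bin0.
  have -> : (-1) ^+ m / m`!%:R = 1 :> R by rewrite m0 expr0 fact0 divr1.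
  have S2E : S2 l = \sum_(j <- irange (c + 1) (KK - l%:Z - 0%:Z + 1)) j * (j - c) * elem_sym
    (l%:Z - 1) (irange (j + 1) KK).
    by rewrite /S2 m0 big_nat1 expr0 -/(E 0) E0 !mul1r; apply: eq_bigr => j _; rewrite addr0.
  rewrite mul1r E0 mul1r; case: eqP => [l0|/eqP l0] /=.
    rewrite S2E l0 /= addr0 [X in (X + _)%:~R]big1 ?add0r; last by move=> j _;
      rewrite elem_sym_neg // mulr0.
    by rewrite kmE m0 subr0 fact0 divr1.
  rewrite add0r addr0 lt0n l0 m0 subn0 /= S2E; case: ifP => // _.
  congr ((bigop.body _ _ _)%:~R / _).
    by congr irange; rewrite /c /KK; lia.
  apply/funext => j; congr (BigBody _ _ _ (_ * _ * elem_sym _ (irange _ _))); rewrite /c /KK; lia.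
rewrite coefD coefC coefZ coef_sum_nat leq0n /=.
have -> : (if (l < (k - 2 - m).+1)%N then
   (\sum_(0 <= h < m.+1)
          (-1) ^+ h * elem_sym (m%:Z - h%:Z) (irange (2 * g%:Z - 2) (2 * g%:Z - 3 + m%:Z)) *
          \sum_(j <- irange (-2 * g%:Z + 4) (k%:Z - l%:Z - 2 * g%:Z + 2 - m%:Z - h%:Z))
             j * (j + 2 * g%:Z - 3) *
             elem_sym (l%:Z - 1 + h%:Z) (irange (j + 1) (k%:Z - 2 * g%:Z - m%:Z + 1)))%:~R /
      l`!%:R else 0 : R) = (if (l < (k - 2 - m).+1)%N then (S2 l)%:~R / l`!%:R else 0).
  case: ifP => // _; congr (_%:~R / _); apply: eq_bigr => h _; congr (_ * _).
  congr bigop.body; first by congr irange; rewrite /c /KK; lia.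
  by apply/funext => j; congr (BigBody _ _ _ (_ * _ * elem_sym _ (irange _ _)));
    rewrite /c /KK; lia.
case: eqP => [->|_]; last by rewrite add0r addr0.
rewrite ltn0Sn fact0 !divr1 intrD [RHS]mulrDr addrC; congr (_ + _).
rewrite Em !intrM kmE -!mulrA; congr (_ * _).
by rewrite -!pmulrn [RHS]mulrCA mulKf // fact_neq0.
Qed.
End Acoef.

(** * Taylor coefficients of solutions *)

Section Formal.
Variable R : realType.
Variable al : int.
Let alpha : R := al%:~R.
Implicit Types F G : {poly {poly R}}.

(** A polynomial F with coefficients in R[s] stands for u^alpha F(u^-1), the
    variable of F being u^-1 and s = log u - 1.  Then [euler] is u d/du and
    [ddx] is d/du = d/dx. *)
Definition euler F : {poly {poly R}} :=
  map_poly (@deriv R) F + alpha%:P *: F - 'X * F^`().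

Definition ddx F : {poly {poly R}} := 'X * euler F.

(** The function represented by F, at u = e^t. *)
Definition eval_at F (t : R) : R := F.[(expR (- t))%:P].[t - 1] * expR (alpha * t).

Lemma coef_euler F m : (euler F)`_m = (F`_m)^`() + (alpha - m%:R) *: F`_m.
Proof.
rewrite coefB coefD coef_map_id0 ?deriv0 // coefZ coefXM mul_polyC scalerBl addrA; congr (_ - _).
case: m => [|m]; first by rewrite scale0r.
by rewrite coef_deriv /= scaler_nat.
Qed.

Lemma euler_is_additive : {morph euler : F G / F - G}.
Proof.
move=> F G; apply/polyP => m; rewrite [RHS]coefB !coef_euler coefB derivB scalerBr.
by rewrite opprD addrACA.
Qed.

Lemma eulerB F G : euler (F - G) = euler F - euler G.
Proof. exact: euler_is_additive. Qed.

Lemma euler0 : euler 0 = 0.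
Proof. by have := eulerB 0 0; rewrite !subrr. Qed.

Lemma eulerD F G : euler (F + G) = euler F + euler G.
Proof.
have eulerN H : euler (- H) = - euler H by rewrite -sub0r eulerB euler0 sub0r.
by rewrite -[in LHS](opprK G) eulerB eulerN opprK.
Qed.

Lemma eulerZ (a : R) F : euler (a%:P *: F) = a%:P *: euler F.
Proof.
apply/polyP => m; rewrite coefZ !coef_euler coefZ !mul_polyC derivZ scalerDr.
by rewrite !scalerA [_ * a]mulrC.
Qed.

Lemma eulerMX F : euler (F * 'X) = euler F * 'X - F * 'X.
Proof.
apply/polyP => m; rewrite [RHS]coefB !coef_euler !coefMX coef_euler.
case: m => [|m] /=; first by rewrite deriv0 scaler0 addr0 subr0.
rewrite -addrA; congr (_ + _); rewrite -[X in _ = _ - X]scale1r -scalerBl.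
by congr (_ *: _); rewrite -natr1; ring.
Qed.

Lemma eulerC (p : {poly R}) : euler p%:P = (p^`() + alpha *: p)%:P.
Proof.
apply/polyP => m; rewrite coef_euler !coefC; case: m => [|m] /=;
  last by rewrite deriv0 scaler0 addr0.
by rewrite subr0.
Qed.

Lemma is_derive_eval_at F (t : R) : is_derive t 1 (eval_at F) (eval_at (euler F) t).
Proof.
elim/poly_ind: F => [|F p IH].
  have -> : eval_at 0 = cst 0 by apply/funext => s; rewrite /eval_at !horner0 mul0r.
  by rewrite euler0 /eval_at !horner0 mul0r; exact: is_derive_cst.
have -> : eval_at (F * 'X + p%:P) = (fun s => eval_at F s * expR (- s) + p.[s - 1]
  * expR (alpha * s)).
  apply/funext => s; rewrite /eval_at hornerMXaddC hornerD hornerM hornerC; ring.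
have -> : eval_at (euler (F * 'X + p%:P)) t =
   (eval_at (euler F) t * expR (- t) + eval_at F t * - expR (- t))
   + (p^`().[t - 1] * expR (alpha * t) + p.[t - 1] * (alpha * expR (alpha * t))).
  rewrite eulerD eulerMX eulerC /eval_at; set T := euler F; rewrite !hornerE /=; ring.
apply: is_deriveD.
- have H : is_derive t 1 (fun s : R => expR (- s)) (- expR (- t)).
    by rewrite -mulrN1; exact: (@is_derive1_comp _ expR (fun s => - s)).
  rewrite addrC [eval_at (euler F) t * _]mulrC.
  exact: (@is_deriveM _ _ (eval_at F) (fun s => expR (- s)) t 1 _ _ IH H).
- have H1 : is_derive t 1 (fun s : R => expR (alpha * s)) (alpha * expR (alpha * t)).
    rewrite mulrC; apply: (@is_derive1_comp _ expR (fun s => alpha * s)).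
    by apply: (is_derive_eq (@is_deriveZ _ _ _ id alpha t 1 1 _)); exact: mulr1.
  have H2 : is_derive t 1 (fun s : R => p.[s - 1]) p^`().[t - 1].
    rewrite -[X in is_derive _ _ _ X]mulr1;
      apply: (@is_derive1_comp _ (horner p) (fun s => s - 1)).
    have H : is_derive t (1 : R) ((id : R -> R) - cst 1) (1 - 0) by exact: is_deriveB.
    by rewrite subr0 in H; exact: H.
  have H := @is_deriveM _ _ (fun s : R => p.[s - 1]) (fun s : R => expR (alpha * s)) t 1 _ _ H2
    H1.
  by apply: (is_derive_eq H); rewrite /GRing.scale /=; ring.
Qed.

Definition eval_in F (x : R) := eval_at F (ln (1 + x)).

Lemma is_derive_eval_in F (x : R) : -1 < x -> is_derive x 1 (eval_in F) (eval_in (ddx F) x).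
Proof.
move=> x1; have x0 : 0 < 1 + x by lra.
have -> : eval_in (ddx F) x = eval_at (euler F) (ln (1 + x)) * ((1 + x)^-1 * 1).
  by rewrite /eval_in /eval_at /ddx hornerM hornerX hornerM hornerC expRN lnK // mulr1; ring.
apply: (@is_derive1_comp _ (eval_at F) (fun x => ln (1 + x))).
  exact: is_derive_eval_at.
apply: (@is_derive1_comp _ (@ln R) (fun x => 1 + x)).
  exact: is_derive1_ln.
have H : is_derive x (1 : R) ((cst 1 : R -> R) + id) (0 + 1) by exact: is_deriveD.
by rewrite add0r in H; exact: H.
Qed.

Lemma derive1n_eval_in F n x : -1 < x -> ((eval_in F)^`(n))%classic x = eval_in (iter n ddx F) x.
Proof.
elim: n x => [|n IH] x x1; first by [].
rewrite derive1nS derive1E.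
have E : \forall y \near x, (((eval_in F)^`(n))%classic : R -> R) y = eval_in (iter n ddx F) y.
  near=> y; apply: IH; near: y; exact: lt_nbhsr.
rewrite (near_eq_derive _ E).
by have [_ ->] := is_derive_eval_in (iter n ddx F) x1.
Unshelve. all: by end_near.
Qed.

Lemma eval_at0 F : eval_at F 0 = F.[1].[-1].
Proof. by rewrite /eval_at oppr0 expR0 mulr0 expR0 mulr1 sub0r. Qed.

(** Differentiation is formal, so that Taylor coefficients are values of formal
    derivatives at x = 0, where u = 1 and s = -1. *)
Lemma taylor_coef_eval_in F n : taylor_coef (eval_in F) n = (iter n ddx F).[1].[-1] / n`!%:R.
Proof.
rewrite /taylor_coef derive1n_eval_in; last by lra.
by rewrite /eval_in addr0 ln1 eval_at0.
Qed.

Lemma iter_ddx_sum n (I : Type) (r : seq I) (F : I -> {poly {poly R}}) :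
  iter n ddx (\sum_(i <- r) F i) = \sum_(i <- r) iter n ddx (F i).
Proof.
elim: n => [|n IH] //=; rewrite IH /ddx.
by rewrite (big_morph euler eulerD euler0) mulr_sumr.
Qed.

Variable c : nat -> nat -> {poly R}.
Hypothesis c_solves : solves al c.

(** The coefficient of kappa^k in the solution c. *)
Definition kappa_part k : {poly {poly R}} := \poly_(m < k.+1) c k m.

Lemma coef_kappa_part k m : (kappa_part k)`_m = c k m.
Proof.
rewrite coef_poly ltnS; case: leqP => // km.
by have [E _ _ _] := c_solves; rewrite E.
Qed.

Lemma euler_kappa_part0 : euler (kappa_part 0) = alpha%:P *: kappa_part 0.
Proof.
apply/polyP => m; rewrite coef_euler coefZ mul_polyC coef_kappa_part.
have [E0 E1 _ _] := c_solves; case: m => [|m]; first by rewrite E1 add0r subr0.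
by rewrite E0 // deriv0 !scaler0 addr0.
Qed.

(** The differential equation, with x written as u - 1 and divided by u. *)
Lemma euler_kappa_partS k : euler (kappa_part k.+1) - euler (kappa_part k) + 'X * euler
  (kappa_part k)
  = alpha%:P *: kappa_part k.+1 + k%:R *: kappa_part k.
Proof.
have [_ _ E2 E3] := c_solves.
apply/polyP => m; pose T := euler.
have cT F i : (T F)`_i = (F`_i)^`() + (alpha - i%:R) *: F`_i := coef_euler F i.
rewrite -/(T (kappa_part k.+1)) -/(T (kappa_part k)); clearbody T.
rewrite !coefD coefN coefXM !coefZ !cT !coef_kappa_part.
rewrite -(rmorph_nat (@polyC R)).
case: m => [|m] /=; rewrite -!mul_polyC.
  rewrite E2 -!mul_polyC !polyCD polyCN; ring.
have /eqP := E3 k m; rewrite subr_eq => /eqP ->.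
rewrite -!mul_polyC !(polyCB, polyCD); ring.
Qed.

Lemma ddx_euler F : ddx (euler F) = euler (ddx F) + ddx F.
Proof. by rewrite /ddx ['X * euler F]mulrC eulerMX; ring. Qed.

Lemma ddxZ (a : R) F : ddx (a%:P *: F) = a%:P *: ddx F.
Proof. by rewrite /ddx eulerZ -scalerAr. Qed.

Lemma ddxD F G : ddx (F + G) = ddx F + ddx G.
Proof. by rewrite /ddx eulerD mulrDr. Qed.

Lemma ddxB F G : ddx (F - G) = ddx F - ddx G.
Proof. by rewrite /ddx eulerB mulrBr. Qed.

Lemma euler_iter0 n : euler (iter n ddx (kappa_part 0)) =
  (alpha - n%:R)%:P *: iter n ddx (kappa_part 0).
Proof.
elim: n => [|n IH]; first by rewrite subr0 euler_kappa_part0.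
have := congr1 ddx IH; rewrite ddxZ ddx_euler => /eqP.
rewrite -subr_eq0 addrAC => /eqP E /=.
apply/eqP; rewrite -subr_eq0 -[X in _ == X]E; apply/eqP.
rewrite -natr1 !polyCB polyCD -!mul_polyC; ring.
Qed.

(** Each derivative in x of the differential equation lowers alpha by 1 and
    raises k by 1, by the commutation of [euler] and [ddx]. *)
Lemma euler_iterS k n :
  euler (iter n ddx (kappa_part k.+1)) - euler (iter n ddx (kappa_part k))
    + ddx (iter n ddx (kappa_part k)) =
  (alpha - n%:R)%:P *: iter n ddx (kappa_part k.+1) + (n + k)%:R%:P *: iter n ddx (kappa_part k).
Proof.
elim: n => [|n IH].
  by rewrite subr0 add0n euler_kappa_partS (rmorph_nat (@polyC R)).
have := congr1 ddx IH; rewrite [LHS]ddxD [in LHS]ddxB [RHS]ddxD !ddxZ !ddx_euler => /eqP.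
rewrite -subr_eq0 => /eqP E /=.
apply/eqP; rewrite -subr_eq0 -[X in _ == X]E; apply/eqP.
rewrite addSn -!natr1 !polyCB !polyCD -!mul_polyC; ring.
Qed.

Lemma taylor_rec0 n : (iter n.+1 ddx (kappa_part 0)).[1].[-1] =
  (alpha - n%:R) * (iter n ddx (kappa_part 0)).[1].[-1].
Proof. by rewrite /= /ddx -/ddx euler_iter0 !hornerE. Qed.

(** At u = 1 the operators [euler] and [ddx] agree, and two of the terms
    cancel. *)
Lemma taylor_recS k n : (iter n.+1 ddx (kappa_part k.+1)).[1].[-1] =
  (alpha - n%:R) * (iter n ddx (kappa_part k.+1)).[1].[-1]
    + (n + k)%:R * (iter n ddx (kappa_part k)).[1].[-1].
Proof.
have ddx1 F : (ddx F).[1] = (euler F).[1] by rewrite /ddx hornerM hornerX mul1r.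
rewrite iterS ddx1; have := congr1 (horner^~ 1) (euler_iterS k n) => /=.
rewrite hornerD [X in X + _ = _]hornerD hornerN ddx1 subrK => ->.
by rewrite hornerD !hornerZ hornerD !hornerM !hornerC.
Qed.
End Formal.

Section Main.
Variable R : realType.
Variable g : nat.
Hypothesis g2 : (2 <= g)%N.
Let al : int := 2 - 2 * g%:Z.

Lemma acoef_monomial_evol p k m : (p < k)%N -> (m <= k - p)%N -> acoef R g p k m =
  monomial_evol R al p k m.
Proof.
case: p => [|[|[|p]]] pk mk.
- by apply: acoef0_monomial_evol => //; lia.
- by apply: acoef1_monomial_evol => //; lia.
- rewrite /acoef acoef2_eq //; last by lia.
  by rewrite acoef3_eq // ?acoef3'_monomial_evol //; lia.
- by rewrite /acoef acoef3_eq // ?acoef3'_monomial_evol //; lia.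
Qed.

(** This includes k < p, where the solution vanishes, and k = p, where it is
    u^alpha. *)
Lemma A_fun_monomial_evol p k (s : R) : A_fun g p k s =
  eval_at al (kappa_part (monomial_evol R al p) k) (s + 1).
Proof.
have evE : eval_at al (kappa_part (monomial_evol R al p) k) (s + 1) =
    \sum_(m < k.+1) (monomial_evol R al p k m).[s] * expR ((- (2 * g)%:R + 2 - m%:R) * (s + 1)).
  rewrite /eval_at /kappa_part horner_poly horner_sum mulr_suml; apply: eq_bigr => m _.
  rewrite addrK hornerM horner_exp hornerC -mulrA; congr (_ * _).
  rewrite -expRM_natl -expRD; congr expR.
  have -> : (al%:~R : R) = 2 - (2 * g)%:R by exact: intr_al.
  by ring.
rewrite evE /A_fun; case: ltnP => [kp|pk].
  by rewrite big1 // => m _; rewrite monomial_evol_eq0 ?horner0 ?mul0r // ltn_addr.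
case: eqP => [->|/eqP kp].
  rewrite big_ord_recl big1 ?addr0; last first.
    by move=> m _; rewrite monomial_evol_diag horner0 mul0r.
  by rewrite monomial_evol_diag hornerC mul1r subr0 [_ + 2]addrC.
rewrite big_mkord (big_ord_widen k.+1 (fun m => (acoef R g p k m).[s]
  * expR ((- (2 * g)%:R + 2 - m%:R) * (s + 1)))); last by lia.
rewrite big_mkcond; apply: eq_bigr => m _ /=; rewrite ltnS; case: leqP => mk.
  by rewrite acoef_monomial_evol // ltn_neqAle eq_sym kp.
by rewrite monomial_evol_eq0 ?horner0 ?mul0r //; lia.
Qed.

(** The combination of the solutions with the weights a_0^p has initial values
    a_0^k, for all k since a_0^k vanishes for k > d, and its Taylor coefficients
    obey the recursion that determines a_n^k from a_0^k. *)
Lemma taylor_coef_A_fun (a : nat -> nat -> rat) (d N n : nat) :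
  (forall n, n.+1%:R * a n.+1 0 = (2 - (2 * g)%:R - n%:R) * a n 0) ->
  (forall n k, n.+1%:R * a n.+1 k.+1 =
      (2 - (2 * g)%:R - n%:R) * a n k.+1 + (n + k)%:R * a n k) ->
  (forall k, (d < k)%N -> a 0 k = 0) ->
  \sum_(0 <= k < N) ratr (a n k) = taylor_coef (fun x : R =>
     \sum_(0 <= k < N) \sum_(0 <= p < d.+1) ratr (a 0 p) * A_fun g p k (ln (1 + x) - 1)) n.
Proof.
move=> rec0 recS a0.
pose c k m : {poly R} := \sum_(0 <= p < d.+1) ratr (a 0 p) *: monomial_evol R al p k m.
have cS : solves al c by apply: solves_sum => p; exact: solves_monomial_evol.
have -> : (fun x : R => \sum_(0 <= k < N) \sum_(0 <= p < d.+1) ratr (a 0 p) * A_fun g p k (ln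
  (1 + x) - 1))
   = eval_in al (\sum_(0 <= k < N) kappa_part c k).
  apply/funext => x; rewrite /eval_in /eval_at horner_sum horner_sum mulr_suml.
  apply: eq_bigr => k _.
  under eq_bigr do rewrite A_fun_monomial_evol subrK.
  rewrite /eval_at /kappa_part horner_poly horner_sum mulr_suml.
  rewrite (eq_bigr (fun p => \sum_(m < k.+1) ratr (a 0 p) * ((monomial_evol R al p k m * (expR
    (- ln (1 + x)))%:P ^+ m).[ln (1 + x) - 1] * expR (al%:~R * ln (1 + x))))); last first.
    move=> p _; rewrite -mulr_sumr; congr (_ * _).
    by rewrite horner_poly horner_sum mulr_suml.
  rewrite exchange_big; apply: eq_bigr => m _ /=.
  rewrite hornerM /c horner_sum !mulr_suml; apply: eq_bigr => p _.
  by rewrite hornerZ hornerM !mulrA.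
rewrite taylor_coef_eval_in iter_ddx_sum !horner_sum mulr_suml; apply: eq_bigr => k _.
have init k' : (kappa_part c k').[1].[-1] = ratr (a 0 k').
  rewrite /kappa_part horner_poly horner_sum.
  transitivity (initial c k').
    by apply: eq_bigr => m _; rewrite expr1n mulr1.
  transitivity (\sum_(0 <= p < d.+1) ratr (a 0 p) * initial (monomial_evol R al p) k').
    rewrite /initial /c; under eq_bigr do rewrite horner_sum.
    rewrite exchange_big; apply: eq_bigr => p _ /=.
    by rewrite mulr_sumr; apply: eq_bigr => m _; rewrite hornerZ.
  under eq_bigr do rewrite initial_monomial_evol.
  have [kd|dk] := leqP k' d; last first.
    rewrite a0 // rmorph0 big_nat_cond big1 // => p /andP[/andP[_ pd] _].
    by rewrite gtn_eqF ?mulr0 //; lia.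
  rewrite (bigD1_seq k') ?mem_index_iota ?iota_uniq //= eqxx mulr1 big1 ?addr0 //.
  by move=> p pk; rewrite eq_sym (negPf pk) mulr0.
suff H m : (forall k, (iter m (ddx al) (kappa_part c k)).[1].[-1] = m`!%:R * ratr (a m k)).
  by rewrite H mulrC mulKf // fact_neq0.
have alE : (al%:~R : R) = 2 - (2 * g)%:R by exact: intr_al.
elim: m => [|m IH] k'; first by rewrite init mul1r.
rewrite factS mulnC natrM -mulrA; case: k' => [|k'].
  rewrite taylor_rec0 // IH alE mulrCA; congr (_ * _).
  have := congr1 (@ratr R) (rec0 m).
  by rewrite !rmorphM !rmorphB /= !rmorph_nat => ->.
rewrite taylor_recS // !IH alE.
have := congr1 (@ratr R) (recS m k').
rewrite rmorphM rmorphD !rmorphM !rmorphB /= !rmorph_nat => ->.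
ring.
Qed.
End Main.

(** * Graphs on finite sets of vertices and half-edges *)

Section GraphData.
Variables (V H : finType) (vf : H -> V) (ff : H -> H) (gf : V -> nat).

Definition data_valence v := #|[pred h | vf h == v]|.

Definition data_adj : rel V := [rel u v | [exists h, (vf h == u) && (vf (ff h) == v)]].

(** The last condition is the genus formula multiplied by 2, without
    subtraction: for a connected graph, twice the number of edges is the number
    of half-edges minus n. *)
Definition data_ok (g n : nat) : bool :=
  [&& [forall h, ff (ff h) == h], #|[pred h | ff h == h]| == n,
      [forall u, forall v, connect data_adj u v],
      [forall v, (2 < 2 * gf v + data_valence v)%N] &
      (2 * (\sum_v gf v) + #|H| + 2 == 2 * g + 2 * #|V| + n)%N].

Definition data_weight : rat := \prod_v chi_M (gf v) (data_valence v).

Lemma sum_valence : (\sum_v data_valence v = #|H|)%N.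
Proof.
rewrite -sum1_card (partition_big vf predT) //=; apply: eq_bigr => v _.
by rewrite /data_valence -sum1_card; apply: eq_bigl.
Qed.

Lemma data_okP g n : reflect [/\ forall h, ff (ff h) = h, #|[pred h | ff h == h]| = n,
   forall u v, connect data_adj u v, forall v, (2 < 2 * gf v + data_valence v)%N &
   (2 * (\sum_v gf v) + #|H| + 2 = 2 * g + 2 * #|V| + n)%N] (data_ok g n).
Proof.
apply: (iffP and5P) => -[h1 h2 h3 h4 h5]; split.
- by move=> h; apply/eqP; exact: (forallP h1).
- exact/eqP.
- by move=> u v; exact: (forallP (forallP h3 u) v).
- exact/forallP.
- exact/eqP.
- by apply/forallP => h; apply/eqP.
- exact/eqP.
- by apply/forallP => u; apply/forallP.
- exact/forallP.
- exact/eqP.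
Qed.

Section Bounds.
Variables g n : nat.
Hypothesis ok : data_ok g n.

(** The numbers 2 g_v - 2 + val_v are positive and add up to 2g - 2 + n. *)
Lemma data_card_vertex : (#|V| + 2 <= 2 * g + n)%N.
Proof.
have [_ _ _ st ge] := data_okP g n ok.
have : (\sum_(v : V) 3 <= \sum_v (2 * gf v + data_valence v))%N by apply: leq_sum.
have -> : (\sum_(v : V) 3 = 3 * #|V|)%N.
  by rewrite sum_nat_const mulnC; congr (_ * _)%N; exact: eq_card.
rewrite big_split /= -big_distrr /= sum_valence; move: ge .
move: (#|V|) (#|H|) (\sum_v gf v)%N => a b c; lia.
Qed.

Lemma data_card_half : (#|H| <= 6 * g + 3 * n)%N.
Proof.
by have := data_card_vertex; have [_ _ _ _ ge] := data_okP g n ok; lia.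
Qed.

Lemma data_genus_bound v : (gf v <= 3 * g + 2 * n)%N.
Proof.
have := data_card_vertex; have [_ _ _ _ ge] := data_okP g n ok.
have : (gf v <= \sum_v gf v)%N by rewrite (bigD1 v) //= leq_addr.
lia.
Qed.
End Bounds.
End GraphData.

Section DataIso.
Variables (V H V' H' : finType) (vf : H -> V) (ff : H -> H) (gf : V -> nat).
Variables (vf' : H' -> V') (ff' : H' -> H') (gf' : V' -> nat).
Variables (f : V -> V') (h : H -> H').

Definition data_iso : Prop :=
  [/\ forall x, vf' (h x) = f (vf x), forall x, ff' (h x) = h (ff x) &
      forall v, gf' (f v) = gf v].

Hypotheses (bf : bijective f) (bh : bijective h) (iso : data_iso).

Lemma iso_card_vertex : #|V'| = #|V|. Proof. exact/esym/(bij_eq_card bf). Qed.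
Lemma iso_card_half : #|H'| = #|H|. Proof. exact/esym/(bij_eq_card bh). Qed.

Lemma iso_valence v : data_valence vf' (f v) = data_valence vf v.
Proof.
have [E _ _] := iso.
rewrite /data_valence -!sum1_card (reindex h) /=; last exact: onW_bij.
by apply: eq_bigl => x; rewrite !inE E (inj_eq (bij_inj bf)).
Qed.

Lemma iso_weight : data_weight vf' gf' = data_weight vf gf.
Proof.
have [_ _ E] := iso.
rewrite /data_weight (reindex f) /=; last exact: onW_bij.
by apply: eq_bigr => v _; rewrite E iso_valence.
Qed.

Lemma iso_legs : #|[pred x | ff' x == x]| = #|[pred x | ff x == x]|.
Proof.
have [_ E _] := iso.
rewrite -!sum1_card (reindex h) /=; last exact: onW_bij.
by apply: eq_bigl => x; rewrite !inE E (inj_eq (bij_inj bh)).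
Qed.

Lemma iso_genus : (\sum_v gf' v = \sum_v gf v)%N.
Proof.
have [_ _ E] := iso.
by rewrite (reindex f) /=; [apply: eq_bigr => v _; rewrite E | exact: onW_bij].
Qed.
End DataIso.

Lemma connect_map (V V' : finType) (e : rel V) (e' : rel V') (f : V -> V') :
  (forall u v, e u v -> connect e' (f u) (f v)) ->
  forall u v, connect e u v -> connect e' (f u) (f v).
Proof.
move=> H u v /connectP[p]; elim: p u => [|w p IH] u /=; first by move=> _ ->.
by move=> /andP[uw wp] vp; apply: connect_trans (H _ _ uw) (IH _ wp vp).
Qed.

Lemma iso_ok_impl (V H V' H' : finType) (vf : H -> V) (ff : H -> H) (gf : V -> nat)
    (vf' : H' -> V') (ff' : H' -> H') (gf' : V' -> nat) f h g n :
  bijective f -> bijective h -> data_iso vf ff gf vf' ff' gf' f h ->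
  data_ok vf ff gf g n -> data_ok vf' ff' gf' g n.
Proof.
move=> bf bh iso /data_okP[h1 h2 h3 h4 h5].
have [f' fK f'K] := bf; have [h' hK h'K] := bh; have [i1 i2 i3] := iso.
apply/data_okP; split.
- by move=> x; rewrite -(h'K x) !i2 h1.
- by rewrite (iso_legs bh iso).
- move=> u v; rewrite -(f'K u) -(f'K v); apply: connect_map (h3 _ _) => {u v} u v.
  move=> /existsP[x /andP[/eqP<- /eqP<-]]; apply: connect1.
  by apply/existsP; exists (h x); rewrite i1 i2 i1 !eqxx.
- by move=> v; rewrite -(f'K v) i3 (iso_valence bf bh iso).
- by rewrite (iso_genus bf iso) (iso_card_half bh) (iso_card_vertex bf).
Qed.

Lemma iso_inv (V H V' H' : finType) (vf : H -> V) (ff : H -> H) (gf : V -> nat)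
    (vf' : H' -> V') (ff' : H' -> H') (gf' : V' -> nat) f h f' h' :
  cancel f f' -> cancel f' f -> cancel h h' -> cancel h' h ->
  data_iso vf ff gf vf' ff' gf' f h -> data_iso vf' ff' gf' vf ff gf f' h'.
Proof.
move=> fK f'K hK h'K [i1 i2 i3]; split=> x.
- by apply: (can_inj fK); rewrite f'K -i1 h'K.
- by apply: (can_inj hK); rewrite h'K -i2 h'K.
- by rewrite -i3 f'K.
Qed.

Lemma iso_ok (V H V' H' : finType) (vf : H -> V) (ff : H -> H) (gf : V -> nat)
    (vf' : H' -> V') (ff' : H' -> H') (gf' : V' -> nat) f h g n :
  bijective f -> bijective h -> data_iso vf ff gf vf' ff' gf' f h ->
  data_ok vf' ff' gf' g n = data_ok vf ff gf g n.
Proof.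
move=> bf bh iso; apply/idP/idP; last exact: iso_ok_impl iso.
have [f' fK f'K] := bf; have [h' hK h'K] := bh.
by apply: (iso_ok_impl _ _ (iso_inv fK f'K hK h'K iso)); [exists f | exists h].
Qed.

Lemma big_option (R : Type) (idx : R) (op : Monoid.com_law idx) (T : finType)
    (P : pred (option T)) (F : option T -> R) :
  \big[op/idx]_(i | P i) F i =
  op (if P None then F None else idx) (\big[op/idx]_(i | P (Some i)) F (Some i)).
Proof.
rewrite big_mkcond (bigD1 None) //=; congr (op _ _).
rewrite -big_mkcondr (reindex_omap Some id) /=; last by case.
by apply: eq_bigl => i; rewrite eqxx andbT.
Qed.

Lemma card_option_pred (T : finType) (P : pred (option T)) :
  #|P| = (P None + #|[pred x | P (Some x)]|)%N.
Proof. by rewrite -!sum1_card big_option; congr addn; case: (P None). Qed.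

(** Forgetting a marked point has fibre a surface of Euler characteristic
    2 - 2g - n; the sum over graphs inherits its recursion from this one. *)
Lemma chi_M_S (g n : nat) : (2 < 2 * g + n)%N ->
  chi_M g n.+1 = (2 - (2 * g)%:R - n%:R) * chi_M g n.
Proof.
move=> gn; rewrite /chi_M.
have -> : (2 * g + n.+1 - 3 = (2 * g + n - 3).+1)%N by lia.
rewrite factS (natrM _ (2 * g + n - 3).+1) exprS.
have -> : ((2 * g + n - 3).+1)%N%:R = (2 * g)%:R + n%:R - 2 :> rat.
  by rewrite -natrD -natrB; [congr (_%:R); lia | lia].
by ring.
Qed.

Lemma chi_M03 : chi_M 0 3 = 1.
Proof.
rewrite /chi_M /bernoulli_number /= !fact0 mulr1 divr1 sub0r.
by rewrite mulr1 -exprSr -signr_odd.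
Qed.

(** * Sums over labelled graphs *)

Section Structures.
Variables (N g : nat).

(** The graphs with vertex set V and half-edges H.  The bound N on the genus of
    the vertices makes them a finite type; stability provides it. *)
Definition structure (V H : finType) : finType :=
  ({ffun H -> V} * {ffun H -> H} * {ffun V -> 'I_N.+1})%type.

Definition svert (V H : finType) (x : structure V H) : H -> V := x.1.1.
Definition sflip (V H : finType) (x : structure V H) : H -> H := x.1.2.
Definition sgen (V H : finType) (x : structure V H) : V -> nat := fun v => x.2 v.

Definition okstr (n : nat) (V H : finType) (x : structure V H) : bool :=
  data_ok (svert x) (sflip x) (sgen x) g n.

Definition sweight (V H : finType) (x : structure V H) : rat := data_weight (svert x) (sgen x).

Definition svalence (V H : finType) (x : structure V H) := data_valence (svert x).

Definition total_weight n (V H : finType) : rat := \sum_(x : structure V H | okstr n x) sweight x.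

Section Transport.
Variables (V H V' H' : finType) (f : V -> V') (f' : V' -> V) (h : H -> H') (h' : H' -> H).
Hypotheses (fK : cancel f f') (f'K : cancel f' f) (hK : cancel h h') (h'K : cancel h' h).

Definition transport (x : structure V H) : structure V' H' :=
  ([ffun y => f (svert x (h' y))], [ffun y => h (sflip x (h' y))], [ffun v => x.2 (f' v)]).

Lemma transport_iso x : data_iso (svert x) (sflip x) (sgen x)
  (svert (transport x)) (sflip (transport x)) (sgen (transport x)) f h.
Proof. by split=> y; rewrite /svert /sflip /sgen !ffunE /= ?hK ?fK. Qed.

Lemma transport_ok n x : okstr n (transport x) = okstr n x.
Proof.
by apply: iso_ok (transport_iso x); [exists f' | exists h'].
Qed.

Lemma transport_weight x : sweight (transport x) = sweight x.
Proof.
by apply: iso_weight (transport_iso x); [exists f' | exists h'].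
Qed.

Lemma transport_val x v : svalence (transport x) (f v) = svalence x v.
Proof.
by apply: iso_valence (transport_iso x) v; [exists f' | exists h'].
Qed.
End Transport.

Lemma transportK (V H V' H' : finType) (f : V -> V') (f' : V' -> V) (h : H -> H') (h' : H' -> H) :
  cancel f f' -> cancel h h' -> cancel (transport f f' h h') (transport f' f h' h).
Proof.
move=> fK hK [[a b] c]; rewrite /transport /svert /sflip /=; congr (_, _, _).
- by apply/ffunP => y; rewrite !ffunE /= hK fK.
- by apply/ffunP => y; rewrite !ffunE /= !hK.
- by apply/ffunP => y; rewrite !ffunE /= fK.
Qed.

Lemma sum_transport (V H V' H' : finType)
    (f : V -> V') (f' : V' -> V) (h : H -> H') (h' : H' -> H)
    n (P : pred (structure V H)) (P' : pred (structure V' H')) :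
  cancel f f' -> cancel f' f -> cancel h h' -> cancel h' h ->
  (forall x, P' (transport f f' h h' x) = P x) ->
  \sum_(x | okstr n x && P' x) sweight x = \sum_(x | okstr n x && P x) sweight x.
Proof.
move=> fK f'K hK h'K PP'.
rewrite (reindex (transport f f' h h')) /=; last first.
  by apply: onW_bij; exists (transport f' f h' h); apply: transportK.
apply: eq_big => x; first by rewrite transport_ok // PP'.
by move=> _; rewrite transport_weight.
Qed.

(** * Attaching an external edge to a vertex *)

Section AddLeg.
Variables (V H : finType).

Definition add_leg (x : structure V H) (v : V) : structure V (option H) :=
  ([ffun y => if y is Some z then svert x z else v],
   [ffun y => omap (sflip x) y], x.2).

(** The default value y is reached only when [None] is joined to y, which is
    excluded for an external edge. *)
Definition del_leg (x : structure V (option H)) : structure V H :=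
  ([ffun y => svert x (Some y)], [ffun y => odflt y (sflip x (Some y))], x.2).

Lemma add_leg_val x v w : svalence (add_leg x v) w = ((v == w) + svalence x w)%N.
Proof.
rewrite /svalence /data_valence card_option_pred /svert /= ffunE; congr addn.
by apply: eq_card => y; rewrite !inE ffunE.
Qed.

Lemma add_leg_legs x v : #|[pred y | sflip (add_leg x v) y == y]| =
  #|[pred y | sflip x y == y]|.+1.
Proof.
rewrite card_option_pred /sflip /= !ffunE /= add1n; congr S.
by apply: eq_card => y; rewrite !inE ffunE /=.
Qed.

Lemma add_leg_adj x v u w :
  data_adj (svert (add_leg x v)) (sflip (add_leg x v)) u w =
  ((v == u) && (v == w)) || data_adj (svert x) (sflip x) u w.
Proof.
apply/existsP/idP => [[[y|]] | /orP[H0|/existsP[y Hy]]].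
- rewrite /svert /sflip !ffunE /= => E; apply/orP; right; apply/existsP; exists y.
  exact: E.
- by rewrite /svert /sflip !ffunE /= ?ffunE => ->.
- by exists None; rewrite /svert /sflip !ffunE /= ?ffunE.
- by exists (Some y); rewrite /svert /sflip !ffunE /= ?ffunE; exact: Hy.
Qed.

Lemma add_leg_ok n x v : okstr n.+1 (add_leg x v) && (3 < 2 * sgen x v + svalence (add_leg x v)
  v)%N = okstr n x.
Proof.
rewrite add_leg_val eqxx.
have cE u w : connect (data_adj (svert (add_leg x v)) (sflip (add_leg x v))) u w =
   connect (data_adj (svert x) (sflip x)) u w.
  apply/idP/idP; apply: (connect_map (f := id)) => {}u {}w /=.
    rewrite add_leg_adj => /orP[/andP[/eqP<- /eqP<-] //|uw]; exact: connect1.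
  by move=> uw; apply: connect1; rewrite add_leg_adj uw orbT.
have gE w : sgen (add_leg x v) w = sgen x w by [].
have GE : (\sum_w sgen (add_leg x v) w = \sum_w sgen x w)%N by [].
apply/andP/idP => [[/data_okP[h1 h2 h3 h4 h5] h6] | /data_okP[h1 h2 h3 h4 h5]].
- apply/data_okP; split.
  + by move=> y; have := h1 (Some y); rewrite /sflip /= !ffunE /= => -[].
  + by move: h2; rewrite add_leg_legs => -[].
  + by move=> u w; rewrite -cE.
  + move=> w; have := h4 w; rewrite -/(svalence _ _) add_leg_val -/(svalence _ _) gE.
    by case: eqP => [<-|_] //; move: h6; lia.
  + by move: h5; rewrite card_option GE; move: (\sum_w _)%N => *; lia.
- split; last by have := h4 v; rewrite -/(svalence _ _); lia.
  apply/data_okP; split.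
  + move=> [y|]; rewrite /sflip /= !ffunE //= ?ffunE //=; congr Some; exact: h1.
  + by rewrite add_leg_legs h2.
  + by move=> u w; rewrite cE.
  + by move=> w; have := h4 w; rewrite -/(svalence _ _) -/(svalence _ _) add_leg_val gE; lia.
  + by move: h5; rewrite card_option GE; move: (\sum_w _)%N => *; lia.
Qed.

Lemma add_leg_weight x v : (2 < 2 * sgen x v + svalence x v)%N ->
  sweight (add_leg x v) = (2 - (2 * sgen x v)%:R - (svalence x v)%:R) * sweight x.
Proof.
move=> st; rewrite /sweight /data_weight (bigD1 v) //= [in RHS](bigD1 v) //= mulrA.
rewrite -/(svalence _ _) add_leg_val eqxx add1n chi_M_S //; congr (_ * _).
by apply: eq_bigr => w; rewrite -/(svalence _ _) add_leg_val eq_sym => /negPf->.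
Qed.

Lemma add_legK x v : del_leg (add_leg x v) = x.
Proof.
case: x => -[a b] c; rewrite /del_leg /add_leg /svert /sflip /=; congr (_, _, _).
  by apply/ffunP => y; rewrite !ffunE.
by apply/ffunP => y; rewrite !ffunE.
Qed.

Lemma del_legK n x : okstr n x -> sflip x None = None ->
  add_leg (del_leg x) (svert x None) = x.
Proof.
case: x => -[a b] c /data_okP[h1 _ _ _ _] h0; rewrite /add_leg /del_leg /svert /sflip /=.
congr (_, _, _); apply/ffunP => -[y|]; rewrite !ffunE //= ?ffunE //.
case E : (b (Some y)) => [z|] //=.
by have := h1 (Some y); rewrite /sflip /= E [b None]h0.
Qed.

(** Additivity of the Euler characteristic along the graph. *)
Lemma sum_euler n (x : structure V H) : okstr n x ->
  \sum_v (2 - (2 * sgen x v)%:R - (svalence x v)%:R) = 2 - (2 * g)%:R - n%:R :> rat.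
Proof.
move=> /data_okP[_ _ _ _ /(congr1 (fun m => m%:R : rat))].
rewrite !sumrB -!natr_sum -big_distrr /= /svalence sum_valence.
have -> : (\sum_(v : V) 2 = 2 * #|V|)%N.
  by rewrite sum_nat_const mulnC; congr (_ * _)%N; exact: eq_card.
rewrite !natrD; lra.
Qed.

(** Each vertex v receives the leg with the factor 2 - 2g_v - val_v; the sum over
    v does not depend on the graph. *)
Lemma sum_add_leg n :
  \sum_(x : structure V (option H) | okstr n.+1 x && ((sflip x None == None)
     && (3 < 2 * sgen x (svert x None) + svalence x (svert x None))%N)) sweight x
  = (2 - (2 * g)%:R - n%:R) * total_weight n V H.
Proof.
rewrite (reindex_onto (fun p : structure V H * V => add_leg p.1 p.2)
    (fun x => (del_leg x, svert x None))) /=; last first.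
  by move=> x /andP[okx /andP[/eqP h0 _]]; apply: del_legK okx h0.
rewrite (eq_bigl (fun p : structure V H * V => okstr n p.1)); last first.
  move=> [x v] /=; rewrite add_legK.
  have -> : svert (add_leg x v) None = v by rewrite /svert ffunE.
  have -> : sflip (add_leg x v) None = None by rewrite /sflip ffunE.
  by rewrite !eqxx andbT /= add_leg_ok.
rewrite (eq_bigl (fun p : structure V H * V => okstr n p.1 && true)); last by move=> p;
  rewrite andbT.
rewrite -(pair_big_dep (fun x : structure V H => okstr n x) (fun _ _ => true) (fun x v =>
  sweight (add_leg x v))) /=.
rewrite /total_weight mulr_sumr; apply: eq_bigr => x okx.
rewrite -(sum_euler okx) mulr_suml; apply: eq_bigr => v _.
by rewrite add_leg_weight //; have /data_okP[_ _ _ h4 _] := okx; exact: h4.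
Qed.
End AddLeg.
End Structures.

(** * Inserting a trivalent vertex *)

Section Insertion.
Variables (N g : nat) (V H : finType).
Local Notation H3 := (option (option (option H))).
Local Notation structure := (structure N).
Local Notation okstr := (okstr g).

(** The new vertex [None] carries three new half-edges: the external edge
    [None], and [leg1] and [leg2], which are to be joined to the rest of the
    graph. *)
Definition old (z : H) : H3 := Some (Some (Some z)).
Definition leg1 : H3 := Some None.
Definition leg2 : H3 := Some (Some None).
Definition is_old (h : H3) : bool := if h is Some (Some (Some _)) then true else false.

Lemma is_oldP h : reflect (exists z, h = old z) (is_old h).
Proof.
case: h => [[[z|]|]|]; constructor; try by case.
by exists z.
Qed.

Lemma old_inj : injective old. Proof. by move=> a b []. Qed.

Lemma card_H3 (P : pred H3) :
  #|P| = (P None + (P leg1 + (P leg2 + #|[pred z | P (old z)]|)))%N.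
Proof. by rewrite !card_option_pred. Qed.

(** The half-edge y is joined to [leg2], and its former partner to [leg1].  When
    y is an external edge, [leg1] takes over as external edge.  So the new
    vertex subdivides the internal or external edge of y, and an internal edge
    is met twice, once from each end. *)
Definition insert (x : structure V H) (y : H) : structure (option V) H3 :=
  ([ffun h : H3 => if h is Some (Some (Some z)) then Some (svert x z) else None],
   [ffun h : H3 => match h with
     | None => None
     | Some None => if sflip x y == y then leg1 else old (sflip x y)
     | Some (Some None) => old y
     | Some (Some (Some z)) =>
         if z == y then leg2 else if z == sflip x y then leg1 else old (sflip x z)
     end],
   [ffun v => if v is Some w then x.2 w else ord0]).

Section InsertTheory.
Variables (x : structure V H) (y : H).

Lemma insert_vert_old z : svert (insert x y) (old z) = Some (svert x z).
Proof. by rewrite /svert ffunE. Qed.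
Lemma insert_vert h : ~~ is_old h -> svert (insert x y) h = None.
Proof. by rewrite /svert ffunE; case: h => [[[]|]|]. Qed.
Lemma insert_flip0 : sflip (insert x y) None = None.
Proof. by rewrite /sflip ffunE. Qed.
Lemma insert_flip1 : sflip (insert x y) leg1 = if sflip x y == y then leg1 else old (sflip x y).
Proof. by rewrite /sflip ffunE. Qed.
Lemma insert_flip2 : sflip (insert x y) leg2 = old y.
Proof. by rewrite /sflip ffunE. Qed.
Lemma insert_flip_old z : sflip (insert x y) (old z) =
  if z == y then leg2 else if z == sflip x y then leg1 else old (sflip x z).
Proof. by rewrite /sflip ffunE. Qed.
Lemma insert_gen_old v : sgen (insert x y) (Some v) = sgen x v.
Proof. by rewrite /sgen ffunE. Qed.
Lemma insert_gen0 : sgen (insert x y) None = 0%N.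
Proof. by rewrite /sgen ffunE. Qed.

Lemma insert_val v : svalence (insert x y) v = if v is Some w then svalence x w else 3.
Proof.
rewrite /svalence /data_valence card_H3 /= !insert_vert //.
case: v => [w|] /=.
  by rewrite !add0n; apply: eq_card => z; rewrite !inE insert_vert_old.
by rewrite ?eqxx eq_card0 // => z; rewrite !inE insert_vert_old.
Qed.

Lemma insert_weight : sweight (insert x y) = sweight x.
Proof.
rewrite /sweight /data_weight big_option /= -/(svalence _ _) insert_val insert_gen0 chi_M03 mul1r.
by apply: eq_bigr => v _; rewrite -/(svalence _ _) insert_val insert_gen_old.
Qed.

Hypothesis flipK : forall z, sflip x (sflip x z) = z.

Lemma insert_flipK h : sflip (insert x y) (sflip (insert x y) h) = h.
Proof.
case: h => [[[z|]|]|]; rewrite -/leg1 -/leg2 -?/(old _).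
- rewrite insert_flip_old; case: (eqVneq z y) => [->|zy]; first by rewrite insert_flip2.
  case: (eqVneq z (sflip x y)) => [zE|zy'].
    rewrite insert_flip1; case: eqP => [E|_]; last by rewrite -zE.
    by rewrite zE E eqxx in zy.
  rewrite insert_flip_old flipK.
  case: eqP => [E|_]; first by rewrite -E flipK eqxx in zy'.
  by case: eqP => // E; rewrite -[z]flipK E flipK eqxx in zy.
- by rewrite insert_flip2 insert_flip_old eqxx.
- rewrite insert_flip1; case: eqP => [E|/eqP E].
    by rewrite insert_flip1 E eqxx.
  by rewrite insert_flip_old (negPf E) eqxx.
- by rewrite !insert_flip0.
Qed.

Lemma insert_legs : #|[pred h | sflip (insert x y) h == h]| = #|[pred z | sflip x z == z]|.+1.
Proof.
rewrite card_H3 /= insert_flip0 insert_flip1 insert_flip2 eqxx add1n add0n; congr S.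
rewrite [in RHS](cardD1 y) inE; case: (eqVneq (sflip x y) y) => yE; congr addn => /=.
- apply: eq_card => z; rewrite !inE insert_flip_old yE.
  by case: (eqVneq z y) => //= _; rewrite (inj_eq old_inj).
- apply: eq_card => z; rewrite !inE insert_flip_old.
  case: (eqVneq z y) => //= zy; case: (eqVneq z (sflip x y)) => [zE|_] /=.
    by rewrite zE flipK [y == _]eq_sym (negPf yE).
  by rewrite (inj_eq old_inj).
Qed.

Local Notation adj := (data_adj (svert x) (sflip x)).
Local Notation adj' := (data_adj (svert (insert x y)) (sflip (insert x y))).

Lemma adj_half h : adj' (svert (insert x y) h) (svert (insert x y) (sflip (insert x y) h)).
Proof. by apply/existsP; exists h; rewrite !eqxx. Qed.

Lemma insert_adj2 : adj' None (Some (svert x y)).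
Proof.
by have := adj_half leg2; rewrite insert_flip2 insert_vert_old insert_vert.
Qed.

Lemma insert_adj2' : adj' (Some (svert x y)) None.
Proof.
by have := adj_half (old y); rewrite insert_flip_old eqxx insert_vert_old insert_vert.
Qed.

(** In one direction a step of the old graph along the subdivided edge becomes
    two steps; in the other direction the new vertex is moved to the vertex
    of y. *)
Lemma insert_connect : (forall u v, connect adj u v) <-> (forall u v, connect adj' u v).
Proof.
split=> C.
  have C' u v : connect adj' (Some u) (Some v).
    apply: connect_map (C u v) => {}u {}v /existsP[z /andP[/eqP<- /eqP<-]].
    have := adj_half (old z); rewrite insert_flip_old insert_vert_old.
    have [-> _|zy] := eqVneq z y.
      have [->//|yE] := eqVneq (sflip x y) y.
      apply: connect_trans (connect1 insert_adj2') _; apply: connect1.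
      by have := adj_half leg1; rewrite insert_flip1 (negPf yE) insert_vert_old insert_vert.
    have [zE H0|_] := eqVneq z (sflip x y).
      rewrite {2}zE flipK; apply: connect_trans (connect1 insert_adj2).
      by apply: connect1; rewrite insert_vert in H0.
    by rewrite insert_vert_old; apply: connect1.
  move=> [u|] [v|] //.
  - by apply: connect_trans (C' _ _) (connect1 insert_adj2').
  - by apply: connect_trans (connect1 insert_adj2) (C' _ _).
move=> u v.
pose p (w : option V) := odflt (svert x y) w.
suff : connect adj (p (Some u)) (p (Some v)) by [].
apply: connect_map (C _ _) => {u v C} u v /existsP[h /andP[/eqP<- /eqP<-]].
case: h => [[[z|]|]|]; rewrite -/leg1 -/leg2 -?/(old _).
- rewrite insert_flip_old insert_vert_old.
  have [->|zy] := eqVneq z y; first by rewrite insert_vert.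
  have [zE|_] := eqVneq z (sflip x y).
    rewrite insert_vert //=; apply: connect1; apply/existsP; exists z.
    by rewrite zE flipK !eqxx.
  rewrite insert_vert_old; apply: connect1; apply/existsP; exists z.
  by rewrite !eqxx.
- by rewrite insert_flip2 insert_vert_old insert_vert.
- rewrite insert_flip1 insert_vert //; case: eqP => [_|_]; first by rewrite insert_vert.
  rewrite insert_vert_old /=; apply: connect1; apply/existsP; exists y.
  by rewrite !eqxx.
- by rewrite insert_flip0 insert_vert.
Qed.

(** One more vertex, three more half-edges and one more external edge keep the
    genus. *)
Lemma insert_ok n : okstr n.+1 (insert x y) = okstr n x.
Proof.
have GE : (\sum_w sgen (insert x y) w = \sum_w sgen x w)%N.
  rewrite big_option /= insert_gen0 add0n; apply: eq_bigr => v _; exact: insert_gen_old.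
apply/idP/idP => /data_okP[h1 h2 h3 h4 h5]; apply/data_okP; split.
- exact: flipK.
- by move: h2; rewrite insert_legs => -[].
- exact/insert_connect.
- by move=> v; have := h4 (Some v); rewrite -/(svalence _ _) insert_val insert_gen_old.
- by move: h5; rewrite !card_option GE; move: (\sum_w _)%N => *; lia.
- exact: insert_flipK.
- by rewrite insert_legs h2.
- exact/insert_connect.
- by move=> [v|]; rewrite -/(svalence _ _) insert_val ?insert_gen_old ?insert_gen0 //; exact: h4.
- by move: h5; rewrite !card_option GE; move: (\sum_w _)%N => *; lia.
Qed.
End InsertTheory.

End Insertion.

Section SumInsert.
Variables (N g : nat) (V H : finType).
Hypothesis g2 : (2 <= g)%N.
Local Notation H3 := (option (option (option H))).
Local Notation structure := (structure N).
Local Notation okstr := (okstr g).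
Local Notation leg1 := (leg1 H).
Local Notation leg2 := (leg2 H).
Implicit Types (X : structure (option V) H3).

(** The form of a graph around the marked external edge [None] when its vertex is
    not stable without it. *)
Definition central X : bool :=
  [&& sflip X None == None, sgen X None == 0%N &
      [forall h, (svert X h == None) == ~~ is_old h]].

Lemma insert_inj (x x' : structure V H) y y' :
  (forall z, sflip x (sflip x z) = z) -> (forall z, sflip x' (sflip x' z) = z) ->
  insert x y = insert x' y' -> x = x' /\ y = y'.
Proof.
move=> xK x'K E.
have yE : y = y'.
  by apply: (@old_inj H); rewrite -(insert_flip2 x y) E insert_flip2.
subst y'; split=> //.
have fy : sflip x y = sflip x' y.
  have := insert_flip1 x y; rewrite E insert_flip1.
  case: (eqVneq (sflip x y) y) => [->|_]; case: (eqVneq (sflip x' y) y) => [->|_] //.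
  by move=> /old_inj.
have E1 : svert x =1 svert x'.
  by move=> z; apply: Some_inj; rewrite -(insert_vert_old x y) E insert_vert_old.
have E2 : sflip x =1 sflip x'.
  move=> z; have := insert_flip_old x y z; rewrite E insert_flip_old -fy.
  case: (eqVneq z y) => [->|zy] //; case: (eqVneq z (sflip x y)) => [->|_].
    by rewrite xK fy x'K.
  by move=> /old_inj.
have E3 v : x.2 v = x'.2 v.
  apply: val_inj; have := insert_gen_old x y v; rewrite E insert_gen_old => H0.
  by rewrite -[LHS]/(sgen x v) -H0.
case: x x' {E xK x'K fy} E1 E2 E3 => -[a b] c [[a' b'] c'] E1 E2 E3.
by congr (_, _, _); apply/ffunP.
Qed.

(** Here y is the partner of [leg2].  The flip of the smaller graph sends y to
    the partner of [leg1], or to y if [leg1] is an external edge. *)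
Lemma insert_surj n X : okstr n.+1 X -> central X -> is_old (sflip X leg2) ->
  exists p : structure V H * H, okstr n p.1 /\ insert p.1 p.2 = X.
Proof.
move=> okX /and3P[/eqP c1 /eqP c2 /forallP c3] /is_oldP[y f2].
have flipK h : sflip X (sflip X h) = h by have /data_okP[] := okX.
have cold h : (svert X h == None) = ~~ is_old h by exact: (eqP (c3 h)).
have /fin_all_exists[a aE] z : exists v, svert X (old z) = Some v.
  by have := cold (old z); case: (svert X (old z)) => // v _; exists v.
have vE h : ~~ is_old h -> svert X h = None by move=> H0; apply/eqP; rewrite cold.
have fy : sflip X (old y) = leg2 by rewrite -f2 flipK.
have n0 z : sflip X (old z) <> None by move=> H0; have /eqP := flipK (old z); rewrite H0 c1.
have n1 : sflip X leg1 <> None by move=> H0; have /eqP := flipK leg1; rewrite H0 c1.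
have n2 : sflip X leg1 <> leg2 by move=> H0; have /eqP := flipK leg1; rewrite H0 f2.
have /fin_all_exists[b bE] z : exists w,
    if z == y then sflip X leg1 = (if w == y then leg1 else old w)
    else if sflip X (old z) == leg1 then w = y else sflip X (old z) = old w.
  case: (eqVneq z y) => [zy|zy].
    have [L1|L1] := eqVneq (sflip X leg1) leg1; first by exists y; rewrite eqxx.
    case E : (sflip X leg1) L1 n1 n2 => [[[w|]|]|] // _ _ _.
    exists w; case: eqP => // wy; move: E; rewrite wy -/(old y) => E.
    by have := flipK leg1; rewrite E fy.
  case: (eqVneq (sflip X (old z)) leg1) => [_|L1]; first by exists y.
  case E : (sflip X (old z)) L1 (n0 z) => [[[w|]|]|] // _ _; first by exists w.
  by have := flipK (old z); rewrite E -/leg2 f2 => /old_inj yz; rewrite yz eqxx in zy.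
pose x : structure V H := ([ffun z => a z], [ffun z => b z], [ffun v => X.2 (Some v)]).
have xf z : sflip x z = b z by rewrite /sflip ffunE.
(* b is the flip of the smaller graph. *)
have by_ : sflip X leg1 = (if b y == y then leg1 else old (b y)).
  by have := bE y; rewrite eqxx.
have bz z : z != y -> sflip X (old z) = (if z == b y then leg1 else old (b z)).
  move=> zy; have := bE z; rewrite (negPf zy).
  have [zby|zby] := eqVneq z (b y).
    have yn : b y == y = false by rewrite -zby (negPf zy).
    have -> : sflip X (old z) = leg1 by rewrite zby; have := flipK leg1; rewrite by_ yn.
    by [].
  case: eqP => // L1 _; case: (eqVneq (b y) y) by_ => [_|_] E.
    by have := flipK (old z); rewrite L1 E.
  have := flipK (old z); rewrite L1 E => /old_inj E'.
  by rewrite E' eqxx in zby.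
have E : insert x y = X.
  have E1 : svert (insert x y) =1 svert X.
    move=> h; case: (boolP (is_old h)) => [/is_oldP[z ->]|ho].
      by rewrite insert_vert_old aE /svert ffunE.
    by rewrite insert_vert // vE.
  have E2 : sflip (insert x y) =1 sflip X.
    move=> [[[z|]|]|]; rewrite -/leg1 -/leg2 -?/(old _).
    - rewrite insert_flip_old !xf; case: (eqVneq z y) => [->|zy]; first by rewrite fy.
      by rewrite bz.
    - by rewrite insert_flip2 f2.
    - by rewrite insert_flip1 xf by_.
    - by rewrite insert_flip0 c1.
  have E3 v : (insert x y).2 v = X.2 v.
    apply: val_inj; case: v => [v|]; first by rewrite -[LHS]/(sgen (insert x y) (Some v))
      insert_gen_old /sgen ffunE.
    by rewrite -[LHS]/(sgen (insert x y) None) insert_gen0 -[RHS]/(sgen X None) c2.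
  by move: E1 E2 E3; case: X {okX c1 c2 c3 f2 flipK cold aE vE fy n0 n1 n2 bE x xf by_ bz}
    (insert x y) => -[p q] r [[p' q'] r'] E1 E2 E3; congr (_, _, _); apply/ffunP.
have xK z : sflip x (sflip x z) = z.
  rewrite !xf; have [zy|zy] := eqVneq z y.
    subst z; have [E0|yb] := eqVneq (b y) y; first by rewrite !E0.
    have := bz _ yb; rewrite eqxx => L.
    have := bE (b y); rewrite (negPf yb) L eqxx. by [].
  have [zby|zby] := eqVneq z (b y).
    have := bE z; rewrite (negPf zy) bz // zby eqxx => ->.
    by [].
  have Ez := bz _ zy; rewrite (negPf zby) in Ez.
  have bzy : b z != y.
    by apply/eqP => E0; have := flipK (old z); rewrite Ez E0 fy.
  have := flipK (old z); rewrite Ez bz //; case: eqP => // _; exact: old_inj.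
by exists (x, y); rewrite -(insert_ok g y xK) E.
Qed.

Lemma insert_central (x : structure V H) y : central (insert x y) && is_old (sflip (insert x y)
  leg2).
Proof.
rewrite /central insert_flip0 insert_gen0 insert_flip2 /= andbT.
apply/forallP => h; case: (boolP (is_old h)) => [/is_oldP[z ->]|ho].
  by rewrite insert_vert_old.
by rewrite insert_vert.
Qed.

Lemma sum_insert n (F : structure (option V) H3 -> rat) :
  \sum_(X | [&& okstr n.+1 X, central X & is_old (sflip X leg2)]) F X =
  \sum_(x : structure V H | okstr n x) \sum_(y : H) F (insert x y).
Proof.
rewrite pair_big /=.
rewrite (reindex_omap (fun p : structure V H * H => insert p.1 p.2)
   (fun X => [pick p : structure V H * H | okstr n p.1 && (insert p.1 p.2 == X)])); last first.
  move=> X /and3P[okX cX oX]; case: pickP => [p /andP[_ /eqP <-] // | H0].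
  have [p [okp pX]] := insert_surj okX cX oX.
  by have := H0 p; rewrite okp pX eqxx.
apply: eq_bigl => -[x y] /=; rewrite andbT; case: pickP => [[x' y'] /andP[/= okx' /eqP E]|H0].
  have x'K : forall z, sflip x' (sflip x' z) = z by have /data_okP[] := okx'.
  apply/andP/idP => [[_ /eqP[<- _]] //|okx].
  have xK : forall z, sflip x (sflip x z) = z by have /data_okP[] := okx.
  have [-> ->] := insert_inj x'K xK E.
  by rewrite insert_ok // okx insert_central.
rewrite andbF; apply/esym/negbTE/negP => okx.
by have := H0 (x, y); rewrite okx eqxx.
Qed.

(** The graphs where [leg2] is an external edge are reduced, by the exchange of
    [leg1] and [leg2], to those where [leg1] is. *)
Definition swap_legs (h : H3) : H3 :=
  match h with Some None => leg2 | Some (Some None) => leg1 | _ => h end.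

Lemma swap_legsK : involutive swap_legs. Proof. by case=> [[[]|]|]. Qed.

(** Otherwise the new vertex would be the whole graph, which would be of genus at
    most 1. *)
Lemma central_not_old n X : okstr n.+1 X -> central X ->
  is_old (sflip X leg1) || is_old (sflip X leg2).
Proof.
move=> okX /and3P[/eqP c1 /eqP c2 /forallP c3].
have /data_okP[flipK _ C _ E] := okX.
have cold h : (svert X h == None) = ~~ is_old h by exact: (eqP (c3 h)).
apply/negPn/negP; rewrite negb_or => /andP[no1 no2].
have adjN u : connect (data_adj (svert X) (sflip X)) None u -> u = None.
  move=> /connectP[p]; elim: p => [|w p IH] /=; first by move=> _ ->.
  case/andP=> /existsP[h /andP[hN /eqP hw]] pp.
  have ho : ~~ is_old h by rewrite -cold.
  have fo : ~~ is_old (sflip X h) by move: ho; case: h {hN hw} => [[[z|]|]|] //; rewrite c1.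
  have wN : w = None by rewrite -hw; apply/eqP; rewrite cold.
  by move: pp; rewrite wN; exact: IH.
have V0 (v : V) : False by have := adjN _ (C None (Some v)).
have H0 (z : H) : False.
  by have := cold (old z); case: (svert X (old z)) => [v|] //; have := V0 v.
have V00 : #|V| = 0%N by apply: eq_card0 => v; have := V0 v.
have H00 : #|H| = 0%N by apply: eq_card0 => v; have := H0 v.
move: E; rewrite big_option /= big1 ?c2; last by move=> v; have := V0 v.
rewrite !card_option V00 H00; lia.
Qed.

(** If [leg2] leads to an old half-edge, the graph is obtained from any of the
    #|H| half-edges y.  If not, then after the exchange of the legs it is
    obtained from one of the n external edges. *)
Lemma sum_central n :
  \sum_(X | okstr n.+1 X && central X) sweight X = (#|H| + n)%:R * total_weight N g n V H.
Proof.
rewrite (bigID (fun X => is_old (sflip X leg2))) /= natrD mulrDl; congr (_ + _).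
  rewrite (eq_bigl (fun X => [&& okstr n.+1 X, central X & is_old (sflip X leg2)])); last first.
    by move=> X; rewrite andbA.
  rewrite sum_insert /total_weight mulr_sumr; apply: eq_bigr => x _.
  under eq_bigr do rewrite insert_weight.
  by rewrite sumr_const mulr_natl; congr (_ *+ _); exact: eq_card.
transitivity (\sum_(X | okstr n.+1 X && (central X && ~~ is_old (sflip X leg2))) sweight X).
  by apply: eq_bigl => X; rewrite andbA.
rewrite (@sum_transport N g _ _ _ _ id id swap_legs swap_legs _
   (fun X => central X && ~~ is_old (sflip X leg1))) //; try exact: swap_legsK; last first.
  move=> X; congr andb.
    rewrite /central; congr [&& _, _ & _].
    - rewrite {1}/sflip ffunE /=.
      by case: (sflip X None) => [[[]|]|].
    - by rewrite {1}/sgen ffunE.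
    - apply/forallP/forallP => H0 h; have := H0 (swap_legs h);
      rewrite /svert ffunE ?swap_legsK /svert.
        by case: h => [[[]|]|].
      by case: h => [[[]|]|].
  rewrite {1}/sflip ffunE /=.
  by case: (sflip X leg1) => [[[]|]|].
transitivity (\sum_(X | [&& okstr n.+1 X, central X & is_old (sflip X leg2)])
   if sflip X leg1 == leg1 then sweight X else 0).
  rewrite big_mkcond [RHS]big_mkcond; apply: eq_bigr => X _.
  case okX : (okstr n.+1 X) => //=; case cX : (central X) => //=.
  have := central_not_old okX cX; have /data_okP[flipK _ _ _ _] := okX.
  have /and3P[/eqP c1 _ _] := cX.
  have K1 := flipK leg1; case E1 : (sflip X leg1) K1 => [[[z|]|]|] //=; rewrite ?c1 //.
    by case: ifP.
  - by move=> -> .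
  - by move=> _ ->.
rewrite sum_insert /total_weight mulr_sumr; apply: eq_bigr => x okx.
have /data_okP[flipK lE _ _ _] := okx.
rewrite -big_mkcond /= (eq_bigl (fun y => sflip x y == y)); last first.
  by move=> y; rewrite insert_flip1; case: (eqVneq (sflip x y) y) => // _; rewrite eqxx.
under eq_bigr do rewrite insert_weight.
by rewrite sumr_const mulr_natl -lE; congr (_ *+ _); exact: eq_card.
Qed.
End SumInsert.

(** * The recursion for labelled sums *)

Lemma card_bij (T T' : finType) : #|T| = #|T'| ->
  exists f : T -> T', exists2 f' : T' -> T, cancel f f' & cancel f' f.
Proof.
move=> E; exists (fun x => enum_val (cast_ord E (enum_rank x))).
exists (fun y => enum_val (cast_ord (esym E) (enum_rank y))) => x.
  by rewrite enum_valK cast_ordK enum_rankK.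
by rewrite enum_valK cast_ordKV enum_rankK.
Qed.

Lemma card_bij_None (T T' : finType) (t : T) : #|T| = #|T'|.+1 ->
  exists f : T -> option T', exists2 f' : option T' -> T,
    cancel f f' & cancel f' f /\ f t = None.
Proof.
rewrite -card_option => /card_bij[f [f' fK f'K]].
pose p := tperm (f t) None.
exists (p \o f); exists (f' \o p) => [x|] /=; first by rewrite tpermK fK.
by split=> [x|] /=; [rewrite f'K tpermK | rewrite tpermL].
Qed.

Lemma card_bij_H3 (T T' : finType) (a b c : T) : #|T| = #|T'|.+3 -> uniq [:: a; b; c] ->
  exists f : T -> option (option (option T')), exists2 f' : option (option (option T')) -> T,
    cancel f f' & cancel f' f /\ [/\ f a = None, f b = leg1 T' & f c = leg2 T'].
Proof.
rewrite -!card_option => /card_bij[f [f' fK f'K]].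
rewrite /= !inE negb_or => /andP[/andP[ab ac] /andP[bc _]].
have fi := can_inj fK.
pose p0 := tperm (f a) None.
pose p1 := tperm (p0 (f b)) (leg1 T').
pose p2 := tperm (p1 (p0 (f c))) (leg2 T').
have b0 : p0 (f b) != None by rewrite -[None](tpermL (f a)) (inj_eq perm_inj) (inj_eq fi) eq_sym.
have c0 : p0 (f c) != None by rewrite -[None](tpermL (f a)) (inj_eq perm_inj) (inj_eq fi) eq_sym.
have p1N : p1 None = None by rewrite tpermD.
have c1 : p1 (p0 (f c)) != None by rewrite -p1N (inj_eq perm_inj).
have c2 : p1 (p0 (f c)) != leg1 T'.
  by rewrite -[leg1 T'](tpermL (p0 (f b))) !(inj_eq perm_inj) (inj_eq fi) eq_sym.
exists (fun x => p2 (p1 (p0 (f x)))); exists (fun y => f' (p0 (p1 (p2 y)))) => [x|] /=.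
  by rewrite !tpermK fK.
split=> [x|] /=; first by rewrite f'K !tpermK.
split.
- by rewrite /p0 tpermL p1N tpermD.
- by rewrite /p1 tpermL tpermD.
- by rewrite /p2 tpermL.
Qed.

Section Recursion.
Variables (N g : nat).
Hypothesis g2 : (2 <= g)%N.
Local Notation structure := (structure N).
Local Notation okstr := (okstr g).
Local Notation total_weight := (total_weight N g).

Section Fixed.
Variables (V H : finType).
Implicit Types (x : structure V H) (h : H).

(** The counterpart of [central] for arbitrary sets of vertices and half-edges. *)
Definition central_at v h0 h1 h2 x : bool :=
  [&& sflip x h0 == h0, sgen x v == 0%N &
      [forall k, (svert x k == v) == (k \in [:: h0; h1; h2])]].

(** The vertex of h is stable without h. *)
Definition stays h x : bool := (3 < 2 * sgen x (svert x h) + svalence x (svert x h))%N.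

Lemma sum_stays n h (H' : finType) : #|H| = #|H'|.+1 ->
  \sum_(x | okstr n.+1 x && ((sflip x h == h) && stays h x)) sweight x =
  (2 - (2 * g)%:R - n%:R) * total_weight n V H'.
Proof.
move=> /(card_bij_None h)[f [f' fK [f'K fh]]].
rewrite -sum_add_leg; apply/esym.
apply: (@sum_transport N g _ _ _ _ id id f f') => // x.
have idK : cancel (@id V) id by [].
have [i1 i2 i3] := transport_iso idK fK x.
rewrite -fh i2 (inj_eq (can_inj fK)) i1 /stays; congr (_ && (_ < _ + _)%N).
  by rewrite i3.
exact: (@transport_val N _ _ _ _ id id f f').
Qed.

Lemma sum_central_at n v h0 h1 h2 (V' H' : finType) : #|V| = #|V'|.+1 -> #|H| = #|H'|.+3 ->
  uniq [:: h0; h1; h2] ->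
  \sum_(x | okstr n.+1 x && central_at v h0 h1 h2 x) sweight x =
  (#|H'| + n)%:R * total_weight n V' H'.
Proof.
move=> /(card_bij_None v)[f [f' fK [f'K fv]]] cH u.
have [h [h' hK [h'K [e0 e1 e2]]]] := card_bij_H3 cH u.
rewrite -sum_central //; apply/esym.
apply: (@sum_transport N g _ _ _ _ f f' h h') => // x.
have [i1 i2 i3] := transport_iso fK hK x.
rewrite /central /central_at -{1 2}e0 i2 (inj_eq (can_inj hK)) -{1}fv i3.
have oldE k : ~~ is_old (h k) = (k \in [:: h0; h1; h2]).
  rewrite !inE -!(inj_eq (can_inj hK)) e0 e1 e2.
  by case: (h k) => [[[]|]|].
have vE k : (svert (transport f f' h h' x) (h k) == None) = (svert x k == v).
  by rewrite i1 -fv (inj_eq (can_inj fK)).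
congr [&& _, _ & _]; apply/forallP/forallP => E k.
  by have := E (h k); rewrite vE oldE.
by have := E (h' k); rewrite -vE -oldE h'K.
Qed.

(** A vertex that becomes unstable is of type (0,3) or (1,1).  In the second case
    it would be the whole graph, of genus 1.  In the first case the two other
    half-edges can be listed in two orders. *)
Lemma count_central n h0 x : okstr n.+1 x -> sflip x h0 = h0 ->
  #|[pred t : V * H * H | uniq [:: h0; t.1.2; t.2] && central_at t.1.1 h0 t.1.2 t.2 x]|
  = (if stays h0 x then 0 else 2)%N.
Proof.
move=> /data_okP[_ _ C st E] f0; pose v := svert x h0.
pose A := [set k | svert x k == v]%SET.
have cA : #|A| = svalence x v by rewrite /A cardsE.
have h0A : h0 \in A by rewrite inE.
have cent w h1 h2 : uniq [:: h0; h1; h2] -> central_at w h0 h1 h2 x ->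
    [/\ w = v, sgen x v = 0%N & A = [set h0; h1; h2]%SET].
  move=> u /and3P[_ /eqP gw /forallP ck].
  have wv : w = v by have := ck h0; rewrite !inE eqxx => /eqP/eqP <-.
  split=> //; first by rewrite -wv.
  by apply/setP => k; rewrite !inE -wv (eqP (ck k)) !inE orbA.
rewrite /stays -/v; case: ltnP => [big|small].
  apply: eq_card0 => -[[w h1] h2]; rewrite inE /=;
    apply/negbTE/negP => /andP[u /cent[//|_ g0 AE]].
  have : (#|A| <= 3)%N.
    rewrite AE (@eq_card _ _ (mem [:: h0; h1; h2])); first exact: (card_size [:: h0; h1; h2]).
    by move=> k; rewrite !inE orbA.
  by move: big; rewrite g0 -cA; lia.
have val3 : sgen x v = 0%N /\ #|A| = 3.
  have := st v; rewrite -/(svalence _ _) -cA in small *.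
  (* With genus 1 the half-edge h0 is alone at v, and v is the whole graph. *)
  have [g0|g1] : sgen x v = 0%N \/ sgen x v = 1%N by move: small; case: (sgen x v) => [|[|?]];
    lia.
    by move=> H0; split=> //; move: small H0; rewrite g0; lia.
  have A1 : #|A| = 1%N.
    by move: small; rewrite g1 (cardD1 h0) h0A; lia.
  have AE k : svert x k = v -> k = h0.
    move=> kv; have /eqP/cards1P[z zE] := A1; move: h0A; rewrite zE => /set1P ->.
    by have : k \in A; [rewrite inE kv | rewrite zE => /set1P].
  have reach u : connect (data_adj (svert x) (sflip x)) v u -> u = v.
    move=> /connectP[p]; elim: p => [|w p IH] /=; first by move=> _ ->.
    case/andP=> /existsP[k /andP[/eqP kv /eqP kw]] pp.
    have wv : w = v by rewrite -kw (AE k kv) f0.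
    by move: pp; rewrite wv; exact: IH.
  have allv u : u = v by apply: reach.
  have cV : #|V| = 1%N by rewrite -(card1 v); apply: eq_card => u; rewrite !inE (allv u) eqxx.
  have cH : #|H| = 1%N.
    rewrite -A1; apply: eq_card => k; rewrite !inE (allv (svert x k)) eqxx; exact: erefl.
  have sE : (\sum_u sgen x u = 1)%N.
    rewrite (bigD1 v) //= big1 ?addn0 // => u; by rewrite (allv u) eqxx.
  by move: E; rewrite sE cV cH; lia.
have [g0 A3] := val3.
have /cards2P[p [q [pq pqE]]] : (#|A :\ h0|%SET == 2)%N.
  by rewrite -(eqn_add2l (h0 \in A)) -cardsD1 A3 h0A.
have AE : A = [set h0; p; q]%SET by rewrite -finset.setUA -pqE finset.setD1K.
have uP a b : [set a; b]%SET = [set p; q]%SET -> a != b -> uniq [:: h0; a;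
  b] && central_at v h0 a b x.
  move=> abE ab; have h0n : h0 \notin [set a; b]%SET by rewrite abE -pqE !inE eqxx.
  rewrite /= !inE ab andbT /central_at f0 eqxx g0 eqxx /=; apply/andP; split.
    by move: h0n; rewrite !inE andbT.
  apply/forallP => k; rewrite -[svert x k == v]/(k \in [pred k | svert x k == v]).
  have : (k \in A) = (k \in h0 |: [set a; b]%SET) by rewrite abE -pqE finset.setD1K.
  by rewrite !inE => ->.
transitivity #|[set (v, p, q); (v, q, p)]%SET|; last first.
  by rewrite cards2 !xpair_eqE eqxx /= (negPf pq).
apply: eq_card => -[[w a] b]; rewrite inE /= !inE !xpair_eqE.
apply/idP/idP => [/andP[u ct]|].
  have u' : uniq [:: h0; a; b] by rewrite /= !inE.
  have [wv _ AE'] := cent w a b u' ct; rewrite wv eqxx /=.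
  have abE : [set a; b]%SET = [set p; q]%SET.
    rewrite -pqE AE' -finset.setUA finset.setU1K //.
    by move: u => /= /andP[]; rewrite ?inE.
  have /setP/(_ a) := abE; have /setP/(_ b) := abE.
  rewrite !inE !eqxx orbT /=.
  have ab : a != b by move: u => /=; rewrite ?inE => /and3P[_ -> _].
  move=> /esym/orP[/eqP bp|/eqP bq] /esym/orP[/eqP ap|/eqP aq].
  - by rewrite ap bp eqxx in ab.
  - by rewrite aq bp !eqxx orbT.
  - by rewrite ap bq !eqxx.
  - by rewrite aq bq eqxx in ab.
case/orP=> /andP[/andP[/eqP-> /eqP->] /eqP->].
  by have := uP p q erefl pq; rewrite /= !inE.
by have := uP q p (finset.setUC _ _); rewrite /= !inE eq_sym; apply.
Qed.

Lemma sum_not_stays n h0 :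
  2 * \sum_(x | okstr n.+1 x && ((sflip x h0 == h0) && ~~ stays h0 x)) sweight x =
  \sum_(t : V * H * H | uniq [:: h0; t.1.2; t.2])
     \sum_(x | okstr n.+1 x && central_at t.1.1 h0 t.1.2 t.2 x) sweight x.
Proof.
rewrite mulr_sumr; under [RHS]eq_bigr do rewrite big_mkcond.
rewrite exchange_big /=.
rewrite [LHS]big_mkcond; apply: eq_bigr => x _.
case okx : (okstr n.+1 x) => /=; last by rewrite big1.
case: (eqVneq (sflip x h0) h0) => [fh0|fh0] /=; last first.
  by rewrite big1 // => t _; rewrite /central_at (negPf fh0).
have := count_central okx fh0.
rewrite -big_mkcondr sumr_const => E.
rewrite (_ : #|_| = (if stays h0 x then 0 else 2)%N) //.
by case: (stays h0 x) => //=; rewrite mulr_natl.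
Qed.
End Fixed.

(** Both sides count graphs with a marked external edge, twice in order to list
    the two other half-edges at a central vertex. *)
Lemma total_weight_rec n a b :
  (2 * n.+1)%:R * total_weight n.+1 'I_a 'I_b =
  (2 * b)%:R * (2 - (2 * g)%:R - n%:R) * total_weight n 'I_a 'I_(b - 1) +
  (a * b * (b - 1) * (b - 2))%:R * (b - 3 + n)%:R * total_weight n 'I_(a - 1) 'I_(b - 3).
Proof.
have E : n.+1%:R * total_weight n.+1 'I_a 'I_b =
  \sum_(h : 'I_b) \sum_(x : structure 'I_a 'I_b | okstr n.+1 x && (sflip x h == h)) sweight x.
  rewrite /total_weight mulr_sumr; under [RHS]eq_bigr do rewrite big_mkcond.
  rewrite exchange_big /= [LHS]big_mkcond; apply: eq_bigr => x _.
  case okx : (okstr n.+1 x) => /=; last by rewrite big1.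
  rewrite -big_mkcond sumr_const; have /data_okP[_ <- _ _ _] := okx.
  by rewrite mulr_natl; congr (_ *+ _); apply: eq_card.
rewrite natrM -mulrA {}E.
have S2 h : \sum_(x : structure 'I_a 'I_b | okstr n.+1 x && (sflip x h == h)) sweight x =
   (2 - (2 * g)%:R - n%:R) * total_weight n 'I_a 'I_(b - 1) +
   \sum_(x : structure 'I_a 'I_b | okstr n.+1 x && ((sflip x h == h) && ~~ stays h x)) sweight x.
  rewrite (bigID (stays h)) /=; congr (_ + _); last by apply: eq_bigl => x; rewrite andbA.
  rewrite -(sum_stays 'I_a n h); last by rewrite !card_ord; have := ltn_ord h; lia.
  by apply: eq_bigl => x; rewrite andbA.
under eq_bigr do rewrite S2.
rewrite big_split /= mulrDr sumr_const card_ord; congr (_ + _).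
  by rewrite -[_ *+ b]mulr_natl natrM; ring.
rewrite mulr_sumr.
have S3 (h0 : 'I_b) :
  2 * \sum_(x : structure 'I_a 'I_b | okstr n.+1 x && ((sflip x h0 == h0) && ~~ stays h0 x))
    sweight x =
  (a * (b - 1) * (b - 2))%:R * ((b - 3 + n)%:R * total_weight n 'I_(a - 1) 'I_(b - 3)).
  rewrite sum_not_stays.
  rewrite (eq_bigr (fun=> (b - 3 + n)%:R * total_weight n 'I_(a - 1) 'I_(b - 3))); last first.
    move=> [[v h1] h2] u0; have u : uniq [:: h0; h1; h2] := u0.
    have b3 : (3 <= b)%N.
      have := max_card (mem [:: h0; h1; h2]).
      by rewrite card_ord (card_uniqP u).
    rewrite (sum_central_at (V' := 'I_(a - 1)) (H' := 'I_(b - 3)) n v) ?card_ord //.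
    - by have := ltn_ord v; lia.
    - by lia.
  rewrite sumr_const -[LHS]mulr_natl; congr (_%:R * _).
  have b0 : (0 < b)%N by exact: leq_trans (ltn_ord h0).
  rewrite -sum1_card.
  rewrite (eq_bigl (fun t : 'I_a * 'I_b * 'I_b => (h0 != t.1.2) && (t.2 \notin [:: h0;
    t.1.2]))); last first.
    move=> t; rewrite -topredE /= !inE !negb_or andbT -andbA; congr andb.
    by rewrite [h0 == t.2]eq_sym [t.1.2 == t.2]eq_sym.
  rewrite -(pair_big_dep (fun p : 'I_a * 'I_b => h0 != p.2) (fun p h2 => h2 \notin [:: h0;
    p.2]) (fun _ _ => 1%N)) /=.
  rewrite (eq_bigr (fun=> (b - 2)%N)) => [|p hp]; last first.
    have u2 : uniq [:: h0; p.2] by rewrite /= inE hp.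
    have := cardC (mem [:: h0; p.2]); rewrite card_ord (card_uniqP u2) /= => e.
    rewrite sum1_card; apply: (@addnI 2); rewrite subnKC; last by rewrite -e leq_addr.
    by rewrite -[RHS]e; congr addn; apply: eq_card => k; rewrite !inE.
  rewrite sum_nat_const; congr (_ * _)%N.
  transitivity #|[predX 'I_a & predC1 h0]|.
    by apply: eq_card => p; rewrite !inE eq_sym.
  by rewrite cardX cardC1 !card_ord subn1.
under eq_bigr do rewrite S3.
by rewrite sumr_const card_ord -[_ *+ b]mulr_natl !natrM; ring.
Qed.

End Recursion.

(** * Isomorphism classes as labelled graphs *)

(** A sum over Q is distributed over a finite type E that surjects to the support
    A by a functional relation; this also shows that the support is finite. *)
Lemma fsbig_rel (Q : choiceType) (E : finType) (M : nmodType) (P : pred E) (Rl : E -> Q -> bool)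
    (A : set Q) (F : Q -> M) (G : E -> M) :
  (forall e, P e -> exists C, A C /\ Rl e C) ->
  (forall C, A C -> exists e, P e /\ Rl e C) ->
  (forall e C C', Rl e C -> Rl e C' -> C = C') ->
  (forall C, A C -> \sum_(e | P e && Rl e C) G e = F C) ->
  \sum_(C \in A) F C = \sum_(e | P e) G e.
Proof.
move=> H1 H2 H3 H4.
have /choice[cl clP] : forall e, exists o : option Q, P e -> exists C, [/\ o =
  Some C, A C & Rl e C].
  move=> e; case Pe : (P e); last by exists None.
  by have [C [AC RC]] := H1 e Pe; exists (Some C) => _; exists C.
pose r := undup (pmap cl (enum P)).
have rP C : reflect (A C) (C \in r).
  rewrite mem_undup mem_pmap; apply: (iffP idP).
    case/mapP=> e; rewrite mem_enum => Pe; have [C' [-> AC' _]] := clP e Pe.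
    by move=> [->].
  move=> AC; have [e [Pe RC]] := H2 C AC; apply/mapP; exists e; first by rewrite mem_enum.
  by have [C' [-> _ RC']] := clP e Pe; rewrite (H3 _ _ _ RC RC').
have -> : A = [set` r]%classic by apply/seteqP; split=> C /rP.
rewrite -fsbig_seq ?undup_uniq //.
transitivity (\sum_(e | P e) \sum_(C <- r | Rl e C) G e); last first.
  apply: eq_bigr => e Pe; have [C [_ AC RC]] := clP e Pe.
  rewrite big_mkcond (bigD1_seq C) ?undup_uniq //=; last exact/rP.
  rewrite RC big1 ?addr0 // => C' CC'; case: ifP => // RC'.
  by rewrite (H3 _ _ _ RC' RC) eqxx in CC'.
rewrite (exchange_big_dep xpredT) //= big_seq [RHS]big_seq.
by apply: eq_bigr => C /rP AC; rewrite H4.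
Qed.

Section GraphToData.
Variable G : graph.
Local Notation V := 'I_(nvert G).
Local Notation H := 'I_(nhalf G).

Lemma card_legs : #|legs G| = #|[pred h | flip h == h :> H]|.
Proof. by rewrite cardsE. Qed.

Lemma edges_legs : (2 * #|edges G| + #|legs G| = nhalf G)%N.
Proof.
rewrite addnC -[RHS]card_ord -(cardsC (legs G)); congr addn.
rewrite -[RHS]sum1_card (partition_big_imset (fun h : H => [set h; flip h]%SET)) /=.
rewrite -/(edges G) mulnC -sum_nat_const; apply: eq_bigr => e /imsetP[h0 h0n ->].
rewrite sum1_card.
transitivity #|[set h0; flip h0]%SET|.
  by rewrite cards2; move: h0n; rewrite !inE eq_sym => ->.
apply: eq_card => h; rewrite [in RHS]unfold_in /=; apply/idP/andP => [|[_ /eqP <-]];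
  last by rewrite !inE eqxx.
rewrite !inE => /orP[/eqP-> | /eqP->]; first by move: h0n; rewrite !inE => ->.
rewrite flipK finset.setUC eqxx; split=> //.
by move: h0n; rewrite !inE eq_sym.
Qed.

Lemma n_comp1P (T : finType) (e : rel T) : connect_sym e ->
  reflect ((0 < #|T|)%N /\ forall u v, connect e u v) (n_comp e predT == 1%N).
Proof.
move=> sym; rewrite /n_comp_mem; apply: (iffP idP) => [/eqP/mem_card1[r rE]|[T0 C]].
  have rootE u : fingraph.root e u = r.
    by apply/eqP; have := rE (fingraph.root e u); rewrite !inE roots_root // => <-.
  split; first by apply/card_gt0P; exists r.
  by move=> u v; rewrite -(root_connect sym) !rootE.
have /card_gt0P[u _] := T0.
apply/eqP; rewrite -(card1 (fingraph.root e u)); apply: eq_card => v; rewrite !inE andbT /=.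
apply/eqP/eqP => [<-|->]; last exact: root_root.
by apply/eqP; rewrite (root_connect sym).
Qed.

Lemma graph_dataP g n : (2 <= g)%N ->
  [/\ connected_graph G, stable_graph G, graph_genus G = g%:Z & #|legs G| = n] <->
  data_ok (@vert G) (@flip G) (@vgenus G) g n.
Proof.
move=> g2.
have sym : connect_sym (@vertex_adj G).
  apply: sym_connect_sym => u v; apply/existsP/existsP => -[h /andP[h1 h2]];
    by exists (flip h); rewrite flipK h1 h2.
have val v : valence v = data_valence (@vert G) v by rewrite /valence cardsE.
have sumz : \sum_(v < nvert G) (vgenus v)%:Z = (\sum_(v < nvert G) vgenus v)%N%:Z.
  by rewrite -(big_morph Posz PoszD (erefl _)).
have el := edges_legs.
split=> [[cn st ge lg]|/data_okP[_ lg C st ge]].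
  have /(n_comp1P sym)[V0 C] := cn.
  apply/data_okP; split.
  - exact: flipK.
  - by rewrite -card_legs.
  - exact: C.
  - by move=> v; rewrite -val; exact: (forallP st v).
  - move: ge; rewrite /graph_genus /h1 sumz (eqP cn) !card_ord.
    by move: (\sum_(v < nvert G) vgenus v)%N => s; lia.
have V0 : (0 < nvert G)%N.
  rewrite lt0n; apply/eqP => V0.
  have H0 : nhalf G = 0%N.
    apply/eqP; rewrite -leqn0 leqNgt; apply/negP => H0.
    by have := ltn_ord (vert (Ordinal H0)); rewrite {2}V0.
  have s0 : (\sum_(v < nvert G) vgenus v = 0)%N.
    by rewrite big1 // => v; have := ltn_ord v; rewrite {2}V0.
  by move: ge; rewrite s0 !card_ord V0 H0; lia.
have cn : connected_graph G by apply/(n_comp1P sym); rewrite card_ord; split.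
split=> //.
- by apply/forallP => v; rewrite val.
- move: ge; rewrite /graph_genus /h1 sumz (eqP cn) !card_ord -lg -card_legs.
  by move: (\sum_(v < nvert G) vgenus v)%N => s; lia.
- by rewrite card_legs.
Qed.
End GraphToData.

(** * Counting the labellings of a graph *)

Section CountIso.
Variables (N : nat) (G : graph) (m : nat) (s : m.-tuple 'I_(nhalf G)).
Local Notation V := 'I_(nvert G).
Local Notation H := 'I_(nhalf G).
Hypothesis gN : forall v : V, (vgenus v <= N)%N.
Local Notation structure := (structure N).

Definition iso_at (e : structure V H * m.-tuple H) (q : {perm V} * {perm H}) : bool :=
  [&& [forall y, vert (q.2 y) == q.1 (svert e.1 y)],
      [forall y, flip (q.2 y) == q.2 (sflip e.1 y)],
      [forall v, vgenus (q.1 v) == sgen e.1 v] & map q.2 e.2 == s].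

Definition marked_aut : {set {perm V} * {perm H}} :=
  [set q : {perm V} * {perm H} | preserves q.1 q.2 && (map q.2 s == s)]%SET.

Lemma iso_atP (e : structure V H * m.-tuple H) (q : {perm V} * {perm H}) : reflect (data_iso
  (svert e.1) (sflip e.1) (sgen e.1)
   (@vert G) (@flip G) (@vgenus G) q.1 q.2 /\ map q.2 e.2 = s) (iso_at e q).
Proof.
apply: (iffP and4P) => [[h1 h2 h3 h4]|[[h1 h2 h3] h4]].
  split; last exact/eqP.
  by split=> x; apply/eqP; [exact: (forallP h1) | exact: (forallP h2) | exact: (forallP h3)].
by split; [apply/forallP=> x; apply/eqP.. | apply/eqP].
Qed.

(** The only marked structure from which the bijections q are an isomorphism to
    G. *)
Definition pull (q : {perm V} * {perm H}) : structure V H * m.-tuple H :=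
  (([ffun y => (q.1^-1)%g (vert (q.2 y))], [ffun y => (q.2^-1)%g (flip (q.2 y))],
    [ffun v => inord (vgenus (q.1 v))]), [tuple of map (q.2^-1)%g s]).

Lemma iso_at_pull e q : iso_at e q = (e == pull q).
Proof.
apply/iso_atP/eqP => [[[h1 h2 h3] h4]|->].
  case: e h1 h2 h3 h4 => -[[a b] c] t /= h1 h2 h3 h4; congr (_, _, _, _).
  - by apply/ffunP => y; rewrite ffunE h1 permK.
  - by apply/ffunP => y; rewrite ffunE h2 permK.
  - by apply/ffunP => v; rewrite ffunE h3 /sgen inord_val.
  - by apply: val_inj; rewrite /= -h4 -map_comp map_id_in // => z _ /=; rewrite permK.
split; first split=> y; rewrite ?/svert ?/sflip ?/sgen ?ffunE /= ?ffunE ?permKV //.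
  by rewrite inordK // ltnS.
by rewrite /= -map_comp map_id_in // => z _ /=; rewrite permKV.
Qed.

Lemma card_iso_at e q0 : iso_at e q0 -> #|[pred q | iso_at e q]| = #|marked_aut|.
Proof.
move=> /iso_atP[[h1 h2 h3] h4].
rewrite -!sum1_card (reindex (fun q : {perm V} * {perm H} => (q0.1 * q.1, q0.2 * q.2)%g)) /=.
  apply: eq_bigl => q; rewrite !inE.
  apply/iso_atP/andP => [[[i1 i2 i3] i4]|[/preservesP[i1 i2 i3] /eqP i4]] /=.
    split.
      apply/preservesP; split=> y.
      - have := i1 ((q0.2^-1)%g y); rewrite !permM permKV => ->; congr (q.1 _).
        by rewrite -h1 permKV.
      - have := i2 ((q0.2^-1)%g y); rewrite !permM permKV => ->; congr (q.2 _).
        by rewrite -h2 permKV.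
      - have := i3 ((q0.1^-1)%g y); rewrite !permM permKV => ->.
        by rewrite -h3 permKV.
    apply/eqP; rewrite -[in LHS]h4 -[in RHS]i4 -map_comp; apply: eq_map => z /=.
    by rewrite permM.
  split; first split=> y; rewrite /= ?permM.
  - by rewrite i1 h1.
  - by rewrite i2 h2.
  - by rewrite i3 h3.
  - rewrite -[in RHS]i4 -[in RHS]h4 -map_comp; apply: eq_map => z /=.
    by rewrite permM.
exists (fun q : {perm V} * {perm H} => (q0.1^-1 * q.1, q0.2^-1 * q.2)%g) => q _ /=.
  by case: q => a b /=; rewrite !mulKg.
by case: q => a b /=; rewrite !mulKVg.
Qed.

(** The pairs of a marked structure isomorphic to G and an isomorphism are counted
    twice: the isomorphisms from a given structure form a coset of the
    automorphism group, and every pair of permutations is an isomorphism from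
    exactly one structure. *)
Lemma count_iso :
  (#|[pred e | [exists q, iso_at e q]]| * #|marked_aut| = (nvert G)`! * (nhalf G)`!)%N.
Proof.
rewrite -sum_nat_const.
transitivity (\sum_(e : structure V H * m.-tuple H) \sum_(q | iso_at e q) 1)%N.
  rewrite [LHS]big_mkcond; apply: eq_bigr => e _; rewrite inE sum1_card.
  case: existsP => [[q0 /card_iso_at <-]|no]; first exact: eq_card.
  by rewrite eq_card0 // => q; rewrite !inE; apply/negbTE/negP => Hq; case: no; exists q.
rewrite (exchange_big_dep xpredT) //=.
transitivity (\sum_(q : {perm V} * {perm H}) 1)%N.
  by apply: eq_bigr => q _; rewrite (eq_bigl (pred1 (pull q))) ?big_pred1_eq // => e;
    rewrite iso_at_pull.
rewrite sum1_card (eq_card (B := predX {perm V} {perm H})); last by [].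
by rewrite cardX !card_Sn.
Qed.
End CountIso.

Lemma perm_of_bij (T : finType) (f : T -> T) : bijective f -> exists p : {perm T}, p =1 f.
Proof. by move=> /bij_inj fi; exists (perm fi) => x; rewrite permE. Qed.

Lemma chi_verticesE (G : graph) : chi_vertices G = data_weight (@vert G) (@vgenus G).
Proof. by apply: eq_bigr => v _; rewrite /valence cardsE. Qed.

(** * Sums over isomorphism classes *)

(** External edges are unnumbered in one of the sums over classes and numbered in
    the other.  Both are covered by classes Q of graphs with a list of m marked
    external edges, for m = 0 and m = n. *)
Section ClassSum.
Variables (N g n m A B : nat).
Hypotheses (g2 : (2 <= g)%N) (AB : (2 * g + n < A)%N) (BB : (6 * g + 3 * n < B)%N)
  (NB : (3 * g + 2 * n <= N)%N).
Local Notation structure := (structure N).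
Local Notation okstr := (okstr g).
Variables (Q : choiceType) (rp : Q -> graph) (sq : forall C, seq 'I_(nhalf (rp C))).
Variable Acl : set Q.

Definition ok_marked a b (e : structure 'I_a 'I_b * m.-tuple 'I_b) : bool :=
  okstr n e.1 && (all [pred h | sflip e.1 h == h] e.2 && uniq e.2).

Definition represents a b (e : structure 'I_a 'I_b * m.-tuple 'I_b) (C : Q) : bool :=
  `[< exists f : 'I_a -> 'I_(nvert (rp C)), exists h : 'I_b -> 'I_(nhalf (rp C)),
      [/\ bijective f, bijective h,
          data_iso (svert e.1) (sflip e.1) (sgen e.1)
            (@vert (rp C)) (@flip (rp C)) (@vgenus (rp C)) f h & map h e.2 = sq C] >].

Definition class_aut C : {set {perm 'I_(nvert (rp C))} * {perm 'I_(nhalf (rp C))}} :=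
  [set q : {perm 'I_(nvert (rp C))} * {perm 'I_(nhalf (rp C))} |
     preserves q.1 q.2 && (map q.2 (sq C) == sq C)]%SET.

Hypothesis Acl_ok : forall C, Acl C ->
  [/\ data_ok (@vert (rp C)) (@flip (rp C)) (@vgenus (rp C)) g n,
      size (sq C) = m, uniq (sq C) & all [pred h | flip h == h] (sq C)].
Hypothesis Acl_ex : forall a b (e : structure 'I_a 'I_b * m.-tuple 'I_b), ok_marked e ->
  exists C, Acl C /\ represents e C.
Hypothesis rp_inj : forall a b (e : structure 'I_a 'I_b * m.-tuple 'I_b) C C',
  represents e C -> represents e C' -> C = C'.

Variables (M : lmodType rat) (psi : nat -> nat -> M).

Lemma represents_ok C a b (e : structure 'I_a 'I_b * m.-tuple 'I_b) :
  Acl C -> represents e C -> ok_marked e.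
Proof.
move=> AC; have [ok sz us als] := Acl_ok AC.
move=> /asboolP[f [h [bf bh i1 i2]]]; apply/and3P; split.
- by move: ok; rewrite (iso_ok g n bf bh i1).
- apply/allP => y ye /=; have /allP/(_ (h y)) := als.
  rewrite -i2 map_f // => /(_ isT) /=; have [_ j2 _] := i1.
  by rewrite j2 (inj_eq (bij_inj bh)).
- by move: us; rewrite -i2 map_inj_uniq //; exact: bij_inj.
Qed.

Lemma sum_represents C a b : Acl C ->
  \sum_(e : structure 'I_a 'I_b * m.-tuple 'I_b | ok_marked e && represents e C)
     (sweight e.1 / (a`! * b`!)%:R) *: psi a b =
  if (a == nvert (rp C)) && (b == nhalf (rp C)) then
    (chi_vertices (rp C) / #|class_aut C|%:R) *: psi (nvert (rp C)) (nhalf (rp C)) else 0.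
Proof.
move=> AC; have [ok sz us als] := Acl_ok AC.
case: ifP => [/andP[/eqP-> /eqP->]|ab]; last first.
  rewrite big1 // => e /andP[_ /asboolP[f [h [bf bh _ _]]]].
  have := bij_eq_card bf; have := bij_eq_card bh; rewrite !card_ord => eb ea.
  by rewrite ea eb !eqxx in ab.
have gN (v : 'I_(nvert (rp C))) : (vgenus v <= N)%N.
  by apply: (leq_trans (data_genus_bound ok v)).
pose s : m.-tuple _ := Tuple (introT eqP sz).
have repE e : represents e C = [exists q, iso_at s e q].
  apply/asboolP/existsP => [[f [h [bf bh i1 i2]]]|[q /iso_atP[i1 i2]]].
    have [p pE] := perm_of_bij bf; have [r rE] := perm_of_bij bh.
    exists (p, r); apply/iso_atP; have [j1 j2 j3] := i1; split.
      by split=> y /=; rewrite ?pE ?rE.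
    by rewrite /= (eq_map rE).
  exists q.1, q.2; split=> //; [exact: (Bijective (permK _) (permKV _)).. ].
have wE e : represents e C -> sweight e.1 = chi_vertices (rp C).
  move=> /asboolP[f [h [bf bh i1 _]]].
  by rewrite chi_verticesE (iso_weight bf bh i1).
rewrite (eq_bigl (fun e => represents e C)); last first.
  by move=> e; apply/andP/idP => [[]//|re]; rewrite (represents_ok AC re).
rewrite (eq_bigr (fun=> (chi_vertices (rp C) / ((nvert (rp C))`! * (nhalf (rp C))`!)%:R) *:
    psi (nvert (rp C)) (nhalf (rp C)))); last by move=> e re; rewrite wE.
rewrite sumr_const -scaler_nat scalerA; congr (_ *: _).
have := count_iso s gN; rewrite -[marked_aut s]/(class_aut C) => <-.
rewrite (eq_card (B := [pred e | [exists q, iso_at s e q]])); last by move=> e; rewrite inE -repE.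
set c := #|_|; set d := #|class_aut C|.
have d0 : d%:R != 0 :> rat.
  rewrite pnatr_eq0 -lt0n; apply/card_gt0P; exists (1%g, 1%g); rewrite inE /=.
  apply/andP; split; last by apply/eqP; rewrite map_id_in // => z _; rewrite perm1.
  by apply/preservesP; split=> x; rewrite !perm1.
have c0 : c%:R != 0 :> rat.
  have : (0 < c * d)%N by rewrite count_iso // muln_gt0 !fact_gt0.
  by rewrite muln_gt0 pnatr_eq0 -lt0n => /andP[].
by rewrite natrM; field; rewrite c0 d0.
Qed.

(** A structure with n external edges has n (n-1) ... (n-m+1) lists of m distinct
    marked ones. *)
Lemma class_sum :
  \sum_(C \in Acl)
     (chi_vertices (rp C) / #|class_aut C|%:R) *: psi (nvert (rp C)) (nhalf (rp C)) =
  \sum_(a < A) \sum_(b < B) \sum_(x : structure 'I_a 'I_b | okstr n x)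
    ((n ^_ m)%:R * sweight x / (a`! * b`!)%:R) *: psi a b.
Proof.
pose E := {i : 'I_A * 'I_B & (structure 'I_i.1 'I_i.2 * m.-tuple 'I_i.2)%type}.
rewrite (@fsbig_rel _ E _ (fun e => ok_marked (tagged e)) (fun e C => represents (tagged e) C)
  _ _ (fun e => (sweight (tagged e).1 / ((tag e).1`! * (tag e).2`!)%:R) *: psi (tag e).1 (tag
    e).2)).
- rewrite -(sig_big_dep xpredT
    (fun (i : 'I_A * 'I_B) (e : structure 'I_i.1 'I_i.2 * m.-tuple 'I_i.2) => ok_marked e)
    (fun (i : 'I_A * 'I_B) (e : structure 'I_i.1 'I_i.2 * m.-tuple 'I_i.2) => (sweight e.1 /
      (i.1`! * i.2`!)%:R) *: psi i.1 i.2)) /=.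
  rewrite pair_bigA /=; apply: eq_bigr => -[a b] _ /=.
  rewrite -(pair_big_dep (fun x : structure 'I_a 'I_b => okstr n x)
     (fun (x : structure 'I_a 'I_b) (t : m.-tuple 'I_b) => all [pred h | sflip x h == h]
       t && uniq t)
     (fun (x : structure 'I_a 'I_b) (t : m.-tuple 'I_b) => (sweight x / (a`! * b`!)%:R) *: psi
       a b)) /=.
  apply: eq_bigr => x okx; rewrite sumr_const -scaler_nat scalerA mulrA;
    congr (_%:R * _ / _ *: _).
  have /data_okP[_ <- _ _ _] := okx; rewrite -card_uniq_tuples cardsE.
  by apply: eq_card => t.
- by move=> [i e] /= oke; exact: Acl_ex.
- move=> C AC; have [ok sz us als] := Acl_ok AC.
  have a1 : (nvert (rp C) < A)%N.
    by have := data_card_vertex ok; rewrite card_ord; lia.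
  have b1 : (nhalf (rp C) < B)%N.
    by have := data_card_half ok; rewrite card_ord; lia.
  have gN (v : 'I_(nvert (rp C))) : (vgenus v <= N)%N.
    by apply: (leq_trans (data_genus_bound ok v)).
  pose s : m.-tuple _ := Tuple (introT eqP sz).
  pose i0 : 'I_A * 'I_B := (Ordinal a1, Ordinal b1).
  pose e0 := pull N s (1%g, 1%g).
  have e0P : iso_at s e0 (1%g, 1%g) by rewrite iso_at_pull.
  have R0 : represents e0 C.
    have /iso_atP[i1 i2] := e0P.
    by apply/asboolP; exists (1%g : {perm _}), (1%g : {perm _}); split=> //;
      exact: (Bijective (permK _) (permKV _)).
  by exists (existT _ i0 e0); split=> //=; exact: represents_ok AC R0.
- by move=> [i e] C C' /=; exact: rp_inj.
- move=> C AC.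
  rewrite -(sig_big_dep xpredT
    (fun (i : 'I_A * 'I_B) (e : structure 'I_i.1 'I_i.2 * m.-tuple 'I_i.2) => ok_marked e &&
      represents e C)
    (fun (i : 'I_A * 'I_B) (e : structure 'I_i.1 'I_i.2 * m.-tuple 'I_i.2) => (sweight e.1 /
      (i.1`! * i.2`!)%:R) *: psi i.1 i.2)) /=.
  have [ok _ _ _] := Acl_ok AC.
  have a1 : (nvert (rp C) < A)%N.
    by have := data_card_vertex ok; rewrite card_ord; lia.
  have b1 : (nhalf (rp C) < B)%N.
    by have := data_card_half ok; rewrite card_ord; lia.
  under eq_bigr => i _ do rewrite sum_represents //.
  rewrite (bigD1 (Ordinal a1, Ordinal b1)) //= !eqxx /= big1 ?addr0 // => -[a b] /= ne.
  rewrite ifF //; apply: contraNF ne => /andP[/eqP ea /eqP eb].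
  by apply/eqP; congr pair; apply: val_inj.
Qed.
End ClassSum.

Local Open Scope quotient_scope.

Definition structure_graph N a b (x : structure N 'I_a 'I_b) (xK : involutive (sflip x)) :
  graph :=
  @Graph a b (svert x) (sflip x) xK (sgen x).

Lemma preserves_dataP (G1 G2 : graph) f h :
  reflect (data_iso (@vert G1) (@flip G1) (@vgenus G1) (@vert G2) (@flip G2) (@vgenus G2) f h)
    (preserves f h).
Proof. by apply: (iffP (preservesP f h)) => -[]. Qed.

Lemma iso_comp (V H V' H' V'' H'' : finType) (vf : H -> V) (ff : H -> H) (gf : V -> nat)
    (vf' : H' -> V') (ff' : H' -> H') (gf' : V' -> nat)
    (vf'' : H'' -> V'') (ff'' : H'' -> H'') (gf'' : V'' -> nat) f h f' h' :
  data_iso vf ff gf vf' ff' gf' f h -> data_iso vf' ff' gf' vf'' ff'' gf'' f' h' ->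
  data_iso vf ff gf vf'' ff'' gf'' (f' \o f) (h' \o h).
Proof.
move=> [i1 i2 i3] [j1 j2 j3]; split=> x /=; first by rewrite j1 i1.
  by rewrite j2 i2.
by rewrite j3 i3.
Qed.

Section Instances.
Variables (N g n A B : nat).
Hypotheses (g2 : (2 <= g)%N) (AB : (2 * g + n < A)%N) (BB : (6 * g + 3 * n < B)%N)
  (NB : (3 * g + 2 * n <= N)%N).

(** A structure with b half-edges and n external edges has (b-n)/2 internal
    edges. *)
Lemma chi_tilde_sum : chi_tilde g n =
  \sum_(a < A) \sum_(b < B) \sum_(x : structure N 'I_a 'I_b | okstr g n x)
     (sweight x / (a`! * b`!)%:R) *: 'X^((b - n)./2).
Proof.
pose rp (C : graph_class) : graph := repr C.
pose sq (C : graph_class) : seq 'I_(nhalf (rp C)) := [::].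
have autE C : @class_aut _ rp sq C = graph_aut (rp C).
  by apply/setP => q; rewrite !inE eqxx andbT.
have := @class_sum N g n 0 A B g2 AB BB NB _ rp sq (Gc g n) _ _ _ _ (fun a b => 'X^((b - n)./2)
  : {poly rat}).
rewrite ffactn0 => H.
under [RHS]eq_bigr do under eq_bigr do under eq_bigr do rewrite -[sweight _]mul1r.
rewrite -H => [|C /graph_dataP okC|a b e /andP[oke _]|a b e C C'].
- apply: eq_fsbigr => C; rewrite inE => -[_ _ _ lg]; rewrite autE; congr (_ *: 'X^_).
  by have := edges_legs (rp C); rewrite -/(rp C) in lg *; rewrite lg; lia.
- by split=> //; exact: okC.
- have xK : involutive (sflip e.1) by have /data_okP[] := oke.
  pose G := structure_graph xK; exists (\pi_graph_class G).
  have /eqquotP/asboolP[f [h [bf bh /preserves_dataP i]]] :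
     G = rp (\pi_graph_class G) %[mod graph_class] by rewrite /rp reprK.
  split.
    apply/graph_dataP => //; rewrite (iso_ok g n bf bh i); exact: oke.
  apply/asboolP; exists f, h; split=> //.
  by rewrite (tuple0 e.2).
- move=> /asboolP[f [h [[f' fK f'K] [h' hK h'K] i _]]] /asboolP[f2 [h2 [bf2 bh2 i2 _]]].
  rewrite -[C]reprK -[C']reprK; apply/eqquotP/asboolP.
  exists (f2 \o f'), (h2 \o h'); split.
  + by apply: bij_comp => //; exists f.
  + by apply: bij_comp => //; exists h.
  + by apply/preserves_dataP; apply: iso_comp i2; exact: iso_inv i.
Qed.

(** All n external edges are marked, in n! orders. *)
Lemma chi_Mbar_sum : chi_Mbar g n =
  \sum_(a < A) \sum_(b < B) \sum_(x : structure N 'I_a 'I_b | okstr g n x)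
     n`!%:R * (sweight x / (a`! * b`!)%:R).
Proof.
pose rp (C : lgraph_class n) : graph := (repr C : lgraph n).
pose sq (C : lgraph_class n) : seq 'I_(nhalf (rp C)) := codom (mark (repr C)).
have autE C : @class_aut _ rp sq C = lgraph_aut (repr C : lgraph n).
  apply/setP => q; rewrite !inE; congr andb.
  rewrite /sq codomE -map_comp; apply/eqP/forallP => [/eq_in_map E i|E].
    by apply/eqP; exact: E (mem_enum _ _).
  by apply: eq_map => i; apply/eqP; exact: E.
have legE (G : lgraph n) : #|legs G| = n.
  by rewrite -(eq_card (@mark_legs n G)) card_codom ?card_ord //; exact: mark_inj.
have := @class_sum N g n n A B g2 AB BB NB _ rp sq (lGc g n) _ _ _ rat^o (fun a b => 1).
rewrite ffactnn => H.
transitivity (\sum_(a < A) \sum_(b < B) \sum_(x : structure N 'I_a 'I_b | okstr g n x)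
     (n`!%:R * sweight x / (a`! * b`!)%:R) *: (1 : rat^o)); last first.
  apply: eq_bigr => a _; apply: eq_bigr => b _; apply: eq_bigr => x _.
  by rewrite mulrA; exact: mulr1.
rewrite -H => [|C [cn st ge]|a b e /and3P[oke al un]|a b e C C'].
- apply: eq_fsbigr => C _; rewrite autE; exact/esym/mulr1.
- split.
  + apply/graph_dataP => //; split=> //; exact: legE.
  + by rewrite size_codom card_ord.
  + by rewrite /sq codomE map_inj_uniq ?enum_uniq //; exact: mark_inj.
  + by apply/allP => h; rewrite /sq (@mark_legs n) => hl; move: hl; rewrite finset.in_set.
- have xK : involutive (sflip e.1) by have /data_okP[] := oke.
  pose G0 := structure_graph xK.
  have mi : injective (tnth e.2 : 'I_n -> 'I_(nhalf G0)) by apply/tuple_uniqP.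
  have ml : codom (tnth e.2 : 'I_n -> 'I_(nhalf G0)) =i legs G0.
    have -> : codom (tnth e.2 : 'I_n -> 'I_(nhalf G0)) = e.2 by rewrite codomE map_tnth_enum.
    apply/subset_cardP; last by apply/fintype.subsetP => y ye; rewrite inE; exact: (allP al).
    by rewrite (card_uniqP un) size_tuple card_legs; have /data_okP[] := oke.
  pose G := @LGraph n G0 (tnth e.2) mi ml; exists (\pi_(lgraph_class n) G).
  have /eqquotP/asboolP[f [h [bf bh /preserves_dataP i hm]]] :
     G = repr (\pi_(lgraph_class n) G) %[mod lgraph_class n] by rewrite reprK.
  split.
    have : data_ok (@vert (rp (\pi_(lgraph_class n) G))) (@flip (rp (\pi_(lgraph_class n) G)))
       (@vgenus (rp (\pi_(lgraph_class n) G))) g n.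
      by rewrite (iso_ok g n bf bh i); exact: oke.
    by move=> /(graph_dataP _ _ g2)[].
  apply/asboolP; exists f, h; split=> //.
  by rewrite /sq codomE -(eq_map hm) -[in LHS](map_tnth_enum e.2) -map_comp.
- move=> /asboolP[f [h [[f' fK f'K] [h' hK h'K] i m1]]] /asboolP[f2 [h2 [bf2 bh2 i2 m2]]].
  rewrite -[C]reprK -[C']reprK; apply/eqquotP/asboolP.
  exists (f2 \o f'), (h2 \o h'); split.
  + by apply: bij_comp => //; exists f.
  + by apply: bij_comp => //; exists h.
  + by apply/preserves_dataP; apply: iso_comp i2; exact: iso_inv i.
  + have mE G (k : 'I_b -> 'I_(nhalf G)) (u : 'I_n -> 'I_(nhalf G)) :
        map k e.2 = codom u -> forall j, k (tnth e.2 j) = u j.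
      rewrite codomE -[in LHS](map_tnth_enum e.2) -map_comp => /eq_in_map E j.
      exact: E (mem_enum _ _).
    by move=> j /=; rewrite -(mE _ _ _ m1) hK (mE _ _ _ m2).
Qed.
End Instances.

(** * The recursion for the coefficients *)

Section Coefficients.
Variable g : nat.
Hypothesis g2 : (2 <= g)%N.

(** The bound on the number k of edges is that of the dimension 3g - 3 + n. *)
Lemma okstr_halves N n a b (x : structure N 'I_a 'I_b) : okstr g n x ->
  exists2 k, b = (n + 2 * k)%N & (k <= 3 * g - 3 + n)%N.
Proof.
move=> ok; have := data_card_vertex ok; have /data_okP[_ lg _ _ ge] := ok.
have : (n <= b)%N by rewrite -lg -[X in (_ <= X)%N]card_ord max_card.
move: ge; rewrite !card_ord; move: (\sum_v _)%N => S ge nb av.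
by exists ((b - n)./2); lia.
Qed.

Lemma total_weight_eq0 N n a b :
  (forall k, b = (n + 2 * k)%N -> (3 * g - 3 + n < k)%N) ->
  total_weight N g n 'I_a 'I_b = 0.
Proof.
move=> H; rewrite /total_weight big1 // => x ok.
by have [k bE kn] := okstr_halves ok; have := H k bE; rewrite ltnNge kn.
Qed.

Lemma a_coefE N n k A : (2 * g + n < A)%N -> (3 * g + 2 * n <= N)%N ->
  a_coef g n k = \sum_(a < A) total_weight N g n 'I_a 'I_(n + 2 * k) / (a`! * (n + 2 * k)`!)%:R.
Proof.
move=> AB NB; pose B := (6 * g + 3 * n + n + 2 * k).+1.
rewrite /a_coef (chi_tilde_sum (A := A) (B := B) g2 AB _ NB) /B; last by lia.
rewrite coef_sum; apply: eq_bigr => a _; rewrite coef_sum.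
have kB : (n + 2 * k < B)%N by rewrite /B; lia.
rewrite (bigD1 (Ordinal kB)) //= [X in _ + X]big1 ?addr0 => [|b bk]; last first.
  rewrite coef_sum big1 // => x ok; rewrite coefZ coefXn.
  have [j bE _] := okstr_halves ok; case: eqP => [kE|]; last by rewrite mulr0.
  by case/eqP: bk; apply: val_inj => /=; rewrite kE bE addKn !mul2n doubleK.
rewrite coef_sum /total_weight mulr_suml; apply: eq_bigr => x _.
by rewrite coefZ coefXn (_ : k == _) ?mulr1 // addKn mul2n doubleK.
Qed.

Lemma a_coef_eq0 n k : (3 * g - 3 + n < k)%N -> a_coef g n k = 0.
Proof.
move=> kn; rewrite (@a_coefE (3 * g + 2 * n) n k (2 * g + n).+1) //.
by rewrite big1 // => a _; rewrite total_weight_eq0 ?mul0r // => j; lia.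
Qed.

Lemma chi_Mbar_a_coef n :
  chi_Mbar g n = n`!%:R * \sum_(0 <= k < (3 * g - 3 + n).+1) a_coef g n k.
Proof.
have AB : (2 * g + n < (2 * g + n).+1)%N by [].
have BB : (6 * g + 3 * n < (6 * g + 3 * n).+1)%N by [].
have NB : (3 * g + 2 * n <= 3 * g + 2 * n)%N by [].
have -> : \sum_(0 <= k < (3 * g - 3 + n).+1) a_coef g n k = (chi_tilde g n).[1].
  rewrite (@horner_coef_wide _ (3 * g - 3 + n).+1); last first.
    by apply/leq_sizeP => k kn; exact: a_coef_eq0.
  by rewrite big_mkord; apply: eq_bigr => k _; rewrite expr1n mulr1.
rewrite (chi_Mbar_sum g2 AB BB NB) (chi_tilde_sum g2 AB BB NB).
rewrite horner_sum mulr_sumr; apply: eq_bigr => a _.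
rewrite horner_sum mulr_sumr; apply: eq_bigr => b _.
rewrite horner_sum mulr_sumr; apply: eq_bigr => x _.
by rewrite hornerZ hornerXn expr1n mulr1.
Qed.

(** Clears the orders D and D' of the symmetric groups by which the labelled sums
    W are divided. *)
Lemma rescale (r W D D' b : rat) : D' != 0 -> D = b * D' -> r * (W / D') * (2 * D) =
  2 * b * r * W.
Proof. by move=> D0 ->; field. Qed.

Lemma fact2_neq0 a b : (a`! * b`!)%:R != 0 :> rat.
Proof. by rewrite pnatr_eq0 -lt0n muln_gt0 !fact_gt0. Qed.

Section Recursion.
Variable n : nat.
Let N := (3 * g + 2 * n.+1)%N.
Let w m a b : rat := total_weight N g m 'I_a 'I_b / (a`! * b`!)%:R.

Lemma weight_rec0 a :
  n.+1%:R * w n.+1 a n.+1 = (2 - (2 * g)%:R - n%:R) * w n a n.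
Proof.
have := total_weight_rec N g2 n a n.+1; rewrite subn1 /=.
have -> : (a * n.+1 * n * (n.+1 - 2))%:R * (n.+1 - 3 + n)%:R
    * total_weight N g n 'I_(a - 1) 'I_(n.+1 - 3) = 0 :> rat.
  have [n2|n2] := ltnP n 2.
    by rewrite (_ : a * n.+1 * n * (n.+1 - 2) = 0)%N ?mul0r //; apply/eqP; rewrite !muln_eq0; lia.
  by rewrite total_weight_eq0 ?mulr0 // => j; lia.
rewrite addr0 /w => E.
apply: (@mulIf _ (2 * (a`! * n.+1`!)%:R)); first by rewrite mulf_neq0 // fact2_neq0.
rewrite (@rescale _ _ _ _ 1) ?fact2_neq0 ?mul1r // mulr1 -natrM E.
rewrite (@rescale _ _ _ _ n.+1%:R) ?fact2_neq0 //; last by rewrite factS mulnCA natrM.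
by rewrite natrM.
Qed.

Lemma weight_recS a b :
  n.+1%:R * w n.+1 a.+1 b.+3 = (2 - (2 * g)%:R - n%:R) * w n a.+1 b.+2
    + (b + n)%:R / 2 * w n a b.
Proof.
have := total_weight_rec N g2 n a.+1 b.+3.
have -> : (b.+3 - 1 = b.+2)%N by [].
have -> : (b.+3 - 2 = b.+1)%N by [].
have -> : (b.+3 - 3 = b)%N by rewrite !subSS subn0.
rewrite subn1 /= /w => E.
apply: (@mulIf _ (2 * (a.+1`! * b.+3`!)%:R)); first by rewrite mulf_neq0 // fact2_neq0.
rewrite (@rescale _ _ _ _ 1) ?fact2_neq0 ?mul1r // mulr1 -natrM E [RHS]mulrDl.
rewrite (@rescale _ _ _ _ b.+3%:R) ?fact2_neq0 //; last by rewrite [b.+3`!]factS mulnCA natrM.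
rewrite (@rescale _ _ _ _ (a.+1 * b.+3 * b.+2 * b.+1)%:R) ?fact2_neq0 //; last first.
  by rewrite !factS -natrM; congr _%:R; ring.
rewrite [(2 * _)%:R]natrM; by congr (_ + _ * _); field.
Qed.

Lemma weight_recS0 b :
  n.+1%:R * w n.+1 0 b.+1 = (2 - (2 * g)%:R - n%:R) * w n 0 b.
Proof.
have := total_weight_rec N g2 n 0 b.+1; rewrite subn1 !mul0n !mul0r addr0 /= /w => E.
apply: (@mulIf _ (2 * (0`! * b.+1`!)%:R)); first by rewrite mulf_neq0 // fact2_neq0.
rewrite (@rescale _ _ _ _ 1) ?fact2_neq0 ?mul1r // mulr1 -natrM E.
rewrite (@rescale _ _ _ _ b.+1%:R) ?fact2_neq0 //; last by rewrite [b.+1`!]factS mulnCA natrM.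
by rewrite natrM.
Qed.

Lemma a_coef_rec0 : n.+1%:R * a_coef g n.+1 0 = (2 - (2 * g)%:R - n%:R) * a_coef g n 0.
Proof.
pose A := (2 * g + n.+1).+1.
rewrite (@a_coefE N n.+1 0 A) ?(@a_coefE N n 0 A) //; [|rewrite /A; lia|rewrite /N; lia].
rewrite !mulr_sumr; apply: eq_bigr => a _.
rewrite !muln0 !addn0; exact: weight_rec0.
Qed.

(** With n + 2k half-edges, the factor (b + n)/2 of the labelled recursion is
    n + k: the number of internal and external edges that can be subdivided. *)
Lemma a_coef_recS k : n.+1%:R * a_coef g n.+1 k.+1 =
  (2 - (2 * g)%:R - n%:R) * a_coef g n k.+1 + (n + k)%:R * a_coef g n k.
Proof.
pose A := (2 * g + n.+1).+1.
rewrite (@a_coefE N n.+1 k.+1 A.+1) ?(@a_coefE N n k.+1 A.+1) ?(@a_coefE N n k A) //;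
  try (rewrite /A /N; lia).
rewrite !mulr_sumr big_ord_recl [X in _ = X + _]big_ord_recl -addrA; congr (_ + _).
  have -> : (n.+1 + 2 * k.+1 = (n + 2 * k.+1).+1)%N by lia.
  exact: weight_recS0.
rewrite -big_split; apply: eq_bigr => a _; rewrite lift0.
have -> : (n.+1 + 2 * k.+1 = (n + 2 * k).+3)%N by lia.
have -> : (n + 2 * k.+1 = (n + 2 * k).+2)%N by lia.
rewrite [LHS](weight_recS a (n + 2 * k)) /=; congr (_ + _ * _).
have -> : (n + 2 * k + n = 2 * (n + k))%N by lia.
by rewrite natrM; field.
Qed.
End Recursion.
End Coefficients.

Theorem theorem5p3 (R : realType) (g n : nat) (hg : (2 <= g)%N) :
  [/\ chi_Mbar g n = n`!%:R * \sum_(0 <= k < (3 * g - 3 + n).+1) a_coef g n k,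
      n`!%:R * \sum_(0 <= k < (3 * g - 3 + n).+1) ratr (a_coef g n k)
      = n`!%:R * taylor_coef (fun x : R =>
          \sum_(0 <= k < (3 * g - 3 + n).+1)
          \sum_(0 <= p < (3 * g - 3).+1)
            ratr (a_coef g 0 p) * A_fun g p k (ln (1 + x) - 1)) n
    & forall p k m : nat, (3 <= p)%N -> (p < k)%N -> (m <= k - p)%N ->
        acoef3 R g p k m = acoef3' R g p k m].
Proof.
split.
- exact: chi_Mbar_a_coef.
- congr (_ * _); apply: (taylor_coef_A_fun R hg (a := a_coef g)).
  + by move=> j; exact: a_coef_rec0.
  + by move=> j k; exact: a_coef_recS.
  + by move=> k kg; apply: a_coef_eq0 => //; rewrite addn0.
- by move=> p k m p3 pk mk; apply: acoef3_eq; lia.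
Qed.
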